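(* Let $X$ be a locally compact Hausdorff space, $(A,X,\mu_A)$ a $\sigma$-unital $C_0(X)$-algebra, $K$ a compactification of $X_A$ and $(A^\beta,K,\mu^K_{A^\beta})$ the associated compactification of $(A,X,\mu_A)$. Denoting by $\{A^\beta_y:y\in K\}$ the fibres of $(A^\beta,K,\mu^K_{A^\beta})$, the set $$\{y\in K\setminus X_A: A^\beta_y\neq\{0\}\}$$ is dense in $K\setminus X_A$.
   Context: For a C*-algebra $A$: $M(A)$ is its multiplier algebra, $ZM(A)$ the centre of $M(A)$, $\mathrm{Prim}(A)$ the primitive ideal space, and $\theta_A:C^b(\mathrm{Prim}(A))\to ZM(A)$ the Dauns-Hofmann isomorphism, $\theta_A(f)a+P=f(P)(a+P)$. A $C_0(X)$-algebra $(A,X,\mu_A)$ is a C*-algebra $A$ with a $*$-homomorphism $\mu_A:C_0(X)\to ZM(A)$ such that $\mu_A(C_0(X))A=A$ (a $C(X)$-algebra when $X$ is compact); it is $\sigma$-unital if $A$ is. Equivalently there is a continuous base map $\phi_A:\mathrm{Prim}(A)\to X$ with $\mu_A(f)=\theta_A(f\circ\phi_A)$. For $x\in X$: $J_x=\mu_A(\{f\in C_0(X):f(x)=0\})A$, $A_x=A/J_x$; $X_A=\mathrm{Im}(\phi_A)=\{x:A_x\ne0\}$ with the subspace topology. The algebra $A^\beta$. Let $\mu_{M(A)}:C(\beta X)\to ZM(A)$, $\mu_{M(A)}(f)=\theta_A(f|_X\circ\phi_A)$; for $x\in\beta X$ let $H_x=\mu_{M(A)}(\{f\in C(\beta X):f(x)=0\})M(A)$;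 put $A^\beta=\bigcap_{x\in X_A}(A+H_x)$, a closed ideal of $M(A)$ containing $A$. A compactification $K$ of $X_A$ is a compact Hausdorff space containing $X_A$ homeomorphically as a dense subspace; for such $K$, $\mu^K_{A^\beta}:C(K)\to ZM(A^\beta)$, $\mu^K_{A^\beta}(f)b=\theta_A(f|_{X_A}\circ\phi_A)\,b$, makes $(A^\beta,K,\mu^K_{A^\beta})$ a $C(K)$-algebra with fibres $A^\beta_y=A^\beta/\big(\mu^K_{A^\beta}(\{f\in C(K):f(y)=0\})A^\beta\big)$, $y\in K$. *)

(* Defs.v *)
From HB Require Import structures.
From mathcomp Require Import all_boot all_order all_algebra.
From mathcomp Require Import all_classical all_reals all_analysis.
From mathcomp Require Import complex.

Set Implicit Arguments.
Unset Strict Implicit.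
Unset Printing Implicit Defensive.

Import Order.TTheory GRing.Theory Num.Theory.
Import numFieldNormedType.Exports.

Local Open Scope classical_set_scope.
Local Open Scope ring_scope.

(* the usual topology of the complex numbers *)
HB.instance Definition _ (R : realType) := NormedModule.copy R[i] R[i]^o.

(* C*-algebras, not assumed to be unital (nor nonzero) *)

HB.mixin Record isCStarAlgebra (R : realType) A
    & CompleteNormedModule R[i] A := {
  cmul : A -> A -> A ;
  cstar : A -> A ;
  cmulA : associative cmul ;
  cmulDl : left_distributive cmul +%R ;
  cmulDr : right_distributive cmul +%R ;
  cmulZl : forall (k : R[i]) a b, cmul (k *: a) b = k *: cmul a b ;
  cmulZr : forall (k : R[i]) a b, cmul a (k *: b) = k *: cmul a b ;
  ler_normcM : forall a b, `|cmul a b| <= `|a| * `|b| ;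
  cstarK : involutive cstar ;
  cstarD : forall a b, cstar (a + b) = cstar a + cstar b ;
  cstarZ : forall (k : R[i]) a, cstar (k *: a) = k^* *: cstar a ;
  cstarM : forall a b, cstar (cmul a b) = cmul (cstar b) (cstar a) ;
  norm_cstarM : forall a, `|cmul (cstar a) a| = `|a| ^+ 2
}.

#[short(type="cstarAlgType")]
HB.structure Definition CStarAlgebra (R : realType) :=
  {A of CompleteNormedModule R[i] A & isCStarAlgebra R A}.

Infix "**" := cmul (at level 40, left associativity) : ring_scope.

HB.mixin Record isHilbert (R : realType) H & CompleteNormedModule R[i] H := {
  inner : H -> H -> R[i] ;
  innerDl : forall x y z, inner (x + y) z = inner x z + inner y z ;
  innerZl : forall (k : R[i]) x y, inner (k *: x) y = k * inner x y ;
  inner_conj : forall x y, inner y x = (inner x y)^* ;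
  inner_norm : forall x, inner x x = `|x| ^+ 2
}.

#[short(type="hilbertType")]
HB.structure Definition Hilbert (R : realType) :=
  {H of CompleteNormedModule R[i] H & isHilbert R H}.

Section CStarTheory.
Context {R : realType} {A : cstarAlgType R}.
Implicit Types (a b c : A).

Lemma cmul0l b : 0 ** b = 0.
Proof. by rewrite -{1}(scale0r (0 : A)) cmulZl scale0r. Qed.

Lemma cmul0r b : b ** 0 = 0.
Proof. by rewrite -{1}(scale0r (0 : A)) cmulZr scale0r. Qed.

Lemma cstar_norm_le a : `|a| <= `|cstar a|.
Proof.
have [->|a0] := eqVneq a 0; first by rewrite normr0.
have na0 : 0 < `|a| by rewrite normr_gt0.
by rewrite -(ler_pM2r na0) -expr2 -norm_cstarM ler_normcM.
Qed.

Lemma norm_cstar a : `|cstar a| = `|a|.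
Proof.
by apply/eqP; rewrite eq_le cstar_norm_le -{2}(cstarK a) cstar_norm_le.
Qed.

Lemma linear_lip_continuous (V W : normedModType R[i]) (f : V -> W) (M : R[i]) :
  (forall x y, f (x - y) = f x - f y) ->
  (forall x, `|f x| <= M * `|x|) -> continuous f.
Proof.
move=> fB fM x; apply/cvgrPdist_lt => e e0.
have M1 : 0 < `|M| + 1 by rewrite ltr_wpDl.
near=> y; rewrite -fB; apply: le_lt_trans (_ : (`|M| + 1) * `|x - y| < e).
  have Mxy := le_trans (normr_ge0 _) (fM (x - y)).
  rewrite -[`|f _|]ger0_norm// (le_trans (_ : _ <= `|M * `|x - y| |))//.
    by rewrite !ger0_norm.
  by rewrite normrM normr_id ler_wpM2r// lerDl.
rewrite mulrC -ltr_pdivlMr//; near: y.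
by apply: cvgr_dist_lt; rewrite ?divr_gt0//; exact: cvg_id.
Unshelve. all: by end_near. Qed.

Lemma cstar_continuous : continuous (@cstar R A).
Proof.
apply: (@linear_lip_continuous A A _ 1) => [x y|x].
  by rewrite cstarD -[- y]scaleN1r cstarZ rmorphN rmorph1 scaleN1r.
by rewrite mul1r norm_cstar.
Qed.

Lemma cmull_continuous a : continuous (cmul a).
Proof.
apply: (@linear_lip_continuous A A _ `|a|) => [x y|x]; last exact: ler_normcM.
by rewrite cmulDr -[- y]scaleN1r cmulZr scaleN1r.
Qed.

Lemma cmulr_continuous a : continuous (cmul^~ a).
Proof.
apply: (@linear_lip_continuous A A _ `|a|) => [x y|x].
  by rewrite cmulDl -[- y]scaleN1r cmulZl scaleN1r.
by rewrite mulrC; exact: ler_normcM.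
Qed.

End CStarTheory.

(* M(A) as the algebra of double centralizers; its norm is not needed below *)

Record multiplier (R : realType) (A : cstarAlgType R) := Multiplier {
  mulL :> A -> A ;
  mulR : A -> A ;
  mulL_linear : linear mulL ;
  mulR_linear : linear mulR ;
  mulL_continuous : continuous mulL ;
  mulR_continuous : continuous mulR ;
  mulL_cmul : forall a b, mulL (a ** b) = mulL a ** b ;
  mulR_cmul : forall a b, mulR (a ** b) = a ** mulR b ;
  mulLR : forall a b, a ** mulL b = mulR a ** b
}.

#[local] Obligation Tactic := idtac.

Section Multiplier.
Context {R : realType} {A : cstarAlgType R}.
Implicit Types (m n p : multiplier A).

Lemma multiplier_ext m n : mulL m =1 mulL n -> mulR m =1 mulR n -> m = n.
Proof.
case: m n => [L1 R1 ? ? ? ? ? ? ?] [L2 R2 ? ? ? ? ? ? ?] /= /funext EL /funext ER.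
by subst L2 R2; congr Multiplier; exact: Prop_irrelevance.
Qed.

HB.instance Definition _ := gen_eqMixin (multiplier A).
HB.instance Definition _ := gen_choiceMixin (multiplier A).

Program Definition mzero : multiplier A :=
  @Multiplier R A (fun=> 0) (fun=> 0) _ _ _ _ _ _ _.
Next Obligation. by move=> k a b /=; rewrite scaler0 addr0. Qed.
Next Obligation. by move=> k a b /=; rewrite scaler0 addr0. Qed.
Next Obligation. by move=> a; exact: cvg_cst. Qed.
Next Obligation. by move=> a; exact: cvg_cst. Qed.
Next Obligation. by move=> a b /=; rewrite cmul0l. Qed.
Next Obligation. by move=> a b /=; rewrite cmul0r. Qed.
Next Obligation. by move=> a b /=; rewrite cmul0l cmul0r. Qed.

Program Definition mone : multiplier A :=
  @Multiplier R A id id _ _ _ _ _ _ _.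
Next Obligation. by []. Qed.
Next Obligation. by []. Qed.
Next Obligation. by move=> a; exact: cvg_id. Qed.
Next Obligation. by move=> a; exact: cvg_id. Qed.
Next Obligation. by []. Qed.
Next Obligation. by []. Qed.
Next Obligation. by []. Qed.

Program Definition madd m n : multiplier A :=
  @Multiplier R A (fun a => mulL m a + mulL n a)
    (fun a => mulR m a + mulR n a) _ _ _ _ _ _ _.
Next Obligation. by move=> m n k a b /=; rewrite !mulL_linear scalerDr addrACA. Qed.
Next Obligation. by move=> m n k a b /=; rewrite !mulR_linear scalerDr addrACA. Qed.
Next Obligation. by move=> m n a; apply: cvgD; exact: mulL_continuous. Qed.
Next Obligation. by move=> m n a; apply: cvgD; exact: mulR_continuous. Qed.
Next Obligation. by move=> m n a b /=; rewrite !mulL_cmul cmulDl. Qed.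
Next Obligation. by move=> m n a b /=; rewrite !mulR_cmul cmulDr. Qed.
Next Obligation. by move=> m n a b /=; rewrite cmulDr cmulDl !mulLR. Qed.

Program Definition mscale (k : R[i]) m : multiplier A :=
  @Multiplier R A (fun a => k *: mulL m a) (fun a => k *: mulR m a) _ _ _ _ _ _ _.
Next Obligation.
by move=> k m l a b /=; rewrite mulL_linear scalerDr !scalerA mulrC.
Qed.
Next Obligation.
by move=> k m l a b /=; rewrite mulR_linear scalerDr !scalerA mulrC.
Qed.
Next Obligation. by move=> k m a; apply: cvgZ; [exact: cvg_cst|exact: mulL_continuous]. Qed.
Next Obligation. by move=> k m a; apply: cvgZ; [exact: cvg_cst|exact: mulR_continuous]. Qed.
Next Obligation. by move=> k m a b /=; rewrite mulL_cmul cmulZl. Qed.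
Next Obligation. by move=> k m a b /=; rewrite mulR_cmul cmulZr. Qed.
Next Obligation. by move=> k m a b /=; rewrite cmulZr cmulZl mulLR. Qed.

Program Definition mmul m n : multiplier A :=
  @Multiplier R A (mulL m \o mulL n) (mulR n \o mulR m) _ _ _ _ _ _ _.
Next Obligation. by move=> m n k a b /=; rewrite !mulL_linear. Qed.
Next Obligation. by move=> m n k a b /=; rewrite !mulR_linear. Qed.
Next Obligation.
by move=> m n a; apply: continuous_comp; exact: mulL_continuous.
Qed.
Next Obligation.
by move=> m n a; apply: continuous_comp; exact: mulR_continuous.
Qed.
Next Obligation. by move=> m n a b /=; rewrite !mulL_cmul. Qed.
Next Obligation. by move=> m n a b /=; rewrite !mulR_cmul. Qed.
Next Obligation. by move=> m n a b /=; rewrite !mulLR. Qed.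

Program Definition mstar m : multiplier A :=
  @Multiplier R A (fun a => cstar (mulR m (cstar a)))
    (fun a => cstar (mulL m (cstar a))) _ _ _ _ _ _ _.
Next Obligation.
by move=> m k a b /=; rewrite cstarD cstarZ mulR_linear cstarD cstarZ conjCK.
Qed.
Next Obligation.
by move=> m k a b /=; rewrite cstarD cstarZ mulL_linear cstarD cstarZ conjCK.
Qed.
Next Obligation.
move=> m a; apply: (@continuous_comp _ _ _ (mulR m \o @cstar R A) (@cstar R A)).
  by apply: continuous_comp; [exact: cstar_continuous|exact: mulR_continuous].
exact: cstar_continuous.
Qed.
Next Obligation.
move=> m a; apply: (@continuous_comp _ _ _ (mulL m \o @cstar R A) (@cstar R A)).
  by apply: continuous_comp; [exact: cstar_continuous|exact: mulL_continuous].
exact: cstar_continuous.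
Qed.
Next Obligation. by move=> m a b /=; rewrite cstarM mulR_cmul cstarM cstarK. Qed.
Next Obligation. by move=> m a b /=; rewrite cstarM mulL_cmul cstarM cstarK. Qed.
Next Obligation.
by move=> m a b /=; rewrite -{1}(cstarK a) -cstarM -mulLR cstarM cstarK.
Qed.

Program Definition mult_of (a : A) : multiplier A :=
  @Multiplier R A (fun b => a ** b) (fun b => b ** a) _ _ _ _ _ _ _.
Next Obligation. by move=> a k b c /=; rewrite cmulDr cmulZr. Qed.
Next Obligation. by move=> a k b c /=; rewrite cmulDl cmulZl. Qed.
Next Obligation. exact: cmull_continuous. Qed.
Next Obligation. exact: cmulr_continuous. Qed.
Next Obligation. by move=> a b c /=; rewrite cmulA. Qed.
Next Obligation. by move=> a b c /=; rewrite cmulA. Qed.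
Next Obligation. by move=> a b c /=; rewrite cmulA. Qed.

Let ext := multiplier_ext.

Fact maddA : associative madd.
Proof. by move=> m n p; apply: ext => a /=; rewrite addrA. Qed.
Fact maddC : commutative madd.
Proof. by move=> m n; apply: ext => a /=; rewrite addrC. Qed.
Fact madd0 : left_id mzero madd.
Proof. by move=> m; apply: ext => a /=; rewrite add0r. Qed.
Fact maddN : left_inverse mzero (mscale (-1)) madd.
Proof. by move=> m; apply: ext => a /=; rewrite scaleN1r addNr. Qed.
HB.instance Definition _ :=
  GRing.isZmodule.Build (multiplier A) maddA maddC madd0 maddN.

Fact mmulA : associative mmul.
Proof. by move=> m n p; exact: ext. Qed.
Fact mmul1l : left_id mone mmul.
Proof. by move=> m; exact: ext. Qed.
Fact mmul1r : right_id mone mmul.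
Proof. by move=> m; exact: ext. Qed.

Lemma mulLD m a b : mulL m (a + b) = mulL m a + mulL m b.
Proof. by rewrite -[a]scale1r mulL_linear !scale1r. Qed.
Lemma mulRD m a b : mulR m (a + b) = mulR m a + mulR m b.
Proof. by rewrite -[a]scale1r mulR_linear !scale1r. Qed.

Fact mmulDl : left_distributive mmul +%R.
Proof. by move=> m n p; apply: ext => a //=; rewrite mulRD. Qed.
Fact mmulDr : right_distributive mmul +%R.
Proof. by move=> m n p; apply: ext => a //=; rewrite mulLD. Qed.
HB.instance Definition _ := GRing.Zmodule_isPzRing.Build (multiplier A)
  mmulA mmul1l mmul1r mmulDl mmulDr.

Fact mscaleA (k l : R[i]) m : mscale k (mscale l m) = mscale (k * l) m.
Proof. by apply: ext => a /=; rewrite scalerA. Qed.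
Fact mscale1 : left_id 1 mscale.
Proof. by move=> m; apply: ext => a /=; rewrite scale1r. Qed.
Fact mscaleDr : right_distributive mscale +%R.
Proof. by move=> k m n; apply: ext => a /=; rewrite scalerDr. Qed.
Fact mscaleDl m : {morph mscale^~ m : k l / k + l >-> k + l}.
Proof. by move=> k l; apply: ext => a /=; rewrite scalerDl. Qed.
HB.instance Definition _ := GRing.Zmodule_isLmodule.Build R[i] (multiplier A)
  mscaleA mscale1 mscaleDr mscaleDl.

Definition ZM : set (multiplier A) := [set m | forall n, m * n = n * m].

End Multiplier.


Section Cosets.
Context {V : zmodType}.
Implicit Types (B I : set V).

Definition add_coset I (b : V) : set V := [set b + j | j in I].

Definition add_quotient B I : set (set V) := [set add_coset I b | b in B].

Definition zero_add_quotient I : set (set V) := [set add_coset I 0].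

Definition set_add (B I : set V) : set V := [set b + j | b in B & j in I].

End Cosets.

Section Primitive.
Context {R : realType} {A : cstarAlgType R}.

Definition representation (H : hilbertType R) (pi : A -> H -> H) :=
  [/\ forall a, linear (pi a) /\ continuous (pi a),
      forall (k : R[i]) a b x, pi (k *: a + b) x = k *: pi a x + pi b x,
      forall a b x, pi (a ** b) x = pi a (pi b x) &
      forall a x y, inner (pi a x) y = inner x (pi (cstar a) y)].

Definition closed_subspace (H : hilbertType R) (V : set H) :=
  [/\ closed V, V 0 &
      forall (k : R[i]) x y, V x -> V y -> V (k *: x + y)].

(* the first clause excludes the zero representation on a line *)
Definition irreducible_rep (H : hilbertType R) (pi : A -> H -> H) :=
  (exists a x, pi a x <> 0) /\
  forall V : set H, closed_subspace V -> (forall a x, V x -> V (pi a x)) ->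
    V = [set 0] \/ V = setT.

Definition primitive_ideal (P : set A) :=
  exists (H : hilbertType R) (pi : A -> H -> H),
    [/\ representation pi, irreducible_rep pi & P = [set a | forall x, pi a x = 0]].

End Primitive.

Record prim (R : realType) (A : cstarAlgType R) := Prim {
  prim_ideal :> set A ;
  primP : primitive_ideal prim_ideal
}.

HB.instance Definition _ (R : realType) (A : cstarAlgType R) :=
  gen_eqMixin (prim A).
HB.instance Definition _ (R : realType) (A : cstarAlgType R) :=
  gen_choiceMixin (prim A).

(* the hull-kernel topology: complements of hulls are open *)
HB.instance Definition _ (R : realType) (A : cstarAlgType R) :=
  isSubBaseTopological.Build (prim A) [set: set A]
    (fun S => [set P : prim A | ~ S `<=` P]).

Section DaunsHofmann.
Context {R : realType} {A : cstarAlgType R}.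

(* For continuous bounded g there is exactly one such m, by the Dauns-Hofmann
   theorem; the default value 0 is irrelevant there. *)
Definition dauns_hofmann (g : prim A -> R[i]) : multiplier A :=
  xget 0 [set m | ZM m /\
    forall (P : prim A) a, add_coset P (m a) = add_coset P (g P *: a)].

Definition cstar_positive (a : A) := exists b, a = cstar b ** b.

Definition sigma_unital := exists u : nat -> A,
  [/\ forall n, cstar_positive (u n) /\ `|u n| <= 1,
      forall n, cstar_positive (u n.+1 - u n) &
      forall a, u n ** a @[n --> \oo] --> a /\ a ** u n @[n --> \oo] --> a].

End DaunsHofmann.

Arguments sigma_unital {R} A.

Section C0.
Context {R : realType} (X : topologicalType).

Definition C0 : set (X -> R[i]) := [set f | continuous f /\
  forall e : R[i], 0 < e -> compact [set x | e <= `|f x|]].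

Definition Cb : set (X -> R[i]) := [set f | continuous f /\
  exists M : R[i], forall x, `|f x| <= M].

(* the Stone-Cech compactification, as the closure of the image of X in the
   product of copies of the scalars indexed by C^b(X) *)
Definition eval_Cb (x : X) : prod_topology (fun _ : Cb => R[i] : topologicalType) :=
  fun f => set_val f x.

Definition stone_cech := set_type (closure (range eval_Cb)).
HB.instance Definition _ := Topological.on stone_cech.

Definition to_stone_cech (x : X) : stone_cech :=
  exist _ (eval_Cb x) (mem_set (subset_closure (imageT eval_Cb x))).

End C0.

(* Values of c0_map outside C0 are irrelevant *)
Record c0_algebra (R : realType) (X : topologicalType) (A : cstarAlgType R) :=
  C0Algebra {
  c0_map :> (X -> R[i]) -> multiplier A ;
  c0_mapD : forall f g, C0 f -> C0 g -> c0_map (f \+ g) = c0_map f + c0_map g ;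
  c0_mapZ : forall k f, C0 f -> c0_map (k \*: f) = k *: c0_map f ;
  c0_mapM : forall f g, C0 f -> C0 g -> c0_map (f \* g) = c0_map f * c0_map g ;
  c0_map_star : forall f, C0 f ->
    c0_map (fun x => (f x)^* ) = mstar (c0_map f) ;
  c0_map_central : forall f, C0 f -> ZM (c0_map f) ;
  c0_map_nondeg : [set c0_map f a | f in @C0 R X & a in [set: A]] = setT
}.

Section C0Algebra.
Context {R : realType} {X : topologicalType} {A : cstarAlgType R}.
Variable mu : c0_algebra X A.

Lemma prim_inhab (P : prim A) : exists x : X, True.
Proof.
case: P => P [H [pi [[pil pilA _ _] [[a [x pax0]] _] _]]].
apply/not_existsP => X0; apply: pax0.
have CX0 f : @C0 R X f.
  split=> [y|e _]; first by case: (X0 y).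
  rewrite (_ : [set _ | _] = set0); first exact: compact0.
  by rewrite -subset0 => y; case: (X0 y).
have mu0 f : mu f = 0.
  apply: (addrI (mu f)); rewrite addr0 -c0_mapD//; congr (mu _).
  by apply/funext => y; case: (X0 y).
have [f _ [b _ <-]] : [set mu f a | f in @C0 R X & a in [set: A]] a.
  by rewrite c0_map_nondeg.
rewrite mu0 /=; have := pilA (-1) 0 0 x.
by rewrite scaler0 addr0 scaleN1r addNr.
Qed.

(* The base map is determined by the property below; prim_inhab only serves
   to provide a default value. *)
Definition base_map : prim A -> X :=
  xget (fun P => sval (cid (prim_inhab P))) [set phi | continuous phi /\
    forall f, C0 f -> mu f = dauns_hofmann (f \o phi)].

(* {x | A_x <> 0} is the same set *)
Definition XA : set X := range base_map.

Definition base_mapXA (P : prim A) : XA :=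
  exist _ (base_map P) (mem_set (imageT base_map P)).

Definition mu_MA (f : stone_cech X -> R[i]) : multiplier A :=
  dauns_hofmann (f \o @to_stone_cech R X \o base_map).

(* Here and in Abeta_ideal, c0_map_nondeg: by Cohen factorization the set of
   products already is the closed linear span. *)
Definition H_ (x : stone_cech X) : set (multiplier A) :=
  [set mu_MA f * m | f in [set f | continuous f /\ f x = 0] & m in setT].

Definition Abeta : set (multiplier A) :=
  \bigcap_(x in XA) set_add (range mult_of) (H_ (to_stone_cech x)).

Section Fibres.
Context {K : topologicalType} (iota : XA -> K).

Definition mu_Abeta (f : K -> R[i]) (b : multiplier A) : multiplier A :=
  dauns_hofmann (f \o iota \o base_mapXA) * b.

Definition Abeta_ideal (y : K) : set (multiplier A) :=
  [set mu_Abeta f b | f in [set f | continuous f /\ f y = 0] & b in Abeta].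

Definition Abeta_fibre (y : K) : set (set (multiplier A)) :=
  add_quotient Abeta (Abeta_ideal y).

End Fibres.
End C0Algebra.

Definition compactification (Y K : topologicalType) (iota : Y -> K) :=
  [/\ compact [set: K], hausdorff_space K, injective iota,
      forall U : set Y, open U <-> exists2 V : set K, open V & iota @^-1` V = U
    & dense (range iota)].

(* Main.v *)
(* Cutting off by functions equal to 1 near x and choosing an extreme state on
   the resulting germ of M(A) shows that the fibre norms of a in A vanish off X_A;
   their level sets {x : |a(x)| >= e} are therefore compact subsets of X_A. With
   an approximate identity (u_k) these exhaust X_A, so X_A is a countable union
   of compact sets D_n. Given y in K outside X_A and a neighbourhood U of y, pick
   disjoint open W_n whose union has its closure in U, eventually disjoint from a neighbourhood of each
   point of X_A, and x_n in W_n off D_n. Let h_n be a bump at x_n supported in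
   W_n. Since x_n avoids D_n, h_n can be shrunk so that |h_n u_k| <= 2^-n for
   k + 1 < n; hence b = sum_n h_n u_(k_n) converges strictly in M(A). The sum is
   locally finite over X_A, so b lies in A^beta, while for suitable k_n the norm
   of b modulo a primitive ideal over x_n is at least 1/4. If y' is a cluster
   point of (x_n), then y' lies in U but not in X_A, and b does
   not belong to the ideal of y', because f(y') = 0 makes |f(x_n)| small
   infinitely often. *)
Require Import Defs.
From HB Require Import structures.
From mathcomp Require Import all_boot all_order all_algebra.
From mathcomp Require Import all_classical all_reals all_analysis.
From mathcomp Require Import complex ring lra.

Set Implicit Arguments.
Unset Strict Implicit.
Unset Printing Implicit Defensive.

Import Order.TTheory GRing.Theory Num.Theory.
Import numFieldNormedType.Exports.

Local Open Scope classical_set_scope.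
Local Open Scope ring_scope.
Local Open Scope complex_scope.

(** The obstacle is that membership in [XA] speaks of primitive ideals, whereas cut-offs only
    control norms. The bridge is [localized_primitive]: multipliers [mur h], with [h] equal to 1
    near x, act as the identity on the GNS space of a functional dominated by [local_upper], so the
    kernel of that representation contains every element whose germ at x vanishes and therefore lies
    over x. Extremality of the functional gives irreducibility. The representation is built on M(A),
    which contains the unit and the cut-offs, and is restricted to A at the end. Positivity is the
    norm condition [mpos], square roots come from a contraction, and extreme functionals from Zorn's
    lemma on faces cut out by sublinear functionals. [base_map] and [dauns_hofmann] are choices with
    defaults: a default either empties the remainder or contradicts that some element is nonzero.
    The constant 1/4 is 1/2 - 1/4: a unit vector at distance at least 1/2 from the primitive ideal
    moves by less than 1/4 under multiplication by a suitable u_k. *)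

(* Abelian groups embed in commutative rings as square-zero ideals, which lets
   [ring] decide identities in an abelian group. *)
Definition square_zero_ext (V : zmodType) := (int * V)%type.

Section SquareZeroExt.
Variable V : zmodType.
Local Notation E := (square_zero_ext V).
Implicit Types x y z : E.

HB.instance Definition _ := GRing.Zmodule.on E.

Definition sqz_mul x y : E := (x.1 * y.1, y.2 *~ x.1 + x.2 *~ y.1).

Fact sqz_mulA : associative sqz_mul.
Proof.
move=> [a u] [b v] [c w]; congr (_, _) => /=; first exact: mulrA.
by rewrite !mulrzDl -!mulrzA [c * a]mulrC addrA [b * a]mulrC.
Qed.

Fact sqz_mulC : commutative sqz_mul.
Proof. by move=> x y; rewrite /sqz_mul mulrC addrC. Qed.

Fact sqz_mul1 : left_id ((1, 0) : E) sqz_mul.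
Proof. by case=> a u; rewrite /sqz_mul/= mul1r mul0rz addr0. Qed.

Fact sqz_mulDl : left_distributive sqz_mul +%R.
Proof.
move=> [a u] [b v] [c w]; congr (_, _) => /=; first exact: mulrDl.
by rewrite mulrzDr mulrzDl addrACA.
Qed.

Fact sqz_oner_neq0 : ((1, 0) : E) != 0.
Proof. by []. Qed.

HB.instance Definition _ := GRing.Zmodule_isComNzRing.Build E
  sqz_mulA sqz_mulC sqz_mul1 sqz_mulDl sqz_oner_neq0.

Definition sqz_in (v : V) : E := (0, v).

Fact sqz_in_additive : additive sqz_in.
Proof. by move=> u v; congr (_, _). Qed.

HB.instance Definition _ := GRing.isZmodMorphism.Build V E sqz_in sqz_in_additive.

Lemma sqz_in_inj : injective sqz_in.
Proof. by move=> u v []. Qed.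

End SquareZeroExt.

Ltac zmod := apply: (@sqz_in_inj _ _ _); ring.

(** * Real-valued norms and elementary estimates *)

Definition rnorm (R : realType) (V : normedZmodType R[i]) (x : V) : R :=
  complex.Re `|x|.

Section RealNorm.
Context {R : realType}.
Implicit Types (V : normedModType R[i]).

(** Norms take values in [R[i]]. Passing to the real part loses nothing and moves all estimates into
    an ordered field, where [lra] applies. *)
Lemma rnormE (V : normedZmodType R[i]) (x : V) : `|x| = (rnorm x)%:C.
Proof. by rewrite /rnorm RRe_real// ger0_real. Qed.

Lemma rnorm_ge0 (V : normedZmodType R[i]) (x : V) : 0 <= rnorm x.
Proof. by rewrite -ler0c -rnormE. Qed.

Lemma rnorm0 (V : normedZmodType R[i]) : rnorm (0 : V) = 0.
Proof. by rewrite /rnorm normr0. Qed.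

Lemma rnorm_eq0 (V : normedZmodType R[i]) (x : V) : rnorm x = 0 -> x = 0.
Proof. by move=> x0; apply/eqP; rewrite -normr_eq0 rnormE x0. Qed.

Lemma rnormD (V : normedZmodType R[i]) (x y : V) :
  rnorm (x + y) <= rnorm x + rnorm y.
Proof. by rewrite -lecR rmorphD/= -!rnormE ler_normD. Qed.

Lemma rnormN (V : normedZmodType R[i]) (x : V) : rnorm (- x) = rnorm x.
Proof. by rewrite /rnorm normrN. Qed.

Lemma rnormB (V : normedZmodType R[i]) (x y : V) :
  rnorm (x - y) <= rnorm x + rnorm y.
Proof. by rewrite (le_trans (rnormD _ _))// rnormN. Qed.

Lemma rnormC (V : normedZmodType R[i]) (x y : V) : rnorm (x - y) = rnorm (y - x).
Proof. by rewrite -rnormN opprB. Qed.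

Lemma rnormZ V (k : R[i]) (x : V) : rnorm (k *: x) = rnorm k * rnorm x.
Proof. by apply: complexI; rewrite rmorphM/= -!rnormE normrZ. Qed.

Lemma rnorm_real (t : R) : rnorm (t%:C : R[i]) = `|t|.
Proof. by rewrite /rnorm normc_def/= expr0n addr0 sqrtr_sqr. Qed.

Lemma rnormZr V (t : R) (x : V) : rnorm (t%:C *: x) = `|t| * rnorm x.
Proof. by rewrite rnormZ rnorm_real. Qed.

Lemma rnorm_le_eps (a b : R) : (forall e, 0 < e -> a <= b + e) -> a <= b.
Proof. by move=> h; apply/ler_addgt0Pr. Qed.

Lemma expr_half_small (e : R) : 0 < e ->
  exists N, forall n, (N <= n)%N -> 2^-1 ^+ n < e.
Proof.
move=> e0; have : 2^-1 ^+ n @[n --> \oo] --> (0 : R).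
  by apply: cvg_expr; rewrite ger0_norm ?invr_ge0// invf_lt1// ltr1n.
move=> /cvgrPdist_lt/(_ _ e0)[N _ hN]; exists N => n Nn.
by have := hN n Nn; rewrite /= sub0r normrN ger0_norm// exprn_ge0// invr_ge0.
Qed.

Lemma cvg_rnormP V (T : Type) (F : set_system T) (FF : Filter F) (f : T -> V) l :
  f x @[x --> F] --> l <->
  forall e : R, 0 < e -> \forall x \near F, rnorm (f x - l) < e.
Proof.
split=> [/cvgrPdist_lt h e e0|h].
  have := h e%:C; rewrite ltcR => /(_ e0); apply: filterS => x.
  by rewrite rnormE ltcR rnormC.
apply/cvgrPdist_lt => e e0.
have eE : e = (complex.Re e)%:C by rewrite RRe_real// gtr0_real.
move: e0; rewrite eE ltcR => /h; apply: filterS => x.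
by rewrite rnormE ltcR rnormC.
Qed.

Lemma rnorm_cauchy_cvg (V : completeNormedModType R[i]) (u : nat -> V) :
  (forall e : R, 0 < e -> exists N, forall n m, (N <= n)%N -> (N <= m)%N ->
    rnorm (u n - u m) < e) ->
  exists l : V, u n @[n --> \oo] --> l.
Proof.
move=> h; exists (lim (u n @[n --> \oo])); apply: cauchy_cvg.
apply: cauchy_exP => e e0.
have eE : e = (complex.Re e)%:C by rewrite RRe_real// gtr0_real.
move: e0; rewrite eE ltcR => /h[N hN]; exists (u N); exists N => // n /= Nn.
by rewrite -ball_normE /ball_/= rnormE ltcR hN.
Qed.

Lemma cvg_rnorm_le V (T : Type) (F : set_system T) (FF : ProperFilter F)
    (f : T -> V) l (M : R) :
  f x @[x --> F] --> l -> (\forall x \near F, rnorm (f x) <= M) -> rnorm l <= M.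
Proof.
move=> fl fM; apply: rnorm_le_eps => e e0.
have /cvg_rnormP/(_ _ e0) h := fl.
have [x [fx1 fx2]] := filter_ex (filterI h fM).
rewrite -(subrK (f x) l) addrC (le_trans (rnormD _ _))// lerD//.
by rewrite rnormC ltW.
Qed.

End RealNorm.

(** * Fixed points of contractions and square roots in a C*-algebra *)

Section Contraction.
Context {R : realType} {V : completeNormedModType R[i]}.
Variables (F : V -> V) (q r : R).
Hypotheses (q0 : 0 <= q) (q1 : q < 1) (r0 : 0 <= r).
Hypothesis F_ball : forall x, rnorm x <= r -> rnorm (F x) <= r.
Hypothesis F_contr : forall x y, rnorm x <= r -> rnorm y <= r ->
  rnorm (F x - F y) <= q * rnorm (x - y).

(** The iterates of 0 stay in the ball and are Cauchy, with error at most 2 r q^n. A ball is used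
    instead of the whole space because the map behind the square root is quadratic and contracts
    only there. *)
Lemma contraction_fixpoint : exists2 x, rnorm x <= r & F x = x.
Proof.
pose u n := iter n F 0.
have ur n : rnorm (u n) <= r.
  by elim: n => [|n ih]; rewrite ?rnorm0//=; exact: F_ball.
have udist n m : rnorm (u (n + m)%N - u n) <= q ^+ n * (r + r).
  elim: n => [|n ih].
    by rewrite expr0 mul1r subr0 add0n (le_trans (ur _))// lerDl.
  rewrite addSn /= (le_trans (F_contr (ur _) (ur _)))// exprS -mulrA.
  by rewrite ler_wpM2l.
have qn : (q ^+ n * (r + r)) @[n --> \oo] --> (0 : R).
  rewrite -[X in _ --> X](mul0r (r + r)); apply: cvgM; last exact: cvg_cst.
  by apply: cvg_expr; rewrite ger0_norm.
have [|l ul] := @rnorm_cauchy_cvg R V u.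
  move=> e e0; have e20 : 0 < e / 2 by rewrite divr_gt0.
  have /cvgrPdist_lt/(_ _ e20)[N _ hN] := qn.
  have hd n : (N <= n)%N -> rnorm (u n - u N) < e / 2.
    move=> Nn; rewrite -(subnKC Nn) (le_lt_trans (udist _ _))//.
    have := hN N (leqnn N); rewrite /= sub0r normrN ger0_norm//.
    by rewrite mulr_ge0 ?exprn_ge0 ?addr_ge0.
  exists N => n m Nn Nm; rewrite -(subrK (u N) (u n)) -addrA.
  rewrite (le_lt_trans (rnormD _ _))// [e]splitr ltrD ?hd//.
  by rewrite rnormC hd.
have lr : rnorm l <= r by apply: cvg_rnorm_le ul _; apply: nearW.
exists l => //; apply/eqP; rewrite -subr_eq0; apply/eqP/rnorm_eq0/eqP.
rewrite eq_le rnorm_ge0 andbT; apply: rnorm_le_eps => e e0; rewrite add0r.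
have e20 : 0 < e / 2 by rewrite divr_gt0.
have /cvg_rnormP/(_ _ e20)[N _ hN] := ul.
rewrite -(subrK (u N.+1) (F l)) -addrA (le_trans (rnormD _ _))//.
rewrite [e]splitr lerD//; last by rewrite ltW// hN/=.
rewrite (le_trans (F_contr lr (ur _)))//.
have := hN N (leqnn N); rewrite /= rnormC => /ltW; apply: le_trans.
by rewrite ler_piMl ?rnorm_ge0// ltW.
Qed.

End Contraction.

Section CStarNorm.
Context {R : realType} {A : cstarAlgType R}.
Implicit Types (a b c x y z : A).

Lemma rnorm_cmul a b : rnorm (a ** b) <= rnorm a * rnorm b.
Proof. by rewrite -lecR rmorphM/= -!rnormE ler_normcM. Qed.

Lemma rnorm_cstar a : rnorm (cstar a) = rnorm a.
Proof. by rewrite /rnorm norm_cstar. Qed.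

Lemma rnorm_cstarM a : rnorm (cstar a ** a) = rnorm a ^+ 2.
Proof. by apply: complexI; rewrite rmorphXn/= -!rnormE norm_cstarM. Qed.

Lemma cmulBl a b c : (a - b) ** c = a ** c - b ** c.
Proof. by rewrite cmulDl -scaleN1r cmulZl scaleN1r. Qed.

Lemma cmulBr a b c : a ** (b - c) = a ** b - a ** c.
Proof. by rewrite cmulDr -scaleN1r cmulZr scaleN1r. Qed.

Lemma cstar0 : cstar (0 : A) = 0.
Proof. by rewrite -(scale0r (0 : A)) cstarZ rmorph0 !scale0r. Qed.

Lemma cstarB a b : cstar (a - b) = cstar a - cstar b.
Proof. by rewrite cstarD -scaleN1r cstarZ rmorphN rmorph1 scaleN1r. Qed.

Lemma cstarZr (t : R) a : cstar (t%:C *: a) = t%:C *: cstar a.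
Proof. by rewrite cstarZ; congr (_ *: _); exact: conjc_real. Qed.

(* [1 - x] is the square root of [1 - z] *)
Lemma cstar_sqrt z : rnorm z < 1 -> cstar z = z ->
  exists x, [/\ rnorm x < 1, cstar x = x, x + x - x ** x = z &
    forall w, w ** z = z ** w -> w ** x = x ** w].
Proof.
(* This radius lies strictly below 1, satisfies (|z| + r^2) / 2 <= r, and is also the contraction
   constant of [F] on the ball of radius r. *)
move=> z1 zsa; pose r := (1 + rnorm z) / 2.
have z0 := rnorm_ge0 z.
have r0 : 0 <= r by rewrite /r; lra.
have r1 : r < 1 by rewrite /r; lra.
pose F x : A := (2^-1)%:C *: (z + x ** x).
have sqB x y : x ** x - y ** y = x ** (x - y) + (x - y) ** y.
  by rewrite cmulBr cmulBl addrA subrK.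
have Fball x : rnorm x <= r -> rnorm (F x) <= r.
  move=> xr; rewrite /F rnormZr ger0_norm ?invr_ge0//.
  have h1 := rnormD z (x ** x); have h2 := rnorm_cmul x x.
  have h3 : rnorm x * rnorm x <= r * r by rewrite ler_pM// ?rnorm_ge0.
  have h4 : r * r = (1 + 2 * rnorm z + rnorm z * rnorm z) / 4 by rewrite /r; field.
  have h5 : rnorm z * rnorm z <= 1 by rewrite mulr_ile1// ?ltW.
  rewrite /r in h3 h4 *; lra.
have Fcontr x y : rnorm x <= r -> rnorm y <= r ->
    rnorm (F x - F y) <= r * rnorm (x - y).
  move=> xr yr; rewrite /F -scalerBr opprD addrACA subrr add0r rnormZr.
  rewrite ger0_norm ?invr_ge0// sqB.
  have h1 := rnormD (x ** (x - y)) ((x - y) ** y).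
  have h2 := rnorm_cmul x (x - y); have h3 := rnorm_cmul (x - y) y.
  have d0 := rnorm_ge0 (x - y).
  have h4 : rnorm x * rnorm (x - y) <= r * rnorm (x - y) by rewrite ler_wpM2r.
  have h5 : rnorm (x - y) * rnorm y <= rnorm (x - y) * r by rewrite ler_wpM2l.
  by rewrite [_ * r]mulrC in h5; lra.
have [x xr Fx] := contraction_fixpoint r0 r1 r0 Fball Fcontr.
(* Both [cstar x - x] and the commutator of [w] with [x] satisfy this inequality, the latter because
   it equals half of [d ** x + x ** d]. Self-adjointness and commutation thus follow from the
   fixed-point equation alone. *)
have small (d : A) : rnorm d <= r * rnorm d -> d = 0.
  move=> dr; apply: rnorm_eq0; apply/eqP; rewrite eq_le rnorm_ge0 andbT.
  have r1' : 0 < 1 - r by rewrite subr_gt0.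
  by rewrite -(ler_pM2l r1') mulr0 mulrBl mul1r subr_le0.
have Fx2 : x + x = z + x ** x.
  rewrite -{1 2}Fx /F -scalerDl -rmorphD/= -[2^-1]mul1r -splitr.
  by rewrite scale1r.
exists x; split.
- exact: le_lt_trans r1.
- apply/eqP; rewrite -subr_eq0; apply/eqP; apply: small.
  have xsr : rnorm (cstar x) <= r by rewrite rnorm_cstar.
  have Fxs : F (cstar x) = cstar x.
    by rewrite -[in RHS]Fx /F cstarZr cstarD cstarM zsa.
  by have := Fcontr _ _ xsr xr; rewrite Fxs Fx.
- by rewrite Fx2 addrK.
move=> w wz; apply/eqP; rewrite -subr_eq0; apply/eqP; apply: small.
set d := w ** x - x ** w.
have dE : d = (2^-1)%:C *: (d ** x + x ** d).
  have -> : d ** x + x ** d = w ** (x ** x) - (x ** x) ** w.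
    by rewrite /d cmulBl cmulBr !cmulA addrA subrK.
  rewrite /d -{1 2}Fx /F cmulZr cmulZl -scalerBr cmulDr cmulDl wz.
  by congr (_ *: _); rewrite opprD addrACA subrr add0r.
rewrite {1}dE rnormZr ger0_norm ?invr_ge0//.
have h1 := rnormD (d ** x) (x ** d).
have h2 := rnorm_cmul x d; have h3 := rnorm_cmul d x.
have d0 := rnorm_ge0 d.
have h4 : rnorm x * rnorm d <= r * rnorm d by rewrite ler_wpM2r.
rewrite [_ * rnorm x]mulrC in h3.
lra.
Qed.

End CStarNorm.

Lemma rnorm_cauchyP (R : realType) (V : normedModType R[i]) (F : set_system V)
    (FF : ProperFilter F) :
  cauchy F <-> forall e : R, 0 < e -> exists x, \forall y \near F, rnorm (y - x) < e.
Proof.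
rewrite cauchyP; split=> [h e e0|h e e0].
  have := h e%:C; rewrite ltcR => /(_ e0)[x Fx]; exists x; move: Fx.
  apply: filterS => y; rewrite -ball_normE /ball_/= rnormE ltcR.
  by rewrite rnormC.
have eE : e = (complex.Re e)%:C by rewrite RRe_real// gtr0_real.
move: e0; rewrite eE ltcR => /h[x Fx]; exists x; move: Fx.
apply: filterS => y; rewrite -ball_normE /ball_/= rnormE ltcR.
by rewrite rnormC.
Qed.

Lemma rnorm_cauchy_filter (R : realType) (V : completeNormedModType R[i])
    (T : Type) (F : set_system T) (FF : ProperFilter F) (f : T -> V) :
  (forall e : R, 0 < e -> exists y, \forall t \near F, rnorm (f t - y) < e) ->
  exists l : V, f t @[t --> F] --> l.
Proof.
move=> h; exists (lim (f t @[t --> F])); apply: cauchy_cvg.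
by apply/rnorm_cauchyP => e /h[y Fy]; exists y.
Qed.

Lemma rnorm_bounded (R : realType) (V W : normedModType R[i]) (f : V -> W) :
  linear f -> continuous f ->
  exists2 M : R, 0 <= M & forall x, rnorm (f x) <= M * rnorm x.
Proof.
move=> fl fc.
have f0 : f 0 = 0 by have := fl (-1) 0 0; rewrite !scaleN1r oppr0 addr0 addNr.
have fZ k x : f (k *: x) = k *: f x by have := fl k x 0; rewrite f0 !addr0.
have /cvg_rnormP/(_ 1 ltr01) := fc 0; rewrite f0 => h.
have [d d0 hd] : exists2 d : R, 0 < d & forall x, rnorm x < d -> rnorm (f x) < 1.
  move: h => /nbhs_ballP[e /= e0 he].
  have eE : e = (complex.Re e)%:C by rewrite RRe_real// gtr0_real.
  exists (complex.Re e) => [|x xe]; first by rewrite -ltcR -eE.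
  rewrite -[f x]subr0; apply: he.
  by rewrite -ball_normE /ball_/= sub0r normrN eE rnormE ltcR.
have d1 : 0 <= 2 / d by rewrite divr_ge0// ltW.
exists (2 / d) => // x; have [x0|x0] := eqVneq (rnorm x) 0.
  by rewrite (rnorm_eq0 x0) f0 !rnorm0 mulr0.
have xp : 0 < rnorm x by rewrite lt_def x0 rnorm_ge0.
have := hd ((d / (2 * rnorm x))%:C *: x).
rewrite fZ !rnormZr ger0_norm; last by rewrite divr_ge0 ?mulr_ge0 ?ltW.
have -> : d / (2 * rnorm x) * rnorm x = d / 2 by field.
have -> : d / (2 * rnorm x) * rnorm (f x) = rnorm (f x) / (2 / d * rnorm x).
  by field; rewrite x0 gt_eqF.
have d2 : d / 2 < d by lra.
move=> /(_ d2); rewrite ltr_pdivrMr ?mul1r; first exact: ltW.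
by apply: mulr_gt0; rewrite ?divr_gt0.
Qed.

(** * The multiplier algebra as a C*-algebra *)

Section MultiplierNorm.
Context {R : realType} {A : cstarAlgType R}.
Implicit Types (m n : multiplier A) (a b : A).

Lemma cmul_faithful a : (forall b, a ** b = 0) -> a = 0.
Proof.
move=> h; apply: rnorm_eq0; have := rnorm_cstarM (cstar a).
rewrite cstarK h rnorm0 rnorm_cstar => /esym/eqP.
by rewrite sqrf_eq0 => /eqP.
Qed.

Lemma cvg_cmulr (T : Type) (F : set_system T) (FF : Filter F) (f : T -> A) l b :
  f t @[t --> F] --> l -> f t ** b @[t --> F] --> l ** b.
Proof. by move=> fl; exact: (cvg_comp _ _ fl (@cmulr_continuous _ _ b l)). Qed.

Lemma cvg_cmull (T : Type) (F : set_system T) (FF : Filter F) (f : T -> A) l b :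
  f t @[t --> F] --> l -> b ** f t @[t --> F] --> b ** l.
Proof. by move=> fl; exact: (cvg_comp _ _ fl (@cmull_continuous _ _ b l)). Qed.

(** The left action determines the right one, since [mulR m a ** b = a ** mulL m b] and an element
    with zero product against all of A is zero. *)
Lemma multiplier_extL m n : mulL m =1 mulL n -> m = n.
Proof.
move=> h; apply: multiplier_ext => // a; apply/eqP; rewrite -subr_eq0.
by apply/eqP/cmul_faithful => b; rewrite cmulBl -!mulLR h subrr.
Qed.

Lemma mulL0 m : m 0 = 0.
Proof. by have := mulL_linear m (-1) 0 0; rewrite !scaleN1r oppr0 addr0 addNr. Qed.

Lemma mulLZ m k a : m (k *: a) = k *: m a.
Proof. by have := mulL_linear m k a 0; rewrite mulL0 !addr0. Qed.

Lemma mulLB m a b : m (a - b) = m a - m b.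
Proof. by rewrite mulLD -scaleN1r mulLZ scaleN1r. Qed.

Definition multiplier_norm m : R :=
  sup [set rnorm (m a) | a in [set a | rnorm a <= 1]].

Lemma multiplier_norm_has_sup m :
  has_sup [set rnorm (m a) | a in [set a | rnorm a <= 1]].
Proof.
split; first by exists (rnorm (m 0)), 0; rewrite //= rnorm0.
have [M M0 hM] := rnorm_bounded (mulL_linear m) (@mulL_continuous _ _ m).
by exists M => _ [a /= a1 <-]; rewrite (le_trans (hM a))// ler_piMr.
Qed.

Lemma multiplier_normP m a : rnorm (m a) <= multiplier_norm m * rnorm a.
Proof.
have [a0|a0] := eqVneq (rnorm a) 0.
  by rewrite (rnorm_eq0 a0) mulL0 !rnorm0 mulr0.
have ap : 0 < rnorm a by rewrite lt_def a0 rnorm_ge0.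
rewrite -ler_pdivrMr// mulrC -[X in X * _]ger0_norm ?invr_ge0 ?(ltW ap)//.
rewrite -rnormZr -mulLZ.
apply: (sup_upper_bound (multiplier_norm_has_sup m)).
exists ((rnorm a)^-1%:C *: a) => //=.
by rewrite rnormZr ger0_norm ?invr_ge0 ?(ltW ap)// mulVf.
Qed.

Lemma multiplier_norm_le m M : 0 <= M ->
  (forall a, rnorm (m a) <= M * rnorm a) -> multiplier_norm m <= M.
Proof.
move=> M0 h; apply: ge_sup; first by have [] := multiplier_norm_has_sup m.
by move=> _ [a /= a1 <-]; rewrite (le_trans (h a))// ler_piMr.
Qed.

Lemma multiplier_norm_ge0 m : 0 <= multiplier_norm m.
Proof.
apply: (le_trans (rnorm_ge0 (m 0))).
apply: (sup_upper_bound (multiplier_norm_has_sup m)).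
by exists 0; rewrite //= rnorm0.
Qed.

Fact multiplier_normD m n :
  (multiplier_norm (m + n))%:C <= (multiplier_norm m)%:C + (multiplier_norm n)%:C.
Proof.
rewrite -rmorphD/= lecR; apply: multiplier_norm_le => [|a].
  by rewrite addr_ge0 ?multiplier_norm_ge0.
by rewrite mulrDl (le_trans (rnormD _ _))// lerD// multiplier_normP.
Qed.

Fact multiplier_normZ (k : R[i]) m :
  (multiplier_norm (k *: m))%:C = `|k| * (multiplier_norm m)%:C.
Proof.
rewrite rnormE -rmorphM/=; congr (_%:C).
have le k' n : multiplier_norm (k' *: n) <= rnorm k' * multiplier_norm n.
  apply: multiplier_norm_le => [|a].
    by rewrite mulr_ge0 ?rnorm_ge0 ?multiplier_norm_ge0.
  by rewrite /= rnormZ -mulrA ler_wpM2l ?rnorm_ge0// multiplier_normP.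
apply/eqP; rewrite eq_le le/=.
have [->|k0] := eqVneq k 0; first by rewrite rnorm0 mul0r multiplier_norm_ge0.
have kp : 0 < rnorm k.
  rewrite lt_def rnorm_ge0 andbT; apply/eqP => /rnorm_eq0 k00.
  by rewrite k00 eqxx in k0.
have := le k^-1 (k *: m); rewrite scalerA mulVf// scale1r.
have -> : rnorm k^-1 = (rnorm k)^-1.
  by apply: complexI; rewrite fmorphV/= -!rnormE normfV.
by rewrite ler_pdivlMl.
Qed.

Fact multiplier_norm_eq0 m : (multiplier_norm m)%:C = 0 -> m = 0.
Proof.
move=> [m0]; apply: multiplier_extL => a /=; apply: rnorm_eq0.
by apply/eqP; rewrite eq_le rnorm_ge0 andbT -(mul0r (rnorm a)) -m0 multiplier_normP.
Qed.

HB.instance Definition _ := @Lmodule_isNormed.Build R[i] (multiplier A)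
  (fun m => (multiplier_norm m)%:C) multiplier_normD multiplier_normZ multiplier_norm_eq0.

Lemma rnorm_multiplierE m : rnorm m = multiplier_norm m.
Proof. by []. Qed.

Lemma rnorm_mulL m a : rnorm (m a) <= rnorm m * rnorm a.
Proof. exact: multiplier_normP. Qed.

Lemma rnorm_mulR m a : rnorm (mulR m a) <= rnorm m * rnorm a.
Proof.
set x := mulR m a; have [->|x0] := eqVneq (rnorm x) 0.
  by rewrite mulr_ge0 ?rnorm_ge0.
have xp : 0 < rnorm x by rewrite lt_def x0 rnorm_ge0.
rewrite -(ler_pM2r xp) -expr2 -[in leLHS]rnorm_cstar -rnorm_cstarM cstarK.
rewrite /x -mulLR (le_trans (rnorm_cmul _ _))// mulrAC mulrC ler_wpM2r ?rnorm_ge0//.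
by rewrite (le_trans (rnorm_mulL _ _))// rnorm_cstar.
Qed.

(** This serves completeness of M(A) and the strict sum b alike. The uniform bound makes the
    pointwise limits Lipschitz, and the double centralizer identities pass to limits by
    uniqueness. *)
Lemma strict_limit (T : Type) (F : set_system T) (FF : ProperFilter F)
    (u : T -> multiplier A) (C : R) :
  (\forall t \near F, rnorm (u t) <= C) ->
  (forall a, exists l : A, u t a @[t --> F] --> l) ->
  (forall a, exists l : A, mulR (u t) a @[t --> F] --> l) ->
  exists m, [/\ forall a, u t a @[t --> F] --> m a,
    forall a, mulR (u t) a @[t --> F] --> mulR m a & rnorm m <= C].
Proof.
move=> uC hL hR.
have C0 : 0 <= C by have [t /(le_trans (rnorm_ge0 _))] := filter_ex uC.
pose L a : A := sval (cid (hL a)); pose Q a : A := sval (cid (hR a)).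
have Lc a : u t a @[t --> F] --> (L a : A) by rewrite /L; case: cid.
have Qc a : mulR (u t) a @[t --> F] --> (Q a : A) by rewrite /Q; case: cid.
have uniq (f g : T -> A) (l l' : A) : f =1 g -> f t @[t --> F] --> l ->
    g t @[t --> F] --> l' -> l = l'.
  by move=> /funext -> h1 h2; exact: cvg_unique h1 h2.
have Llin : linear L.
  move=> k a b; apply: (uniq _ _ _ _ _ (Lc _)).
    by move=> t; exact: mulL_linear.
  by apply: cvgD; [apply: cvgZ; [exact: cvg_cst|exact: Lc]|exact: Lc].
have Qlin : linear Q.
  move=> k a b; apply: (uniq _ _ _ _ _ (Qc _)).
    by move=> t; exact: mulR_linear.
  by apply: cvgD; [apply: cvgZ; [exact: cvg_cst|exact: Qc]|exact: Qc].
have LC a : rnorm (L a) <= C * rnorm a.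
  apply: (cvg_rnorm_le _ (Lc a)); move: uC; apply: filterS => t tC.
  by rewrite (le_trans (rnorm_mulL _ _))// ler_wpM2r ?rnorm_ge0.
have QC a : rnorm (Q a) <= C * rnorm a.
  apply: (cvg_rnorm_le _ (Qc a)); move: uC; apply: filterS => t tC.
  by rewrite (le_trans (rnorm_mulR _ _))// ler_wpM2r ?rnorm_ge0.
have cont (f : A -> A) : linear f -> (forall a, rnorm (f a) <= C * rnorm a) ->
    continuous f.
  move=> fl fC; apply: (@linear_lip_continuous _ A A _ C%:C) => [x y|x].
    by have := fl (-1) y x; rewrite !scaleN1r ![- _ + _]addrC.
  by rewrite !rnormE -rmorphM lecR.
have Lm a b : L (a ** b) = L a ** b.
  apply: (uniq _ _ _ _ _ (Lc _)); first by move=> t; exact: mulL_cmul.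
  exact: cvg_cmulr.
have Qm a b : Q (a ** b) = a ** Q b.
  apply: (uniq _ _ _ _ _ (Qc _)); first by move=> t; exact: mulR_cmul.
  exact: cvg_cmull.
have LQ a b : a ** L b = Q a ** b.
  apply: (uniq (fun t => a ** u t b) (fun t => mulR (u t) a ** b)).
  - by move=> t; exact: mulLR.
  - exact: cvg_cmull.
  - exact: cvg_cmulr.
exists (Multiplier Llin Qlin (cont _ Llin LC) (cont _ Qlin QC) Lm Qm LQ).
by split => //; rewrite rnorm_multiplierE multiplier_norm_le.
Qed.

Fact multiplier_complete (F : set_system (multiplier A)) :
  ProperFilter F -> cauchy F -> cvg F.
Proof.
move=> FF /rnorm_cauchyP Fc.
have [|a|a|m [mL _ _]] := @strict_limit _ F FF id (rnorm (sval (cid (Fc 1 ltr01))) + 1).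
- case: cid => x /=; apply: filterS => y yx.
  by rewrite -(subrK x y) addrC (le_trans (rnormD _ _))// lerD// ltW.
- apply: rnorm_cauchy_filter => e e0.
  have ea0 : 0 < e / (rnorm a + 1) by rewrite divr_gt0// ltr_wpDl ?rnorm_ge0.
  have [x Fx] := Fc _ ea0; exists (x a); move: Fx; apply: filterS => y yx.
  rewrite (_ : y a - x a = (y - x) a); last by rewrite /= scaleN1r.
  rewrite (le_lt_trans (rnorm_mulL _ _))//.
  rewrite (@le_lt_trans _ _ (rnorm (y - x) * (rnorm a + 1)))//.
    by rewrite ler_wpM2l ?rnorm_ge0// lerDl.
  by rewrite -ltr_pdivlMr// ltr_wpDl ?rnorm_ge0.
- apply: rnorm_cauchy_filter => e e0.
  have ea0 : 0 < e / (rnorm a + 1) by rewrite divr_gt0// ltr_wpDl ?rnorm_ge0.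
  have [x Fx] := Fc _ ea0; exists (mulR x a); move: Fx; apply: filterS => y yx.
  rewrite (_ : mulR y a - mulR x a = mulR (y - x) a); last by rewrite /= scaleN1r.
  rewrite (le_lt_trans (rnorm_mulR _ _))//.
  rewrite (@le_lt_trans _ _ (rnorm (y - x) * (rnorm a + 1)))//.
    by rewrite ler_wpM2l ?rnorm_ge0// lerDl.
  by rewrite -ltr_pdivlMr// ltr_wpDl ?rnorm_ge0.
apply/cvg_ex; exists m; apply/(cvg_rnormP (V := multiplier A) _ id) => e e0.
have e40 : 0 < e / 4 by rewrite divr_gt0.
have [x Fx] := Fc _ e40.
suff xm : rnorm (x - m) <= e / 4.
  move: Fx; apply: filterS => y yx.
  rewrite -(subrK x y) -addrA (le_lt_trans (rnormD _ _))//; lra.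
apply: multiplier_norm_le => [|a]; first exact: ltW.
rewrite (_ : (x - m) a = x a - m a); last by rewrite /= scaleN1r.
apply: (@cvg_rnorm_le _ _ _ F _ (fun y : multiplier A => x a - y a)).
  by apply: cvgB; [exact: cvg_cst|exact: mL].
move: Fx; apply: filterS => y yx.
rewrite (_ : x a - y a = (x - y) a); last by rewrite /= scaleN1r.
by rewrite (le_trans (rnorm_mulL _ _))// ler_wpM2r ?rnorm_ge0// rnormC ltW.
Qed.

HB.instance Definition _ := @Uniform_isComplete.Build (multiplier A) multiplier_complete.

End MultiplierNorm.

Section MultiplierCStar.
Context {R : realType} {A : cstarAlgType R}.
Implicit Types (m n : multiplier A).

Fact multiplier_mulZl (k : R[i]) m n : mmul (k *: m) n = k *: mmul m n.
Proof. exact: multiplier_extL. Qed.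

Fact multiplier_mulZr (k : R[i]) m n : mmul m (k *: n) = k *: mmul m n.
Proof. by apply: multiplier_extL => a /=; rewrite mulLZ. Qed.

Fact multiplier_norm_mul m n : `|mmul m n| <= `|m| * `|n|.
Proof.
rewrite !rnormE -rmorphM/= lecR.
apply: multiplier_norm_le => [|a]; first by rewrite mulr_ge0 ?rnorm_ge0.
rewrite /= (le_trans (rnorm_mulL _ _))// -mulrA ler_wpM2l ?rnorm_ge0//.
exact: rnorm_mulL.
Qed.

Fact mstarK : involutive (@mstar R A).
Proof. by move=> m; apply: multiplier_extL => a /=; rewrite !cstarK. Qed.

Fact mstarD m n : mstar (m + n) = mstar m + mstar n.
Proof. by apply: multiplier_extL => a /=; rewrite cstarD. Qed.

Fact mstarZ (k : R[i]) m : mstar (k *: m) = k^*%R *: mstar m.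
Proof. by apply: multiplier_extL => a /=; rewrite cstarZ. Qed.

Fact mstarM m n : mstar (mmul m n) = mmul (mstar n) (mstar m).
Proof. by apply: multiplier_extL => a /=; rewrite cstarK. Qed.

(** The equality |n a|^2 = |a^* (n^* n a)| gives the nontrivial inequality. Applied to n and to its
    adjoint, it also yields that the involution is isometric, from which the reverse inequality
    follows. *)
Fact multiplier_cstar_norm m : `|mmul (mstar m) m| = `|m| ^+ 2.
Proof.
have le n : rnorm n ^+ 2 <= rnorm (mmul (mstar n) n).
  rewrite -[leRHS]sqr_sqrtr ?rnorm_ge0// lerXn2r ?nnegrE ?rnorm_ge0 ?sqrtr_ge0//.
  apply: multiplier_norm_le => [|a]; first exact: sqrtr_ge0.
  rewrite -(@ler_pXn2r _ 2)// ?nnegrE ?mulr_ge0 ?rnorm_ge0 ?sqrtr_ge0//.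
  rewrite exprMn sqr_sqrtr ?rnorm_ge0// -rnorm_cstarM.
  have -> : cstar (n a) ** n a = cstar a ** mmul (mstar n) n a.
    by rewrite [RHS](mulLR (mstar n) (cstar a) (n a)) /= cstarK.
  rewrite (le_trans (rnorm_cmul _ _))// rnorm_cstar mulrC expr2 mulrA.
  by rewrite ler_wpM2r ?rnorm_ge0// rnorm_mulL.
have mul n : rnorm (mmul (mstar n) n) <= rnorm (mstar n) * rnorm n.
  by rewrite -lecR rmorphM/= -!rnormE multiplier_norm_mul.
have star_ge n : rnorm n <= rnorm (mstar n).
  have := le_trans (le n) (mul n).
  have [->|n0] := eqVneq (rnorm n) 0; first by rewrite rnorm_ge0.
  by rewrite expr2 ler_pM2r// lt_def n0 rnorm_ge0.
have starE : rnorm (mstar m) = rnorm m.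
  by apply/eqP; rewrite eq_le star_ge -{2}(mstarK m) star_ge.
rewrite !rnormE -rmorphXn/=; congr (_%:C); apply/eqP.
by rewrite eq_le le andbT (le_trans (mul m))// starE expr2.
Qed.

HB.instance Definition _ := @isCStarAlgebra.Build R (multiplier A)
  (@mmul R A) (@mstar R A) (@mmulA R A) (@mmulDl R A) (@mmulDr R A)
  multiplier_mulZl multiplier_mulZr multiplier_norm_mul mstarK mstarD mstarZ
  mstarM multiplier_cstar_norm.

Lemma scalemAl (k : R[i]) m n : k *: (m * n) = (k *: m) * n.
Proof. by rewrite [RHS]multiplier_mulZl. Qed.

Lemma scalemAr (k : R[i]) m n : k *: (m * n) = m * (k *: n).
Proof. by rewrite [RHS]multiplier_mulZr. Qed.

Lemma rnorm_mul m n : rnorm (m * n) <= rnorm m * rnorm n.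
Proof. exact: rnorm_cmul. Qed.

Lemma rnorm_star_mul m : rnorm (cstar m * m) = rnorm m ^+ 2.
Proof. exact: rnorm_cstarM. Qed.

Lemma mstar_mul m n : cstar (m * n) = cstar n * cstar m.
Proof. exact: cstarM. Qed.

Lemma mstar1 : cstar (1 : multiplier A) = 1.
Proof. by apply: multiplier_extL => a /=; rewrite cstarK. Qed.

Lemma mstarXn m k : cstar (m ^+ k) = cstar m ^+ k.
Proof.
elim: k => [|k ih]; first by rewrite !expr0 mstar1.
by rewrite exprSr exprS mstar_mul ih.
Qed.

Lemma rnorm_mone : rnorm (1 : multiplier A) <= 1.
Proof. by apply: multiplier_norm_le => // a; rewrite mul1r. Qed.

Lemma rnorm_scal1 (t : R) : rnorm (t%:C *: (1 : multiplier A)) <= `|t|.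
Proof. by rewrite rnormZr ler_piMr// rnorm_mone. Qed.

End MultiplierCStar.

(** * Positive multipliers *)

Section Order.
Context {R : realType} {A : cstarAlgType R}.
Local Notation M := (multiplier A).
Implicit Types (a b h k l m n x y z w : M) (s t e : R).
Local Notation "t %:S" := (t%:C *: (1 : M)) (at level 2, format "t %:S").

Lemma scal1M t m : t%:S * m = t%:C *: m.
Proof. by rewrite -scalemAl mul1r. Qed.

Lemma scal1_comm t m : m * t%:S = t%:S * m.
Proof. by rewrite scal1M -scalemAr mulr1. Qed.

Lemma scal1D s t : (s + t)%:S = s%:S + t%:S.
Proof. by rewrite rmorphD/= scalerDl. Qed.

Lemma scal1B s t : (s - t)%:S = s%:S - t%:S.
Proof. by rewrite rmorphB/= scalerBl. Qed.

Lemma scal1_star t : cstar t%:S = t%:S.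
Proof. by rewrite cstarZr mstar1. Qed.

(** Positivity without spectra: for self-adjoint h the norm condition says that the spectrum lies in
    [0, 2t]. Sums and positive multiples are immediate from it; squares, commuting products and
    [cstar y * y] take work. *)
Definition mpos (h : M) :=
  cstar h = h /\ exists2 t, 0 <= t & rnorm (t%:S - h) <= t.

Lemma mposD h k : mpos h -> mpos k -> mpos (h + k).
Proof.
move=> [hs [t t0 ht]] [ks [s s0 ks']]; split; first by rewrite cstarD hs ks.
exists (t + s); first by rewrite addr_ge0.
by rewrite scal1D opprD addrACA (le_trans (rnormD _ _))// lerD.
Qed.

Lemma mposZ h s : 0 <= s -> mpos h -> mpos (s%:C *: h).
Proof.
move=> s0 [hs [t t0 ht]]; split; first by rewrite cstarZr hs.
exists (s * t); first by rewrite mulr_ge0.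
by rewrite rmorphM/= -scalerA -scalerBr rnormZr ger0_norm// ler_wpM2l.
Qed.

Lemma mpos_scal1 t : 0 <= t -> mpos t%:S.
Proof.
move=> t0; split; first exact: scal1_star.
by exists t => //; rewrite subrr rnorm0.
Qed.

Lemma mpos_bound h t : cstar h = h -> rnorm h <= t -> mpos (t%:S - h).
Proof.
move=> hs ht; split; first by rewrite cstarB scal1_star hs.
exists t; first by rewrite (le_trans _ ht)// rnorm_ge0.
by rewrite opprB addrC subrK.
Qed.

Lemma mpos_boundN h t : cstar h = h -> rnorm h <= t -> mpos (t%:S + h).
Proof.
move=> hs ht; rewrite -[h]opprK; apply: mpos_bound; last by rewrite rnormN.
by rewrite -[- h]sub0r cstarB hs cstar0.
Qed.

(* [l + 'i m] has square norm [l^2 + m^2] *)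
Lemma rnorm_re_le l m : cstar l = l -> cstar m = m -> l * m = m * l ->
  rnorm l ^+ 2 <= rnorm (l * l + m * m) /\ rnorm m ^+ 2 <= rnorm (l * l + m * m).
Proof.
move=> ls ms lm; pose z := l + 'i *: m.
have zs : cstar z = l - 'i *: m.
  rewrite /z cstarD ls cstarZ ms; congr (_ + _); rewrite -scaleNr; congr (_ *: _).
  by apply/eqP; rewrite eq_complex/= oppr0 !eqxx.
have ii : 'i * 'i = -1 :> R[i] by rewrite -expr2 sqr_i.
have zz : cstar z * z = l * l + m * m.
  rewrite zs /z mulrBl !mulrDr -scalemAr -!scalemAl -scalemAr scalerA ii scaleN1r.
  by rewrite lm; zmod.
have nz : rnorm z ^+ 2 = rnorm (l * l + m * m) by rewrite -rnorm_star_mul zz.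
have ni : rnorm ('i : R[i]) = 1.
  by rewrite /rnorm normc_def/= expr0n expr1n add0r sqrtr1.
have lz : l = (2^-1)%:C *: (z + cstar z).
  rewrite zs (_ : z + _ = l + l); last by rewrite /z; zmod.
  rewrite scalerDr -scalerDl -rmorphD/=.
  by rewrite -[2^-1]mul1r -splitr scale1r.
have mz : 'i *: m = (2^-1)%:C *: (z - cstar z).
  rewrite zs (_ : z - _ = 'i *: m + 'i *: m); last by rewrite /z; zmod.
  rewrite scalerDr -scalerDl -rmorphD/=.
  by rewrite -[2^-1]mul1r -splitr scale1r.
have z0 := rnorm_ge0 z.
have half (u v : M) : rnorm v = rnorm u ->
    rnorm ((2^-1)%:C *: (u + v)) <= rnorm u.
  move=> uv; rewrite rnormZr ger0_norm ?invr_ge0//.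
  by have := rnormD u v; rewrite uv; lra.
rewrite -!nz; split; rewrite lerXn2r ?nnegrE ?rnorm_ge0//.
  by rewrite {1}lz half// rnorm_cstar.
by rewrite -[rnorm m]mul1r -ni -rnormZ mz half// rnormN rnorm_cstar.
Qed.

(** After rescaling to y with |y| < 1, the square root l of 1 - y^2 is self-adjoint and commutes
    with y. Since l^2 + y^2 = 1, [rnorm_re_le] gives |l| <= 1, hence |1 - y^2| <= 1. *)
Lemma mpos_sq_norm x t : cstar x = x -> rnorm x ^+ 2 < t ->
  rnorm (t%:S - x * x) <= t.
Proof.
move=> xs xt; have t0 : 0 < t by rewrite (le_lt_trans _ xt)// exprn_ge0// rnorm_ge0.
pose y : M := (Num.sqrt t)^-1%:C *: x.
have st0 : 0 < Num.sqrt t by rewrite sqrtr_gt0.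
have ys : cstar y = y by rewrite /y cstarZr xs.
have xx : x * x = t%:C *: (y * y).
  rewrite /y -scalemAr -scalemAl !scalerA -!rmorphM/=.
  rewrite (_ : t * _ * _ = 1) ?scale1r// -[X in X * _ * _](sqr_sqrtr (ltW t0)).
  by field; rewrite gt_eqF.
have yy1 : rnorm (y * y) < 1.
  move: xt; rewrite -rnorm_star_mul xs xx rnormZr gtr0_norm//.
  by rewrite -ltr_pdivlMl// mulVf// gt_eqF.
have yys : cstar (y * y) = y * y by rewrite mstar_mul ys.
have [v [_ vs vE vc]] := cstar_sqrt yy1 yys.
have yv : y * v = v * y by apply: vc; exact: mulrA.
pose l := 1 - v.
have ll : l * l = 1 - y * y.
  by rewrite -[in RHS]vE /l mulrBl mul1r mulrBr mulr1; zmod.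
have ls : cstar l = l by rewrite /l cstarB mstar1 vs.
have ly : l * y = y * l by rewrite /l mulrBl mulrBr mul1r mulr1 yv.
have [h _] := rnorm_re_le ls ys ly.
rewrite ll subrK in h.
rewrite xx -scalerBr rnormZr gtr0_norm// -ll ler_piMr ?(ltW t0)//.
rewrite (le_trans (rnorm_mul _ _))// -expr2 (le_trans h)// rnorm_mone//.
Qed.

Lemma mpos_sqr x : cstar x = x -> mpos (x * x).
Proof.
move=> xs; split; first by rewrite mstar_mul xs.
exists (rnorm x ^+ 2 + 1); first by rewrite addr_ge0// exprn_ge0// rnorm_ge0.
by rewrite mpos_sq_norm// ltrDl.
Qed.

(** The shift by e provides the strict inequality that [cstar_sqrt] asks for: (t - h) / (t + e) has
    norm at most t / (t + e) < 1. *)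
Lemma mpos_root h e : mpos h -> 0 < e ->
  exists l, [/\ cstar l = l, l * l = h + e%:S &
    forall w, w * h = h * w -> w * l = l * w].
Proof.
move=> [hs [t t0 ht]] e0; have te : 0 < t + e by rewrite ltr_wpDl.
pose z : M := (t + e)^-1%:C *: (t%:S - h).
have z1 : rnorm z < 1.
  rewrite /z rnormZr gtr0_norm ?invr_gt0// mulrC ltr_pdivrMr// mul1r.
  by rewrite (le_lt_trans ht)// ltrDl.
have zs : cstar z = z by rewrite /z cstarZr cstarB scal1_star hs.
have [x [_ xs xE xc]] := cstar_sqrt z1 zs.
pose l : M := (Num.sqrt (t + e))%:C *: (1 - x); exists l; split.
- by rewrite /l cstarZr cstarB mstar1 xs.
- rewrite /l -scalemAl -scalemAr scalerA -rmorphM/= -expr2 sqr_sqrtr ?(ltW te)//.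
  have -> : (1 - x) * (1 - x) = 1 - z.
    by rewrite -xE mulrBl mul1r mulrBr mulr1; zmod.
  rewrite scalerBr /z scalerA -rmorphM/= divff ?gt_eqF// scale1r scal1D.
  by zmod.
- move=> w wh; rewrite /l -scalemAl -scalemAr; congr (_ *: _).
  rewrite mulrBl mulrBr mul1r mulr1; congr (_ - _); apply: xc.
  rewrite -[LHS]/(w * z) -[RHS]/(z * w) /z -scalemAl -scalemAr.
  by rewrite mulrBl mulrBr wh scal1_comm.
Qed.

(** Up to 2e, the number |h| itself serves as the witness t of positivity. A witness independent of
    e is what makes positivity a closed condition in [mpos_closed]. *)
Lemma mpos_norm h e : cstar h = h -> 0 <= e ->
  mpos (h + e%:S) -> rnorm ((rnorm h)%:S - h) <= rnorm h + e + e.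
Proof.
move=> hs e0 hp; apply: rnorm_le_eps => d d0.
pose f := d / 4; have f0 : 0 < f by rewrite divr_gt0.
have [l [ls ll _]] := mpos_root hp f0.
have nl : rnorm l ^+ 2 <= rnorm h + e + f.
  rewrite -rnorm_star_mul ls ll.
  have h1 := rnormD (h + e%:S) f%:S; have h2 := rnormD h e%:S.
  have := @rnorm_scal1 _ A e; have := @rnorm_scal1 _ A f.
  by rewrite (ger0_norm e0) (gtr0_norm f0); lra.
have := @mpos_sq_norm l (rnorm h + e + f + f) ls.
rewrite (le_lt_trans nl) ?ltrDl// => /(_ isT); rewrite ll => {}nl.
have -> : (rnorm h)%:S - h = ((rnorm h + e + f + f)%:S - (h + e%:S + f%:S)) - f%:S.
  by rewrite !scal1D; zmod.
rewrite (le_trans (rnormB _ _))//.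
have := @rnorm_scal1 _ A f; rewrite gtr0_norm// => h1.
rewrite (le_trans (lerD nl h1))// /f; lra.
Qed.

Lemma mpos_closed h : cstar h = h -> (forall e, 0 < e -> mpos (h + e%:S)) ->
  mpos h.
Proof.
move=> hs hp; split=> //; exists (rnorm h); first exact: rnorm_ge0.
apply: rnorm_le_eps => e e0; have e20 : 0 < e / 2 by rewrite divr_gt0.
have := mpos_norm hs (ltW e20) (hp _ e20); rewrite -addrA -splitr//.
Qed.

Lemma mpos_sa h : mpos h -> cstar h = h. Proof. by case. Qed.

Lemma mpos_eps h e : mpos h -> 0 <= e -> mpos (h + e%:S).
Proof. by move=> hp e0; apply: mposD => //; exact: mpos_scal1. Qed.

(** The roots of h + d and k + d commute, so the product of the shifted elements is the square of a
    self-adjoint element. The rest of hk + e is a positive combination once d is small. *)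
Lemma mposM h k : mpos h -> mpos k -> h * k = k * h -> mpos (h * k).
Proof.
move=> hp kp hk; have hs := mpos_sa hp; have ks := mpos_sa kp.
apply: mpos_closed; first by rewrite mstar_mul hs ks.
(* With d = e / c one has d N + d + d e = e for N = |h| + |k|, and d <= 1; hence e - d N - d^2 is
   nonnegative. *)
move=> e e0; pose c := rnorm h + rnorm k + 1 + e.
have h0 := rnorm_ge0 h; have k0 := rnorm_ge0 k.
have c0 : 0 < c by rewrite /c; lra.
pose d := e / c; have d0 : 0 < d by rewrite divr_gt0.
have [l [ls ll lc]] := mpos_root hp d0.
have [m [ms mm mc]] := mpos_root kp d0.
have lk : k * l = l * k by apply: lc.
have lm : l * m = m * l by apply: mc.
have E : (l * m) * (l * m) = (h + d%:S) * (k + d%:S).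
  by rewrite -ll -mm -!mulrA; congr (_ * _); rewrite !mulrA; congr (_ * _).
have P1 : mpos ((h + d%:S) * (k + d%:S)).
  by rewrite -E; apply: mpos_sqr; rewrite mstar_mul ls ms.
have [N NE] : exists N, N = rnorm h + rnorm k by eexists.
have -> : h * k + e%:S = (h + d%:S) * (k + d%:S) +
    (d%:C *: (N%:S - (h + k)) + (e - d * N - d * d)%:S).
  rewrite mulrDl !mulrDr !scal1_comm !scal1M !scal1B scalerBr !scalerDr !scalerA -!rmorphM/=.
  by zmod.
apply: mposD => //; apply: mposD.
  apply: mposZ; first exact: ltW.
  by apply: mpos_bound; [rewrite cstarD hs ks|rewrite NE; exact: rnormD].
apply: mpos_scal1.
have dc : d * c = e by rewrite /d mulfVK// gt_eqF.
have de : d <= 1.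
  by rewrite /d ler_pdivrMr// mul1r /c; lra.
have dd : d * d <= d by rewrite ler_piMr// ltW.
have : d * N + d + d * e = e by rewrite -[RHS]dc /c NE; ring.
have : 0 <= d * e by rewrite mulr_ge0// ltW.
lra.
Qed.

(** The commuting square roots of s - k + d and k + d have squares adding up to the scalar s + 2d,
    so [rnorm_re_le] bounds the second root. *)
Lemma mpos_le_norm k s : 0 <= s -> mpos k -> mpos (s%:S - k) -> rnorm k <= s.
Proof.
move=> s0 kp skp; apply: rnorm_le_eps => e e0.
pose d := e / 3; have d0 : 0 < d by rewrite divr_gt0.
have [m [ms mm mc]] := mpos_root kp d0.
have [l [ls ll lc]] := mpos_root skp d0.
have mk : k * m = m * k by apply: mc.
have lm : m * l = l * m.
  by apply: lc; rewrite mulrBl mulrBr scal1_comm mk.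
have [_] := rnorm_re_le ls ms (esym lm).
rewrite -rnorm_star_mul ms mm ll.
rewrite (_ : s%:S - k + d%:S + (k + d%:S) = (s + d + d)%:S); last by rewrite !scal1D; zmod.
move=> h1; have h2 := @rnorm_scal1 _ A (s + d + d).
have h3 := rnormB (k + d%:S) d%:S; rewrite addrK in h3.
have h4 := @rnorm_scal1 _ A d.
rewrite !ger0_norm in h2 h4; [|lra..].
rewrite /d in h1 h2 h3 h4 *; lra.
Qed.

(** The fixed point of x -> 1 + z x is the Neumann series for 1 - z, and r = 1 / (1 - q) is the
    radius solving 1 + q r = r. Adjoints turn the right inverse into a two-sided one. *)
Lemma mpos_inv h e : mpos h -> 0 < e ->
  exists w, [/\ cstar w = w, (h + e%:S) * w = 1 & w * (h + e%:S) = 1].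
Proof.
move=> [hs [t t0 ht]] e0; have te : 0 < t + e by rewrite ltr_wpDl.
pose z : M := (t + e)^-1%:C *: (t%:S - h).
pose q := t / (t + e).
have zq : rnorm z <= q.
  by rewrite /z rnormZr gtr0_norm ?invr_gt0// mulrC ler_wpM2r// invr_ge0 ltW.
have q0 : 0 <= q by rewrite divr_ge0// ltW.
have q1 : q < 1 by rewrite ltr_pdivrMr// mul1r ltrDl.
pose r := (1 - q)^-1; have r0 : 0 <= r by rewrite invr_ge0 subr_ge0 ltW.
have rE : 1 + q * r = r by rewrite /r; field; rewrite subr_eq0 gt_eqF.
have [|x y _ _|x _ xE] := @contraction_fixpoint R M (fun x => 1 + z * x) q r q0 q1 r0.
- move=> x xr; rewrite -rE (le_trans (rnormD _ _))// lerD ?rnorm_mone//.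
  by rewrite (le_trans (rnorm_mul _ _))// ler_pM ?rnorm_ge0.
- rewrite (_ : _ - _ = z * (x - y)); last by rewrite mulrBr; zmod.
  by rewrite (le_trans (rnorm_mul _ _))// ler_wpM2r ?rnorm_ge0.
have zs : cstar z = z by rewrite /z cstarZr cstarB scal1_star hs.
have hz : h + e%:S = (t + e)%:C *: (1 - z).
  rewrite scalerBr /z scalerA -rmorphM/= divff ?gt_eqF// scale1r scal1D.
  by zmod.
have zx : (1 - z) * x = 1 by rewrite mulrBl mul1r -{1}xE addrK.
have xz : cstar x * (1 - z) = 1.
  by have := congr1 cstar zx; rewrite mstar_mul cstarB mstar1 zs.
have xs : cstar x = x by rewrite -[LHS]mulr1 -zx mulrA xz mul1r.
rewrite xs in xz.
exists ((t + e)^-1%:C *: x); rewrite hz; split.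
- by rewrite cstarZr xs.
- by rewrite -scalemAr -scalemAl scalerA -rmorphM/= mulVf ?gt_eqF// scale1r.
- by rewrite -scalemAr -scalemAl scalerA -rmorphM/= divff ?gt_eqF// scale1r.
Qed.

(* the spectra of [y y^*] and [y^* y] agree away from [0] *)
Lemma mpos_swap y e : 0 < e -> mpos (y * cstar y + e%:S) ->
  mpos (cstar y * y + e%:S).
Proof.
move=> e0 yp; set h := cstar y * y.
have hs : cstar h = h by rewrite /h mstar_mul cstarK.
(* The infimum u of the admissible shifts is attained because positivity is closed. If u exceeded e,
   then h + u would be invertible and the shift could be lowered further. *)
pose S := [set s : R | e <= s /\ mpos (h + s%:S)].
have S0 : S !=set0.
  exists (e + rnorm h); split; first by rewrite lerDl rnorm_ge0.
  by rewrite addrC; apply: mpos_boundN => //; rewrite lerDr ltW.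
have infS : has_inf S by split=> //; exists e => s [].
pose u := inf S.
have eu : e <= u by apply: lb_le_inf => // s [].
have up : mpos (h + u%:S).
  apply: mpos_closed => [|d d0]; first by rewrite cstarD hs scal1_star.
  have [s [es sp] su] := inf_adherent d0 infS.
  rewrite (_ : h + u%:S + d%:S = (h + s%:S) + (u + d - s)%:S).
    by apply: mpos_eps => //; rewrite subr_ge0 ltW.
  by rewrite scal1B scal1D; zmod.
have [<-//|ue] := eqVneq u e; exfalso.
have {}ue : 0 < u - e by rewrite subr_gt0 lt_def ue eu.
have u0 : 0 < u by lra.
have [w [ws kw wk]] := mpos_inv yp ue.
have kE : y * cstar y + e%:S + (u - e)%:S = y * cstar y + u%:S.
  by rewrite scal1B; zmod.
rewrite kE in kw wk.
(* This is the resolvent identity that links the spectra: an inverse w of [y * cstar y + u] yields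
   the inverse of [cstar y * y + u]. *)
pose v : M := u^-1%:C *: (1 - cstar y * w * y).
have vs : cstar v = v.
  by rewrite /v cstarZr cstarB mstar1 !mstar_mul cstarK ws mulrA.
have hv : (h + u%:S) * v = 1.
  rewrite /v -scalemAr mulrBr mulr1.
  have -> : (h + u%:S) * (cstar y * w * y) = h.
    transitivity (cstar y * ((y * cstar y + u%:S) * w) * y).
      rewrite /h mulrDl [in RHS]mulrDl [in RHS]mulrDr [in RHS]mulrDl !mulrA.
      by rewrite scal1_comm.
    by rewrite kw mulr1.
  rewrite (_ : h + u%:S - h = u%:S); last by zmod.
  by rewrite scalerA -rmorphM/= mulVf ?scale1r// gt_eqF.
have vh : v * (h + u%:S) = 1.
  by have := congr1 cstar hv; rewrite mstar_mul vs cstarD scal1_star hs mstar1.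
(* The inverse of a positive element is positive, being the commuting product of h + u and the
   square of v. *)
have vp : mpos v.
  have -> : v = (h + u%:S) * (v * v) by rewrite mulrA hv mul1r.
  by apply: mposM => //; [exact: mpos_sqr|rewrite mulrA hv mul1r -mulrA vh mulr1].
(* Since c - v is positive, so is (c - v)(h + u) / c, which equals h + u - 1/c. The shift u - 1/c is
   therefore admissible. *)
pose c := rnorm v + 1; have c0 : 0 < c by rewrite ltr_wpDl ?rnorm_ge0.
have cp : mpos (h + (u - c^-1)%:S).
  have -> : h + (u - c^-1)%:S = c^-1%:C *: ((c%:S - v) * (h + u%:S)).
    rewrite mulrBl vh scal1M scalerBr scalerA -rmorphM/= mulVf ?gt_eqF//.
    by rewrite scale1r scal1B; zmod.
  apply: mposZ; first by rewrite invr_ge0 ltW.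
  apply: mposM => //; last by rewrite mulrBl mulrBr hv vh scal1_comm.
  by apply: mpos_bound => //; rewrite /c lerDl.
have : S (Num.max e (u - c^-1)).
  split; first by rewrite le_max lexx.
  rewrite -[X in mpos (h + X)](subrK (u - c^-1)%:S) addrCA -scal1B addrC.
  by apply: mpos_eps => //; rewrite subr_ge0 le_max lexx orbT.
move=> /(ge_inf (proj2 infS)); rewrite -/u leNgt gt_max.
by rewrite -subr_gt0 ue/= ltrBlDr ltrDl invr_gt0 c0.
Qed.

End Order.

Section Positivity.
Context {R : realType} {A : cstarAlgType R}.
Local Notation M := (multiplier A).
Implicit Types (a b c h k l x y z w : M) (s t e : R) (n : nat).
Local Notation "t %:S" := (t%:C *: (1 : M)) (at level 2, format "t %:S").

Lemma mpos_exp c n : mpos c -> mpos (c ^+ n).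
Proof.
move=> cp; elim: n => [|n ih].
  by rewrite expr0 -[1]scale1r; exact: mpos_scal1.
by rewrite exprS; apply: mposM => //; rewrite -exprS exprSr.
Qed.

(** The elements [x1] and [x2] are, up to sign, twice the real and imaginary parts of y, and half
    the sum of their squares is the given element. *)
Lemma mpos_star_addC y : mpos (cstar y * y + y * cstar y).
Proof.
pose x1 : M := y + cstar y; pose x2 : M := 'i *: (y - cstar y).
have ii : 'i * 'i = -1 :> R[i] by rewrite -expr2 sqr_i.
have x1s : cstar x1 = x1 by rewrite /x1 cstarD cstarK addrC.
have x2s : cstar x2 = x2.
  rewrite /x2 cstarZ cstarB cstarK -[y - _]opprB scalerN -scaleNr.
  congr (_ *: _); apply/eqP; rewrite eq_complex/= oppr0 !eqxx//.
rewrite (_ : _ + _ = (2^-1)%:C *: (x1 * x1 + x2 * x2)).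
  by apply: mposZ; [rewrite invr_ge0|apply: mposD; exact: mpos_sqr].
rewrite /x2 -scalemAl -scalemAr scalerA ii scaleN1r /x1.
rewrite (_ : _ - _ = (cstar y * y + y * cstar y) + (cstar y * y + y * cstar y)).
  by rewrite scalerDr -scalerDl -rmorphD/= -[2^-1]mul1r -splitr scale1r.
by rewrite mulrBl mulrDl !mulrBr !mulrDr; zmod.
Qed.

(* For [-1 <= h <= 1] put [c = 1 - h]; then [1 - (n+1) h c^n - c^(n+1)] and
   [h - h c^n] are sums of products of [h^2] and powers of [c]. *)
Lemma mpos_cut h n : cstar h = h -> rnorm h <= 1 ->
  mpos (1 - n.+1%:R%:C *: (h * (1 - h) ^+ n)) /\
  mpos (h - h * (1 - h) ^+ n).
Proof.
move=> hs h1; pose c : M := 1 - h.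
have cp : mpos c by rewrite /c -[1]scale1r; exact: mpos_bound.
have ch : c * h = h * c by rewrite /c mulrBl mulrBr mul1r mulr1.
have cnh j : c ^+ j * h = h * c ^+ j by apply/commr_sym/commrX.
have hhc j : mpos (h * h * c ^+ j).
  apply: mposM; [exact: mpos_sqr|exact: mpos_exp|].
  by rewrite -mulrA -cnh mulrA -cnh mulrA.
have step j : h * c ^+ j.+1 = h * c ^+ j - h * h * c ^+ j.
  by rewrite exprS /c mulrBl mul1r mulrBr mulrA.
split.
  suff : mpos (1 - n.+1%:R%:C *: (h * c ^+ n) - c ^+ n.+1).
    by move=> pn; have := mposD pn (mpos_exp n.+1 cp); rewrite subrK.
  elim: n => [|n ih].
    rewrite expr0 mulr1 expr1 scale1r /c subrr.
    by rewrite -(scale0r (1 : M)); exact: mpos_scal1.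
  rewrite (_ : _ - _ = (1 - n.+1%:R%:C *: (h * c ^+ n) - c ^+ n.+1) +
     n.+1%:R%:C *: (h * h * c ^+ n)).
    by apply: mposD => //; exact: mposZ.
  have -> : c ^+ n.+2 = c ^+ n.+1 - h * c ^+ n.+1 by rewrite exprS {1}/c mulrBl mul1r.
  rewrite step -[n.+2]addn1 natrD rmorphD/= scalerDl scale1r scalerBr.
  by zmod.
elim: n => [|n ih].
  rewrite expr0 mulr1 subrr -(scale0r (1 : M)); exact: mpos_scal1.
rewrite -/c step (_ : _ - _ = (h - h * c ^+ n) + h * h * c ^+ n).
  exact: mposD.
by zmod.
Qed.

(** Write h = y^* y with |h| <= 1, c = 1 - h and z = y c^n. By [mpos_cut], z^* z = h c^(2n) is at
    most 1/(2n+1) <= e. As z^* z + z z^* is positive, z z^* + e is positive, and [mpos_swap]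
    transfers this to z^* z + e. Adding the positive element h - h c^(2n) gives h + e. *)
Lemma mpos_star_mul y : mpos (cstar y * y).
Proof.
wlog y1 : y / rnorm y <= 1.
  move=> hw; have r0 : 0 < rnorm y + 1 by rewrite ltr_wpDl ?rnorm_ge0.
  have -> : cstar y * y = ((rnorm y + 1) ^+ 2)%:C *:
      (cstar ((rnorm y + 1)^-1%:C *: y) * ((rnorm y + 1)^-1%:C *: y)).
    rewrite cstarZr -scalemAl -scalemAr !scalerA -!rmorphM/= expr2.
    by rewrite mulfK ?gt_eqF// divff ?gt_eqF// scale1r.
  apply: mposZ; first by rewrite exprn_ge0// ltW.
  apply: hw; rewrite rnormZr gtr0_norm ?invr_gt0// mulrC ler_pdivrMr// mul1r.
  by rewrite lerDl.
set h := cstar y * y.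
have hs : cstar h = h by rewrite /h mstar_mul cstarK.
have h1 : rnorm h <= 1 by rewrite /h rnorm_star_mul expr_le1// rnorm_ge0.
pose c : M := 1 - h.
have cs : cstar c = c by rewrite /c cstarB mstar1 hs.
have ch : c * h = h * c by rewrite /c mulrBl mulrBr mul1r mulr1.
have cnh j : c ^+ j * h = h * c ^+ j by apply/commr_sym/commrX.
apply: mpos_closed => // e e0.
pose n := Num.truncn e^-1.
have ne : n.+1%:R^-1 <= e.
  by rewrite -[leRHS]invrK lef_pV2 ?posrE ?invr_gt0// ltW// truncnS_gt.
have nn : (n.+1 <= (n + n).+1)%N by rewrite ltnS leq_addr.
have [p1 p2] := mpos_cut (n + n) hs h1.
pose z := y * c ^+ n.
have zz : cstar z * z = h * c ^+ (n + n).
  rewrite /z mstar_mul mstarXn cs -mulrA [cstar y * _]mulrA -/h mulrA cnh.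
  by rewrite -mulrA exprD.
have p3 : mpos (e%:S - h * c ^+ (n + n)).
  have -> : e%:S - h * c ^+ (n + n) = (n + n).+1%:R^-1%:C *:
       (1 - (n + n).+1%:R%:C *: (h * c ^+ (n + n))) + (e - (n + n).+1%:R^-1)%:S.
    rewrite scalerBr scalerA -rmorphM/= mulVf ?pnatr_eq0// scale1r scal1B.
    by zmod.
  apply: mposD; first by apply: mposZ => //; rewrite invr_ge0.
  apply: mpos_scal1; rewrite subr_ge0 (le_trans _ ne)// lef_pV2 ?posrE//.
  by rewrite ler_nat.
have p4 : mpos (z * cstar z + e%:S).
  have := mposD (mpos_star_addC z) p3; rewrite zz.
  set u := h * _; rewrite (_ : u + _ + (_ - u) = z * cstar z + e%:S)//; zmod.
have p5 := mpos_swap e0 p4.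
have := mposD p2 p5; rewrite zz.
set u := h * _; rewrite (_ : h - u + (u + e%:S) = h + e%:S)//; zmod.
Qed.

Lemma mpos_conj k x : mpos k -> mpos (cstar x * k * x).
Proof.
move=> kp; have ks := mpos_sa kp.
apply: mpos_closed; first by rewrite !mstar_mul cstarK ks mulrA.
move=> e e0; pose c := rnorm x ^+ 2 + 1.
have c0 : 0 < c by rewrite ltr_wpDl// exprn_ge0// rnorm_ge0.
have [l [ls ll _]] := mpos_root kp (divr_gt0 e0 c0).
have -> : cstar x * k * x + e%:S = cstar (l * x) * (l * x) +
    (e / c)%:C *: (c%:S - cstar x * x).
  rewrite mstar_mul ls !mulrA -[_ * l * l]mulrA ll mulrDr scal1_comm mulrDl.
  rewrite scal1M -scalemAl scalerBr scalerA -rmorphM/= divfK ?gt_eqF//; zmod.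
apply: mposD; first exact: mpos_star_mul.
apply: mposZ; first by rewrite divr_ge0// ltW.
apply: mpos_bound; first by rewrite mstar_mul cstarK.
by rewrite rnorm_star_mul /c lerDl.
Qed.

End Positivity.

(** * Extreme functionals *)

Section ExtremeFunctional.
Context {R : realType} {E : lmodType R[i]}.
Implicit Types (p r f g : E -> R) (x y h : E) (s t : R).

Definition real_linear f :=
  (forall x y, f (x + y) = f x + f y) /\ forall t x, f (t%:C *: x) = t * f x.

Definition sublinear p :=
  (forall x y, p (x + y) <= p x + p y) /\
  forall t x, 0 <= t -> p (t%:C *: x) <= t * p x.

Lemma real_linearN f x : real_linear f -> f (- x) = - f x.
Proof.
by case=> _ fZ; have := fZ (-1) x; rewrite rmorphN rmorph1 scaleN1r mulN1r.
Qed.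

Lemma sublinear0 p : sublinear p -> p 0 = 0.
Proof.
move=> [pD pZ]; have := pD 0 0; have := pZ 0 0 (lexx _).
rewrite scaler0 addr0 mul0r; lra.
Qed.

Lemma sublinear_geN p x : sublinear p -> - p (- x) <= p x.
Proof.
move=> ps; have [pD _] := ps; have := pD x (- x).
by rewrite subrr sublinear0//; lra.
Qed.

(* [{f <= r}] is a face of [{f <= p}] *)
Definition face p r := forall g1 g2 s, real_linear g1 -> real_linear g2 ->
  (forall x, g1 x <= p x) -> (forall x, g2 x <= p x) -> 0 < s < 1 ->
  (forall x, s * g1 x + (1 - s) * g2 x <= r x) -> forall x, g1 x <= r x.

(* The functionals below [support_face r h] are those below [r] that attain
   [r h] at [h]. *)
Definition support_face r h x : R :=
  inf [set r (x + t%:C *: h) - t * r h | t in [set t | 0 <= t]].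

Section SupportFace.
Variables (r : E -> R) (h : E).
Hypothesis rs : sublinear r.

Lemma support_face_lb x t : 0 <= t -> - r (- x) <= r (x + t%:C *: h) - t * r h.
Proof.
move=> t0; have [rD rZ] := rs.
have tE : t * r h <= r (t%:C *: h).
  have [->|tn0] := eqVneq t 0; first by rewrite mul0r scale0r sublinear0.
  have tp : 0 < t by rewrite lt_def tn0.
  rewrite -ler_pdivlMl//; have := rZ t^-1 (t%:C *: h).
  by rewrite scalerA -rmorphM/= mulVf// scale1r; apply; rewrite invr_ge0.
have := rD (- x) (x + t%:C *: h); rewrite addKr; lra.
Qed.

Lemma support_face_has_inf x :
  has_inf [set r (x + t%:C *: h) - t * r h | t in [set t | 0 <= t]].
Proof.
split; first by exists (r (x + 0%:C *: h) - 0 * r h), 0 => //=.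
by exists (- r (- x)) => _ [t /= t0 <-]; exact: support_face_lb.
Qed.

Lemma support_face_le x t : 0 <= t -> support_face r h x <= r (x + t%:C *: h) - t * r h.
Proof. by move=> t0; apply: (ge_inf (proj2 (support_face_has_inf x))); exists t. Qed.

Lemma support_face_ge x c :
  (forall t, 0 <= t -> c <= r (x + t%:C *: h) - t * r h) -> c <= support_face r h x.
Proof.
move=> hc; apply: lb_le_inf; first by have [] := support_face_has_inf x.
by move=> _ [t /= t0 <-]; exact: hc.
Qed.

Lemma support_face_le1 x : support_face r h x <= r x.
Proof. by have := @support_face_le x 0 (lexx _); rewrite scale0r addr0 mul0r subr0. Qed.

Lemma support_face_sublinear : sublinear (support_face r h).
Proof.
have [rD rZ] := rs; split=> [x y|t x t0].
  rewrite -lerBlDr; apply: support_face_ge => s s0.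
  rewrite lerBlDl -lerBlDr; apply: support_face_ge => t t0.
  rewrite lerBlDl; have := @support_face_le (x + y) (s + t); rewrite addr_ge0//.
  move=> /(_ isT); have := rD (x + s%:C *: h) (y + t%:C *: h).
  by rewrite addrACA -scalerDl -rmorphD/=; lra.
have [->|tn0] := eqVneq t 0.
  by rewrite mul0r scale0r (le_trans (support_face_le1 _))// sublinear0.
have tp : 0 < t by rewrite lt_def tn0.
rewrite mulrC -ler_pdivrMr//; apply: support_face_ge => s s0.
rewrite ler_pdivrMr// (le_trans (@support_face_le _ (t * s) _)) ?mulr_ge0//.
have := rZ t (x + s%:C *: h) t0; rewrite scalerDr scalerA -rmorphM/=; lra.
Qed.

(** By the face property both g1 and g2 lie below r, and their convex combination attains r h at h.
    Hence each of them attains it, which is exactly what lying below [support_face r h] requires. *)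
Lemma support_face_face p : sublinear p -> face p r -> face p (support_face r h).
Proof.
move=> ps rface g1 g2 s l1 l2 g1p g2p s01 hle.
have le_r x : s * g1 x + (1 - s) * g2 x <= r x.
  exact: le_trans (hle x) (support_face_le1 x).
have g1r := rface _ _ _ l1 l2 g1p g2p s01 le_r.
have g2r : forall x, g2 x <= r x.
  apply: (rface g2 g1 (1 - s)) => // [|x]; first by move: s01; lra.
  by have := le_r x; lra.
have g1h : g1 h = r h.
  have := le_trans (hle (- h)) (@support_face_le _ 1 ler01).
  rewrite scale1r addNr sublinear0// mul1r !real_linearN//.
  have := g1r h; have := g2r h => h2 h1 h3.
  have /andP[s0 s1] := s01.
  have h4 : (1 - s) * g2 h <= (1 - s) * r h by rewrite ler_wpM2l// subr_ge0 ltW.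
  apply/eqP; rewrite eq_le h1/= -(ler_pM2l s0); lra.
move=> x; apply: support_face_ge => t t0.
have [g1D g1Z] := l1.
have := g1r (x + t%:C *: h); rewrite g1D g1Z g1h; lra.
Qed.

End SupportFace.

(** Hahn-Banach and Krein-Milman in one application of Zorn's lemma: faces are represented by
    sublinear functionals, and a minimal one is linear, so its face is a single extreme point. *)
Lemma extreme_functional p e : sublinear p ->
  exists f, [/\ real_linear f, forall x, f x <= p x, f e = p e &
    forall g1 g2 s, real_linear g1 -> real_linear g2 ->
      (forall x, g1 x <= p x) -> (forall x, g2 x <= p x) -> 0 < s < 1 ->
      (forall x, f x = s * g1 x + (1 - s) * g2 x) -> g1 =1 f].
Proof.
move=> ps.
(* The third condition becomes f e >= p e once the minimal r is known to be linear. It is passed on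
   to every smaller sublinear functional. *)
pose P r := [/\ sublinear r, forall x, r x <= p x, r (- e) <= - p e & face p r].
pose T := {r : E -> R | P r}.
(* The order is reversed, so that the maximal element given by [Zorn] is a minimal functional and
   upper bounds of chains are pointwise infima. *)
pose rel (u v : T) := `[< forall x, sval v x <= sval u x >].
have pface : face p p by [].
have base : P (support_face p e).
  split; [exact: support_face_sublinear|exact: support_face_le1| |].
    have := support_face_le e ps (- e) ler01.
    by rewrite scale1r addNr sublinear0// mul1r sub0r.
  exact: support_face_face.
have [||u v uv vu|A Atot|[r rP] rmin] := @Zorn T rel.
- by move=> u; apply/asboolP.
- move=> u v w /asboolP uv /asboolP vw; apply/asboolP => x.
  exact: le_trans (vw x) (uv x).
- case: u v uv vu => [u uP] [v vP] /= /asboolP/= uv /asboolP/= vu.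
  have uvE : u = v by apply/funext => x; apply/eqP; rewrite eq_le uv vu.
  by subst v; congr exist; exact: Prop_irrelevance.
- have [[u0 Au0]|A0] := pselect (A !=set0); last first.
    by exists (exist _ _ base) => u Au; exfalso; apply: A0; exists u.
  pose V x := [set sval u x | u in A].
  have Vinf x : has_inf (V x).
    split; first by exists (sval u0 x), u0.
    exists (- p (- x)) => _ [u Au <-]; have [us up _ _] := svalP u.
    by rewrite (le_trans _ (sublinear_geN x us))// lerN2.
  pose r x := inf (V x).
  have rle u x : A u -> r x <= sval u x.
    by move=> Au; apply: (ge_inf (proj2 (Vinf x))); exists u.
  have rge x c : (forall u, A u -> c <= sval u x) -> c <= r x.
    move=> hc; apply: lb_le_inf; first by have [] := Vinf x.
    by move=> _ [u Au <-]; exact: hc.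
  have rP : P r.
    split.
    - split=> [x y|t x t0].
        rewrite -lerBlDr; apply: (rge _ _) => u Au.
        rewrite lerBlDl -lerBlDr; apply: (rge _ _) => v Av; rewrite lerBlDl.
        have [/asboolP uv|/asboolP vu] := Atot _ _ Au Av.
          have [[vD _] _ _ _] := svalP v.
          rewrite (le_trans (rle _ _ Av))// (le_trans (vD _ _))// lerD2r.
          exact: uv.
        have [[uD _] _ _ _] := svalP u.
        rewrite (le_trans (rle _ _ Au))// (le_trans (uD _ _))// lerD2l.
        exact: vu.
      have [->|tn0] := eqVneq t 0.
        rewrite mul0r scale0r (le_trans (rle _ _ Au0))//.
        by have [us _ _ _] := svalP u0; rewrite sublinear0.
      have tp : 0 < t by rewrite lt_def tn0.
      rewrite mulrC -ler_pdivrMr//; apply: (rge _ _) => u Au.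
      rewrite ler_pdivrMr// (le_trans (rle _ _ Au))// mulrC.
      by have [[_ uZ] _ _ _] := svalP u; exact: uZ.
    - move=> x; have [_ up _ _] := svalP u0.
      exact: le_trans (rle _ _ Au0) (up x).
    - have [_ _ ue _] := svalP u0; exact: le_trans (rle _ _ Au0) ue.
    - move=> g1 g2 s l1 l2 g1p g2p s01 hle x; apply: (rge _ _) => u Au.
      have [_ _ _ uf] := svalP u; apply: (uf g1 g2 s) => // y.
      exact: le_trans (hle y) (rle _ _ Au).
  by exists (exist _ r rP) => u Au; apply/asboolP => x /=; exact: rle.
have [rs rp re rf] := rP.
have rD x y : r (x + y) = r x + r y.
  apply/eqP; rewrite eq_le (proj1 rs)/=.
  (* By minimality r equals its own support face at y, and evaluating that infimum at t = 1 gives r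
     x <= r (x + y) - r y. *)
  have sP : P (support_face r y).
    split; first exact: support_face_sublinear.
    - by move=> z; exact: le_trans (support_face_le1 y rs z) (rp z).
    - exact: le_trans (support_face_le1 y rs _) re.
    - exact: support_face_face.
  have /(congr1 sval)/= sE := rmin (exist _ _ sP) (introT (asboolP _) (support_face_le1 y rs)).
  have := support_face_le y rs x ler01; rewrite sE scale1r mul1r; lra.
have rN x : r (- x) = - r x.
  by have := rD x (- x); rewrite subrr sublinear0//; lra.
have rZ t x : 0 <= t -> r (t%:C *: x) = t * r x.
  move=> t0; apply/eqP; rewrite eq_le (proj2 rs)//=.
  by have := proj2 rs t (- x) t0; rewrite scalerN !rN; lra.
have rl : real_linear r.
  split=> // t x; have [t0|t0] := leP 0 t; first exact: rZ.
  have := rZ (- t) x; rewrite oppr_ge0 (ltW t0) => /(_ isT).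
  by rewrite rmorphN scaleNr rN mulNr => /oppr_inj.
exists r; split => //.
  by apply/eqP; rewrite eq_le rp/= -lerN2 -rN; exact: re.
move=> g1 g2 s l1 l2 g1p g2p s01 fE x.
have g1r : forall y, g1 y <= r y by apply: (rf g1 g2 s) => // y; rewrite fE.
apply/eqP; rewrite eq_le g1r/= -lerN2 -rN -(real_linearN x l1).
exact: g1r.
Qed.

End ExtremeFunctional.

Record semi_inner (R : realType) (V : lmodType R[i]) := SemiInner {
  sip :> V -> V -> R[i] ;
  sipDl : forall x y z, sip (x + y) z = sip x z + sip y z ;
  sipZl : forall (k : R[i]) x y, sip (k *: x) y = k * sip x y ;
  sip_conj : forall x y, sip y x = (sip x y)^*%R ;
  sip_ge0 : forall x, 0 <= complex.Re (sip x x)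
}.

(** * Hilbert completion of a semi-inner product *)

Section SemiInner.
Context {R : realType} {V : lmodType R[i]} (B : semi_inner V).
Implicit Types (x y z : V).

Lemma sipDr x y z : B x (y + z) = B x y + B x z.
Proof. by rewrite sip_conj sipDl rmorphD/= -!sip_conj. Qed.

Lemma sipZr (k : R[i]) x y : B x (k *: y) = k^*%R * B x y.
Proof. by rewrite sip_conj sipZl rmorphM/= -!sip_conj. Qed.

Lemma sipNl x y : B (- x) y = - B x y.
Proof. by rewrite -scaleN1r sipZl mulN1r. Qed.

Lemma sipNr x y : B x (- y) = - B x y.
Proof. by rewrite -scaleN1r sipZr rmorphN rmorph1 mulN1r. Qed.

Lemma sipBl x y z : B (x - y) z = B x z - B y z.
Proof. by rewrite sipDl sipNl. Qed.

Lemma sipBr x y z : B x (y - z) = B x y - B x z.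
Proof. by rewrite sipDr sipNr. Qed.

Lemma sip_real x : B x x = (complex.Re (B x x))%:C.
Proof. by rewrite RRe_real//; apply/CrealP; rewrite -sip_conj. Qed.

Definition sip_norm x : R := Num.sqrt (complex.Re (B x x)).

Lemma sip_norm_ge0 x : 0 <= sip_norm x.
Proof. exact: sqrtr_ge0. Qed.

Lemma sip_norm_sqr x : sip_norm x ^+ 2 = complex.Re (B x x).
Proof. by rewrite sqr_sqrtr ?sip_ge0. Qed.

Lemma sip_normZ (k : R[i]) x : sip_norm (k *: x) = rnorm k * sip_norm x.
Proof.
rewrite /sip_norm sipZl sipZr mulrA -sqr_normc rnormE -rmorphXn/= sip_real -rmorphM/=.
by rewrite sqrtrM ?exprn_ge0 ?rnorm_ge0// sqrtr_sqr ger0_norm ?rnorm_ge0.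
Qed.

(** Choosing the coefficient of y proportional to [B x y] makes the expansion a real quadratic in t.
    It yields both Cauchy-Schwarz and the orthogonality in [hilbert_projection]. *)
Lemma sip_norm_sqrB x y (t : R) :
  sip_norm (x - (t%:C * B x y) *: y) ^+ 2 =
  sip_norm x ^+ 2 - 2 * (t * rnorm (B x y) ^+ 2) +
    t ^+ 2 * rnorm (B x y) ^+ 2 * sip_norm y ^+ 2.
Proof.
set b := rnorm (B x y).
have bE : B x y * B y x = (b ^+ 2)%:C.
  by rewrite (sip_conj B x y) -sqr_normc rnormE rmorphXn.
rewrite !sip_norm_sqr sipBl !sipBr sipZl !sipZr sipZl rmorphM/= -sip_conj.
have -> : (t%:C)^*%R = t%:C by exact: conjc_real.
rewrite (_ : t%:C * B y x * B x y = (t * b ^+ 2)%:C); last first.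
  by rewrite -mulrA [B y x * _]mulrC bE -rmorphM.
rewrite (_ : t%:C * B x y * B y x = (t * b ^+ 2)%:C); last first.
  by rewrite -mulrA bE -rmorphM.
rewrite (_ : t%:C * B y x * (t%:C * B x y * B y y) =
    (t ^+ 2 * b ^+ 2 * complex.Re (B y y))%:C).
  by rewrite (sip_real x) -!rmorphB/=; ring.
rewrite (sip_real y) [LHS](_ : _ =
    t%:C * t%:C * (B x y * B y x) * (complex.Re (B y y))%:C).
  by rewrite bE -!rmorphM/= expr2.
ring.
Qed.

Lemma cauchy_schwarz x y : rnorm (B x y) <= sip_norm x * sip_norm y.
Proof.
set b := rnorm (B x y); have b0 : 0 <= b by exact: rnorm_ge0.
rewrite -(@ler_pXn2r _ 2)// ?nnegrE ?mulr_ge0 ?sip_norm_ge0//.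
rewrite exprMn !sip_norm_sqr.
set a := complex.Re (B x x); set c := complex.Re (B y y).
have a0 : 0 <= a := sip_ge0 B x; have c0 : 0 <= c := sip_ge0 B y.
have key (t : R) : 0 <= a - 2 * (t * b ^+ 2) + t ^+ 2 * b ^+ 2 * c.
  by rewrite /a /b /c -!sip_norm_sqr -sip_norm_sqrB exprn_ge0// sip_norm_ge0.
apply: rnorm_le_eps => e e0.
(* The optimal t would be 1/c, but c may vanish for a degenerate form. Taking 1/(c + d) costs at
   most a d <= e. *)
pose d := e / (a + 1); have a1 : 0 < a + 1 by rewrite ltr_wpDl.
have d0 : 0 < d by rewrite divr_gt0.
have cd : 0 < c + d by rewrite ltr_wpDl.
have de : a * d <= e by rewrite /d mulrA ler_pdivrMr// mulrDr mulr1 mulrC lerDl ltW.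
have := key (c + d)^-1.
rewrite -(ler_pM2r cd) mul0r.
have -> : (a - 2 * ((c + d)^-1 * b ^+ 2) + (c + d)^-1 ^+ 2 * b ^+ 2 * c) * (c + d) =
   a * c + a * d - b ^+ 2 - b ^+ 2 * d / (c + d) by field; rewrite gt_eqF.
have : 0 <= b ^+ 2 * d / (c + d).
  by rewrite divr_ge0 ?(ltW cd)// mulr_ge0 ?exprn_ge0// (ltW d0).
lra.
Qed.

Lemma sip_normD x y : sip_norm (x + y) <= sip_norm x + sip_norm y.
Proof.
rewrite -(@ler_pXn2r _ 2)// ?nnegrE ?addr_ge0 ?sip_norm_ge0//.
rewrite sip_norm_sqr sqrrD !sip_norm_sqr sipDl !sipDr !raddfD/=.
have h1 : complex.Re (B x y) <= sip_norm x * sip_norm y.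
  rewrite (le_trans _ (cauchy_schwarz x y))// -lecR -rnormE.
  by rewrite (le_trans _ (normc_ge_Re _))// lecR ler_norm.
have h2 : complex.Re (B y x) = complex.Re (B x y) by rewrite sip_conj; case: (B x y).
rewrite h2; lra.
Qed.

Lemma sip_norm0 : sip_norm 0 = 0.
Proof. by rewrite -(scale0r (0 : V)) sip_normZ rnorm0 mul0r. Qed.

Lemma parallelogram x y :
  sip_norm (x + y) ^+ 2 + sip_norm (x - y) ^+ 2 =
  2 * (sip_norm x ^+ 2 + sip_norm y ^+ 2).
Proof.
rewrite !sip_norm_sqr sipDl sipBl !sipDr !sipNr.
by case: (B x x) (B x y) (B y x) (B y y) => [? ?] [? ?] [? ?] [? ?] /=; ring.
Qed.

Definition sip_cauchy (u : nat -> V) := forall e : R, 0 < e ->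
  exists N, forall n m, (N <= n)%N -> (N <= m)%N -> sip_norm (u n - u m) < e.

Lemma sip_cauchy_bounded u : sip_cauchy u ->
  exists2 C, 0 <= C & forall n, sip_norm (u n) <= C.
Proof.
move=> uc; have [N hN] := uc 1 ltr01.
pose C := \sum_(i < N) sip_norm (u i) + sip_norm (u N) + 1.
have S0 : 0 <= \sum_(i < N) sip_norm (u i) by rewrite sumr_ge0// => i _; exact: sip_norm_ge0.
have uN0 := sip_norm_ge0 (u N).
exists C => [|n]; first by rewrite /C; lra.
have [nN|Nn] := ltnP n N.
  have : sip_norm (u n) <= \sum_(i < N) sip_norm (u i).
    rewrite (bigD1 (Ordinal nN))//= lerDl sumr_ge0// => i _; exact: sip_norm_ge0.
  rewrite /C; lra.
have := sip_normD (u n - u N) (u N); rewrite subrK.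
have := hN _ _ Nn (leqnn N); rewrite /C; lra.
Qed.

End SemiInner.

Section ComplexSequences.
Context {R : realType}.
Implicit Types (u v : nat -> R[i]).

Lemma rnormM (z w : R[i]) : rnorm (z * w) = rnorm z * rnorm w.
Proof. by apply: complexI; rewrite rmorphM/= -!rnormE normrM. Qed.

Lemma cauchy_cvg_complex u :
  (forall e : R, 0 < e -> exists N, forall n m, (N <= n)%N -> (N <= m)%N ->
    rnorm (u n - u m) < e) -> exists l : R[i], u n @[n --> \oo] --> l.
Proof.
move=> uc.
have real (f : R[i] -> R) : (forall z w, f (z - w) = f z - f w) ->
    (forall z, `|f z| <= rnorm z) -> exists l : R, f (u n) @[n --> \oo] --> l.
  move=> fB fn; exists (lim (f (u n) @[n --> \oo])); apply: cauchy_cvg.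
  apply: cauchy_exP => e e0; have [N hN] := uc e e0.
  exists (f (u N)); exists N => // n /= Nn.
  rewrite -ball_normE /ball_/= -fB (le_lt_trans (fn _))// hN//.
have [a ua] : exists l : R, complex.Re (u n) @[n --> \oo] --> l.
  apply: real => [[? ?] [? ?]//|z].
  by rewrite -lecR -rnormE normc_ge_Re.
have [b ub] : exists l : R, complex.Im (u n) @[n --> \oo] --> l.
  apply: real => [[? ?] [? ?]//|z].
  rewrite /rnorm normc_def/= -sqrtr_sqr ler_wsqrtr// lerDr sqr_ge0//.
exists (a +i* b); apply/cvg_rnormP => e e0.
have e20 : 0 < e / 2 by rewrite divr_gt0.
have /cvgrPdist_lt/(_ _ e20) := ua; have /cvgrPdist_lt/(_ _ e20) := ub.
apply: filterS2 => n hb ha.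
rewrite (_ : u n - _ =
    (complex.Re (u n) - a)%:C + 'i%C * (complex.Im (u n) - b)%:C).
  have ni : rnorm ('i%C : R[i]) = 1.
    by rewrite /rnorm normc_def/= expr0n expr1n add0r sqrtr1.
  rewrite (le_lt_trans (rnormD _ _))// rnormM ni mul1r !rnorm_real.
  by rewrite distrC [X in _ + X < _]distrC; lra.
by case: (u n) => p q; apply/eqP; rewrite eq_complex/=; apply/andP; split; apply/eqP; ring.
Qed.


End ComplexSequences.

Lemma rnorm_conj (R : realType) (z : R[i]) : rnorm (z^*%R) = rnorm z.
Proof. by rewrite /rnorm norm_conjC. Qed.

Lemma cvg_conj (R : realType) (T : Type) (F : set_system T) (FF : Filter F)
    (f : T -> R[i]) (l : R[i]) :
  f x @[x --> F] --> l -> (f x)^*%R @[x --> F] --> (l^*%R : R[i]).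
Proof.
move=> /cvg_rnormP fl; apply/cvg_rnormP => e /fl; apply: filterS => x.
by rewrite -rmorphB/= rnorm_conj.
Qed.

Lemma Re_le_rnorm (R : realType) (z : R[i]) : complex.Re z <= rnorm z.
Proof. by rewrite -lecR -rnormE (le_trans _ (normc_ge_Re _))// lecR ler_norm. Qed.

Lemma Re_lim_ge0 (R : realType) (u : nat -> R[i]) (l : R[i]) :
  u n @[n --> \oo] --> l -> (forall n, 0 <= complex.Re (u n)) -> 0 <= complex.Re l.
Proof.
move=> /cvg_rnormP ul u0; apply: rnorm_le_eps => e e0.
have [n] := filter_ex (ul _ e0).
have := Re_le_rnorm (u n - l); have := u0 n; rewrite raddfB/=; lra.
Qed.

Section CompletionDef.
Context {R : realType} {V : lmodType R[i]} (B : semi_inner V).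

Definition represents (u : nat -> V) (f : V -> R[i]) :=
  sip_cauchy B u /\ forall b, B (u n) b @[n --> \oo] --> f b.

(* the point [lim u] is encoded as the functional [<lim u, _>] *)
Record completion := Completion {
  completion_fun :> V -> R[i] ;
  completion_rep : exists u, represents u completion_fun
}.

HB.instance Definition _ := gen_eqMixin completion.
HB.instance Definition _ := gen_choiceMixin completion.

Lemma completion_ext (f g : completion) : f =1 g -> f = g.
Proof.
case: f g => [f fP] [g gP] /= /funext fg; subst g.
by congr Completion; exact: Prop_irrelevance.
Qed.

Lemma sip_cauchyD u v : sip_cauchy B u -> sip_cauchy B v ->
  sip_cauchy B (fun n => u n + v n).
Proof.
move=> uc vc e e0; have e20 : 0 < e / 2 by rewrite divr_gt0.
have [N1 h1] := uc _ e20; have [N2 h2] := vc _ e20.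
exists (maxn N1 N2) => n m; rewrite !geq_max => /andP[n1 n2] /andP[m1 m2].
rewrite opprD addrACA (le_lt_trans (sip_normD _ _ _))//.
by have := h1 _ _ n1 m1; have := h2 _ _ n2 m2; lra.
Qed.

Lemma sip_cauchyZ (k : R[i]) u : sip_cauchy B u -> sip_cauchy B (fun n => k *: u n).
Proof.
move=> uc e e0; have k0 : 0 < rnorm k + 1 by rewrite ltr_wpDl ?rnorm_ge0.
have [N h] := uc _ (divr_gt0 e0 k0); exists N => n m Nn Nm.
rewrite -scalerBr sip_normZ.
have := h _ _ Nn Nm; rewrite ltr_pdivlMr//; apply: le_lt_trans.
by rewrite mulrC ler_wpM2l ?sip_norm_ge0// lerDl.
Qed.

Lemma representsD u v f g : represents u f -> represents v g ->
  represents (fun n => u n + v n) (fun b => f b + g b).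
Proof.
move=> [uc uf] [vc vg]; split=> [|b]; first exact: sip_cauchyD.
rewrite (_ : (fun n => _) = fun n => B (u n) b + B (v n) b); last first.
  by apply/funext => n; rewrite sipDl.
exact: cvgD.
Qed.

Lemma representsZ (k : R[i]) u f : represents u f ->
  represents (fun n => k *: u n) (fun b => k * f b).
Proof.
move=> [uc uf]; split=> [|b]; first exact: sip_cauchyZ.
rewrite (_ : (fun n => _) = fun n => k * B (u n) b); last first.
  by apply/funext => n; rewrite sipZl.
by apply: cvgM; first exact: cvg_cst.
Qed.

Lemma represents_cst x : represents (fun=> x) (B x).
Proof.
split=> [e e0|b]; last exact: cvg_cst.
by exists 0%N => n m _ _; rewrite subrr sip_norm0.
Qed.

Fact completion_zero_rep : exists u, represents u (fun=> 0).
Proof.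
exists (fun=> 0); split; first by have [] := represents_cst 0.
move=> b; rewrite (_ : (fun n => _) = fun=> 0); first exact: cvg_cst.
by apply/funext => n; rewrite -(scale0r (0 : V)) sipZl mul0r.
Qed.
Definition completion_zero := Completion completion_zero_rep.

Fact completion_add_rep (f g : completion) : exists u, represents u (fun b => f b + g b).
Proof.
have [u uf] := completion_rep f; have [v vg] := completion_rep g.
by exists (fun n => u n + v n); exact: representsD.
Qed.
Definition completion_add f g := Completion (completion_add_rep f g).

Fact completion_scale_rep (k : R[i]) (f : completion) :
  exists u, represents u (fun b => k * f b).
Proof.
have [u uf] := completion_rep f.
by exists (fun n => k *: u n); exact: representsZ.
Qed.
Definition completion_scale k f := Completion (completion_scale_rep k f).

Let ext := completion_ext.
Fact completion_addA : associative completion_add.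
Proof. by move=> f g h; apply: ext => b /=; rewrite addrA. Qed.
Fact completion_addC : commutative completion_add.
Proof. by move=> f g; apply: ext => b /=; rewrite addrC. Qed.
Fact completion_add0 : left_id completion_zero completion_add.
Proof. by move=> f; apply: ext => b /=; rewrite add0r. Qed.
Fact completion_addN :
  left_inverse completion_zero (completion_scale (-1)) completion_add.
Proof. by move=> f; apply: ext => b /=; rewrite mulN1r addNr. Qed.
HB.instance Definition _ := GRing.isZmodule.Build completion
  completion_addA completion_addC completion_add0 completion_addN.

Fact completion_scaleA (k l : R[i]) f :
  completion_scale k (completion_scale l f) = completion_scale (k * l) f.
Proof. by apply: ext => b /=; rewrite mulrA. Qed.
Fact completion_scale1 : left_id 1 completion_scale.
Proof. by move=> f; apply: ext => b /=; rewrite mul1r. Qed.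
Fact completion_scaleDr : right_distributive completion_scale +%R.
Proof. by move=> k f g; apply: ext => b /=; rewrite mulrDr. Qed.
Fact completion_scaleDl f : {morph completion_scale^~ f : k l / k + l >-> k + l}.
Proof. by move=> k l; apply: ext => b /=; rewrite mulrDl. Qed.
HB.instance Definition _ := GRing.Zmodule_isLmodule.Build R[i] completion
  completion_scaleA completion_scale1 completion_scaleDr completion_scaleDl.

Lemma sip_cauchy_cvg u v : sip_cauchy B u -> sip_cauchy B v ->
  exists l : R[i], B (u n) (v n) @[n --> \oo] --> l.
Proof.
move=> uc vc; apply: cauchy_cvg_complex => e e0.
have [C C0 uC] := sip_cauchy_bounded uc; have [D D0 vD] := sip_cauchy_bounded vc.
have S0 : 0 < C + D + 1 by lra.
pose d := e / (C + D + 1); have d0 : 0 < d by rewrite divr_gt0.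
have [N1 h1] := uc _ d0; have [N2 h2] := vc _ d0.
exists (maxn N1 N2) => n m; rewrite !geq_max => /andP[n1 n2] /andP[m1 m2].
rewrite (_ : _ - _ = B (u n - u m) (v n) + B (u m) (v n - v m)); last first.
  by rewrite sipBl sipBr addrA subrK.
rewrite (le_lt_trans (rnormD _ _))//.
have k1 : rnorm (B (u n - u m) (v n)) <= d * D.
  rewrite (le_trans (cauchy_schwarz _ _ _))// ler_pM ?sip_norm_ge0//.
  by rewrite ltW// h1.
have k2 : rnorm (B (u m) (v n - v m)) <= C * d.
  rewrite (le_trans (cauchy_schwarz _ _ _))// ler_pM ?sip_norm_ge0//.
  by rewrite ltW// h2.
have : d * (C + D + 1) = e by rewrite /d divfK// gt_eqF.
lra.
Qed.

(** For a Cauchy sequence weak nullity implies norm nullity: split B(w_n, w_n) as B(w_n, w_n - w_N)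
    + B(w_n, w_N). The first term is small by the Cauchy property, the second by weak convergence
    against the fixed vector w_N. *)
Lemma sip_cauchy_null w : sip_cauchy B w ->
  (forall b, B (w n) b @[n --> \oo] --> (0 : R[i])) ->
  forall e : R, 0 < e -> \forall n \near \oo, sip_norm B (w n) < e.
Proof.
move=> wc w0 e e0; have [C C0 wC] := sip_cauchy_bounded wc.
have C1 : 0 < C + 1 by lra.
have e2 : 0 < e ^+ 2 / 2 by rewrite divr_gt0// exprn_gt0.
have [N hN] := wc _ (divr_gt0 e2 C1).
have /cvg_rnormP/(_ _ e2) := w0 (w N).
move=> [N' _ hN']; exists (maxn N N') => // n /=; rewrite geq_max => /andP[n1 n2].
rewrite -(@ltr_pXn2r _ 2)// ?nnegrE ?sip_norm_ge0 ?(ltW e0)// sip_norm_sqr.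
have := hN' n n2; rewrite /= subr0 => k1.
have k2 : rnorm (B (w n) (w n - w N)) <= e ^+ 2 / 2.
  rewrite (le_trans (cauchy_schwarz _ _ _))//.
  rewrite (@le_trans _ _ ((C + 1) * (e ^+ 2 / 2 / (C + 1))))//.
    rewrite ler_pM ?sip_norm_ge0//; last by rewrite ltW// hN.
    by rewrite (le_trans (wC n))// lerDl.
  by rewrite mulrC divfK// gt_eqF.
have -> : B (w n) (w n) = B (w n) (w n - w N) + B (w n) (w N).
  by rewrite -sipDr subrK.
rewrite raddfD/=.
have := Re_le_rnorm (B (w n) (w n - w N)); have := Re_le_rnorm (B (w n) (w N)).
lra.
Qed.

Definition completion_seq (f : completion) : nat -> V := sval (cid (completion_rep f)).

Lemma completion_seqP f : represents (completion_seq f) f.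
Proof. by rewrite /completion_seq; case: cid. Qed.

Definition completion_inner (f g : completion) : R[i] :=
  lim (B (completion_seq f n) (completion_seq g n) @[n --> \oo]).

(** Independence of representing sequences: u - u' and v - v' represent zero, so they are null in
    norm by [sip_cauchy_null], while u and v' are bounded. *)
Lemma represents_sip_lim u u' v v' f g (l : R[i]) :
  represents u' f -> represents u f -> represents v' g -> represents v g ->
  B (u' n) (v' n) @[n --> \oo] --> l -> B (u n) (v n) @[n --> \oo] --> l.
Proof.
move=> u'f uf v'g vg hl.
have null w w' h : represents w h -> represents w' h ->
    forall e : R, 0 < e -> \forall n \near \oo, sip_norm B (w' n - w n) < e.
  move=> wh w'h; have [wc wl] := representsD w'h (representsZ (-1) wh).
  have w0 b : B (w' n + -1 *: w n) b @[n --> \oo] --> (0 : R[i]).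
    by have := wl b; rewrite mulN1r subrr; exact.
  move=> e e0; have := sip_cauchy_null wc w0 e0.
  by apply: filterS => n; rewrite scaleN1r.
have [C C0 uC] := sip_cauchy_bounded (proj1 uf).
have [D D0 vD] := sip_cauchy_bounded (proj1 v'g).
have S0 : 0 < C + D + 1 by lra.
apply/cvg_rnormP => e e0; have e20 : 0 < e / 2 by rewrite divr_gt0.
pose d := e / 2 / (C + D + 1); have d0 : 0 < d by rewrite divr_gt0.
have := null _ _ _ u'f uf _ d0; have := null _ _ _ v'g vg _ d0.
have /cvg_rnormP/(_ _ e20) := hl.
apply: filterS3 => n k0 k1 k2.
rewrite (_ : _ - l = (B (u' n) (v' n) - l) +
    (B (u n - u' n) (v' n) + B (u n) (v n - v' n))); last first.
  by rewrite sipBl sipBr; ring.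
rewrite (le_lt_trans (rnormD _ _))//.
have k3 := rnormD (B (u n - u' n) (v' n)) (B (u n) (v n - v' n)).
have k4 : rnorm (B (u n - u' n) (v' n)) <= d * D.
  apply: (le_trans (cauchy_schwarz _ _ _)).
  exact: ler_pM (sip_norm_ge0 _ _) (sip_norm_ge0 _ _) (ltW k2) (vD n).
have k5 : rnorm (B (u n) (v n - v' n)) <= C * d.
  apply: (le_trans (cauchy_schwarz _ _ _)).
  exact: ler_pM (sip_norm_ge0 _ _) (sip_norm_ge0 _ _) (uC n) (ltW k1).
have : d * (C + D + 1) = e / 2 by rewrite /d divfK// gt_eqF.
lra.
Qed.

Lemma completion_innerE u v (f g : completion) : represents u f -> represents v g ->
  B (u n) (v n) @[n --> \oo] --> completion_inner f g.
Proof.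
move=> uf vg; have u'f := completion_seqP f; have v'g := completion_seqP g.
have [l hl] := sip_cauchy_cvg (proj1 u'f) (proj1 v'g).
have -> : completion_inner f g = l by exact: cvg_lim hl.
exact: represents_sip_lim u'f uf v'g vg hl.
Qed.

Lemma lim_eq (u : nat -> R[i]) (l l' : R[i]) :
  u n @[n --> \oo] --> l -> u n @[n --> \oo] --> l' -> l = l'.
Proof. by move=> h1 h2; exact: cvg_unique h1 h2. Qed.

Lemma completion_funD (f : completion) x y : f (x + y) = f x + f y.
Proof.
have [u [_ uf]] := completion_rep f; apply: lim_eq (uf (x + y)) _.
rewrite (_ : (fun n => _) = fun n => B (u n) x + B (u n) y); last first.
  by apply/funext => n; rewrite sipDr.
by apply: cvgD; exact: uf.
Qed.

(** A point acts through the second argument of the form, hence conjugate-linearly. *)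
Lemma completion_funZ (f : completion) (k : R[i]) x : f (k *: x) = k^*%R * f x.
Proof.
have [u [_ uf]] := completion_rep f; apply: lim_eq (uf (k *: x)) _.
rewrite (_ : (fun n => _) = fun n => k^*%R * B (u n) x); last first.
  by apply/funext => n; rewrite sipZr.
by apply: cvgM; [exact: cvg_cst|exact: uf].
Qed.

Fact completion_innerDl f g h :
  completion_inner (f + g) h = completion_inner f h + completion_inner g h.
Proof.
have fP := completion_seqP f; have gP := completion_seqP g; have hP := completion_seqP h.
apply: lim_eq.
  by apply: completion_innerE; [exact: representsD fP gP|exact: hP].
rewrite (_ : (fun n => _) = fun n => B (completion_seq f n) (completion_seq h n) +
   B (completion_seq g n) (completion_seq h n)); last first.
  by apply/funext => n; rewrite sipDl.
by apply: cvgD; exact: completion_innerE.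
Qed.

Fact completion_innerZl k f h :
  completion_inner (k *: f) h = k * completion_inner f h.
Proof.
have fP := completion_seqP f; have hP := completion_seqP h.
apply: lim_eq.
  by apply: completion_innerE; [exact: (representsZ k fP)|exact: hP].
rewrite (_ : (fun n => _) = fun n => k * B (completion_seq f n) (completion_seq h n));
    last by apply/funext => n; rewrite sipZl.
by apply: cvgM; [exact: cvg_cst|exact: completion_innerE].
Qed.

Fact completion_inner_conj f g : completion_inner g f = (completion_inner f g)^*%R.
Proof.
have fP := completion_seqP f; have gP := completion_seqP g.
apply: lim_eq; first exact: completion_innerE gP fP.
rewrite (_ : (fun n => _) =
    fun n => (B (completion_seq f n) (completion_seq g n))^*%R); last first.
  by apply/funext => n; rewrite -sip_conj.
by apply: cvg_conj; exact: completion_innerE.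
Qed.

Fact completion_inner_ge0 f : 0 <= complex.Re (completion_inner f f).
Proof.
have fP := completion_seqP f; apply: (Re_lim_ge0 (completion_innerE fP fP)) => n.
exact: sip_ge0.
Qed.

Definition completion_sip : semi_inner completion :=
  SemiInner completion_innerDl completion_innerZl completion_inner_conj completion_inner_ge0.

Definition completion_in (x : V) : completion :=
  Completion (ex_intro (represents^~ (B x)) _ (represents_cst x)).

Lemma completion_inner_in f x : completion_inner f (completion_in x) = f x.
Proof.
have fP := completion_seqP f; apply: lim_eq.
  by apply: completion_innerE; [exact: fP|exact: represents_cst].
exact: (proj2 fP).
Qed.

Lemma completion_in_norm x : sip_norm completion_sip (completion_in x) = sip_norm B x.
Proof. by rewrite /sip_norm/= completion_inner_in. Qed.

Lemma completion_inB x y : completion_in (x - y) = completion_in x - completion_in y.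
Proof. by apply: completion_ext => b /=; rewrite sipBl mulN1r. Qed.

Lemma completion_norm_eq0 f : sip_norm completion_sip f = 0 -> f = 0.
Proof.
move=> f0; apply: completion_ext => b; rewrite -completion_inner_in /=.
apply: rnorm_eq0; apply/eqP; rewrite eq_le rnorm_ge0 andbT.
by rewrite (le_trans (cauchy_schwarz completion_sip _ _))// f0 mul0r.
Qed.

Lemma represents_limit u (f : completion) : represents u f -> forall e : R, 0 < e ->
  exists N, forall n, (N <= n)%N -> sip_norm completion_sip (f - completion_in (u n)) <= e.
Proof.
move=> uf e e0; have [N hN] := proj1 uf e e0; exists N => n Nn.
rewrite -(@ler_pXn2r _ 2)// ?nnegrE ?sip_norm_ge0 ?(ltW e0)// sip_norm_sqr/=.
have fn := representsD uf (representsZ (-1) (represents_cst (u n))).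
have := completion_innerE (f := f - completion_in (u n)) (g := f - completion_in (u n)) fn fn.
move=> /cvg_rnormP h; apply: rnorm_le_eps => d d0.
have [N' _ hN'] := h d d0.
have := hN' (maxn N N') (leq_maxr _ _); rewrite /= scaleN1r => k1.
have k2 := Re_le_rnorm (completion_inner (f - completion_in (u n)) (f - completion_in (u n)) -
  B (u (maxn N N') - u n) (u (maxn N N') - u n)).
have k3 : complex.Re (B (u (maxn N N') - u n) (u (maxn N N') - u n)) <= e ^+ 2.
  rewrite -sip_norm_sqr lerXn2r ?nnegrE ?sip_norm_ge0 ?(ltW e0)//.
  by rewrite ltW// hN// leq_maxl.
rewrite rnormC raddfB/= in k1 k2; lra.
Qed.

Fact completion_normD (f g : completion) :
  (sip_norm completion_sip (f + g))%:C <=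
  (sip_norm completion_sip f)%:C + (sip_norm completion_sip g)%:C.
Proof. by rewrite -rmorphD/= lecR sip_normD. Qed.

Fact completion_normZ (k : R[i]) (f : completion) :
  (sip_norm completion_sip (k *: f))%:C = `|k| * (sip_norm completion_sip f)%:C.
Proof. by rewrite rnormE -rmorphM/= sip_normZ. Qed.

Fact completion_norm0 (f : completion) : (sip_norm completion_sip f)%:C = 0 -> f = 0.
Proof. by case=> /completion_norm_eq0. Qed.

HB.instance Definition _ := @Lmodule_isNormed.Build R[i] completion
  (fun f => (sip_norm completion_sip f)%:C) completion_normD completion_normZ completion_norm0.

Lemma rnorm_completionE (f : completion) : rnorm f = sip_norm completion_sip f.
Proof. by []. Qed.

Fact completion_complete (F : set_system completion) :
  ProperFilter F -> cauchy F -> cvg F.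
Proof.
move=> FF /rnorm_cauchyP Fc.
(* One 1/(n+1) pays for the Cauchy filter, the other for replacing its centre by a vector of V. The
   resulting sequence in V is Cauchy and represents the limit. *)
have aux n : exists a : V, \forall y \near F, rnorm (y - completion_in a) <= 2 * n.+1%:R^-1.
  have n0 : 0 < n.+1%:R^-1 :> R by rewrite invr_gt0.
  have [f Ff] := Fc _ n0; have [u fP] := completion_rep f.
  have [N hN] := represents_limit fP n0.
  exists (u N); move: Ff; apply: filterS => y yf.
  have -> : y - completion_in (u N) = (y - f) + (f - completion_in (u N)).
    by rewrite addrA subrK.
  apply: (le_trans (rnormD _ _)); rewrite mulr_natl mulr2n; apply: lerD.
    exact: ltW.
  exact: hN.
have [a aP] := choice aux.
have aa n m : sip_norm B (a n - a m) <= 2 * n.+1%:R^-1 + 2 * m.+1%:R^-1.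
  have [y [y1 y2]] := filter_ex (filterI (aP n) (aP m)).
  rewrite -completion_in_norm completion_inB -rnorm_completionE.
  have -> : completion_in (a n) - completion_in (a m) =
      (completion_in (a n) - y) + (y - completion_in (a m)).
    by rewrite addrA subrK.
  apply: (le_trans (rnormD _ _)); apply: lerD; last exact: y2.
  by rewrite rnormC; exact: y1.
have inv_small (e : R) : 0 < e -> exists N, forall n, (N <= n)%N -> n.+1%:R^-1 < e.
  move=> e0; exists (Num.truncn e^-1) => n Nn.
  rewrite -[ltRHS]invrK ltf_pV2 ?posrE ?invr_gt0// (lt_le_trans (truncnS_gt _))//.
  by rewrite ler_nat.
have ac : sip_cauchy B a.
  move=> e e0; have e40 : 0 < e / 4 by rewrite divr_gt0.
  have [N hN] := inv_small _ e40; exists N => n m Nn Nm.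
  rewrite (le_lt_trans (aa n m))//.
  have := hN _ Nn; have := hN _ Nm.
  move: (n.+1%:R^-1 : R) (m.+1%:R^-1 : R) => p q; lra.
have gl b : exists l : R[i], B (a n) b @[n --> \oo] --> l.
  exact: sip_cauchy_cvg ac (proj1 (represents_cst b)).
have [g gP] := choice gl.
have ag : represents a g by [].
pose G := Completion (ex_intro (represents^~ g) _ ag).
have aG : represents a G by [].
apply/cvg_ex; exists G; apply/(cvg_rnormP (V := completion) _ id) => e e0.
have e40 : 0 < e / 4 by rewrite divr_gt0.
have [N1 h1] := inv_small _ e40; have [N2 h2] := represents_limit aG e40.
have n1 := leq_maxl N1 N2; have n2 := leq_maxr N1 N2; set n := maxn N1 N2 in n1 n2.
have := aP n; apply: filterS => y yn.
have -> : y - G = (y - completion_in (a n)) + (completion_in (a n) - G).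
  by rewrite addrA subrK.
apply: (le_lt_trans (rnormD _ _)).
have k2 := h2 n n2; rewrite -rnorm_completionE rnormC in k2.
apply: (le_lt_trans (lerD yn k2)).
move: (h1 n n1) {yn k2}; move: (n.+1%:R^-1 : R) => p; lra.
Qed.

HB.instance Definition _ := @Uniform_isComplete.Build completion completion_complete.

Fact completion_inner_norm (f : completion) : completion_inner f f = `|f| ^+ 2.
Proof. by rewrite rnormE rnorm_completionE -rmorphXn/= sip_norm_sqr [LHS](sip_real completion_sip). Qed.

HB.instance Definition _ := @isHilbert.Build R completion completion_inner
  completion_innerDl completion_innerZl completion_inner_conj completion_inner_norm.

End CompletionDef.

Section HilbertProjection.
Context {R : realType} {H : hilbertType R}.
Implicit Types (x y z : H).

Fact inner_ge0 x : 0 <= complex.Re (inner x x).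
Proof. by rewrite inner_norm rnormE -rmorphXn/= exprn_ge0// rnorm_ge0. Qed.

Definition hilbert_sip : semi_inner H :=
  SemiInner (@innerDl R H) (@innerZl R H) (@inner_conj R H) inner_ge0.

Lemma hilbert_sip_norm x : sip_norm hilbert_sip x = rnorm x.
Proof.
rewrite /sip_norm/= inner_norm rnormE -rmorphXn/= sqrtr_sqr ger0_norm//.
exact: rnorm_ge0.
Qed.

Lemma cvg_harmonic_real (e : R) : 0 < e ->
  exists N, forall n, (N <= n)%N -> n.+1%:R^-1 < e.
Proof.
move=> e0; exists (Num.truncn e^-1) => n Nn.
rewrite -[ltRHS]invrK ltf_pV2 ?posrE ?invr_gt0// (lt_le_trans (truncnS_gt _))//.
by rewrite ler_nat.
Qed.

Lemma hilbert_projection (V : set H) x : closed_subspace V ->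
  exists y, V y /\ forall v, V v -> inner (x - y) v = 0.
Proof.
move=> [Vc V0 Vl].
have VD u v : V u -> V v -> V (u + v) by move=> Vu Vv; rewrite -[u]scale1r; exact: Vl.
have VZ (k : R[i]) u : V u -> V (k *: u) by move=> Vu; rewrite -[k *: u]addr0; exact: Vl.
pose D := [set rnorm (x - v) | v in V].
have Dinf : has_inf D.
  split; first by exists (rnorm (x - 0)), 0.
  by exists 0 => _ [v Vv <-]; exact: rnorm_ge0.
pose d := inf D.
have dle v : V v -> d <= rnorm (x - v).
  by move=> Vv; apply: (ge_inf (proj2 Dinf)); exists v.
have d0 : 0 <= d by apply: lb_le_inf; [exact: (proj1 Dinf)|move=> _ [v _ <-]; exact: rnorm_ge0].
have ex n : exists v, V v /\ rnorm (x - v) < d + n.+1%:R^-1.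
  have n0 : 0 < n.+1%:R^-1 :> R by rewrite invr_gt0.
  by have [_ [v Vv <-] vd] := inf_adherent n0 Dinf; exists v.
pose v n := sval (cid (ex n)).
have vP n : V (v n) /\ rnorm (x - v n) < d + n.+1%:R^-1 by rewrite /v; case: cid.
have dist (e : R) n m : 0 < e -> rnorm (x - v n) < d + e -> rnorm (x - v m) < d + e ->
    rnorm (v n - v m) ^+ 2 <= 4 * (2 * d * e + e ^+ 2).
  move=> e0 hn hm.
  have := parallelogram hilbert_sip (x - v n) (x - v m).
  rewrite !hilbert_sip_norm.
  have -> : x - v n - (x - v m) = v m - v n by zmod.
  have -> : x - v n + (x - v m) = 2%:R%:C *: (x - (2^-1)%:C *: (v n + v m)).
    rewrite scalerBr scalerA -rmorphM/= divff// scale1r.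
    by rewrite (_ : 2%:R%:C = 1 + 1) ?scalerDl ?scale1r; [zmod|rewrite rmorphD rmorph1].
  rewrite rnormZr (rnormC (v m)).
  have := dle _ (VZ (2^-1)%:C _ (VD _ _ (proj1 (vP n)) (proj1 (vP m)))).
  set q := rnorm (x - _ *: _); set a := rnorm _ ; set b := rnorm _ => dq.
  rewrite ger0_norm// => par.
  have q2 : d ^+ 2 <= q ^+ 2 by rewrite lerXn2r ?nnegrE// (le_trans d0).
  have a2 : rnorm (x - v n) ^+ 2 <= (d + e) ^+ 2.
    by rewrite lerXn2r ?nnegrE ?rnorm_ge0 ?addr_ge0 ?(ltW e0) ?(ltW hn).
  have b2 : rnorm (x - v m) ^+ 2 <= (d + e) ^+ 2.
    by rewrite lerXn2r ?nnegrE ?rnorm_ge0 ?addr_ge0 ?(ltW e0) ?(ltW hm).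
  rewrite exprMn in par; rewrite sqrrD in a2 b2; lra.
have [|y vy] := @rnorm_cauchy_cvg _ _ v.
  (* With h <= 1 and h c <= e^2, the parallelogram bound 4 (2 d h + h^2) is at most 4 (2 d + 1) h <
     c h <= e^2. *)
  move=> e e0; pose c := 4 * (2 * d + 1) + 1.
  have c0 : 0 < c by rewrite /c; lra.
  pose h := Num.min 1 (e ^+ 2 / c).
  have h0 : 0 < h by rewrite /h lt_min ltr01 divr_gt0// exprn_gt0.
  have h1 : h <= 1 by rewrite /h ge_min lexx.
  have hc : h * c <= e ^+ 2 by rewrite -ler_pdivlMr// /h ge_min lexx orbT.
  have [N hN] := cvg_harmonic_real h0; exists N => n m Nn Nm.
  rewrite -(@ltr_pXn2r _ 2)// ?nnegrE ?rnorm_ge0 ?(ltW e0)//.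
  rewrite (le_lt_trans (dist h _ _ h0 _ _))//.
  - by rewrite (lt_trans (proj2 (vP n)))// ltrD2l hN.
  - by rewrite (lt_trans (proj2 (vP m)))// ltrD2l hN.
  have hh : h ^+ 2 <= h by rewrite expr2 ler_piMr// ltW.
  rewrite /c in hc; lra.
have Vy : V y.
  by apply: (closed_cvg V Vc _ _ vy); apply: nearW => n; exact: (proj1 (vP n)).
have yd : rnorm (x - y) <= d.
  apply: rnorm_le_eps => e e0; have e20 : 0 < e / 2 by rewrite divr_gt0.
  have /cvg_rnormP/(_ _ e20)[N1 _ h1] := vy; have [N2 h2] := cvg_harmonic_real e20.
  pose n := maxn N1 N2.
  have := h1 n (leq_maxl _ _); have := h2 n (leq_maxr _ _); have := proj2 (vP n).
  move: (n.+1%:R^-1 : R) => p /= k1 k2 k3; have := rnormD (x - v n) (v n - y).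
  by rewrite addrA subrK; lra.
exists y; split=> // w Vw.
set b := inner _ _; apply: rnorm_eq0.
(* First variation: moving y inside V by a multiple of w cannot decrease the distance to x. With t =
   1 / (|w|^2 + 1) this forces b = 0. *)
have key (t : R) : 2 * (t * rnorm b ^+ 2) <= t ^+ 2 * rnorm b ^+ 2 * rnorm w ^+ 2.
  have := sip_norm_sqrB hilbert_sip (x - y) w t; rewrite !hilbert_sip_norm/= -/b.
  have : rnorm (x - y) ^+ 2 <= rnorm (x - y - (t%:C * b) *: w) ^+ 2.
    rewrite lerXn2r ?nnegrE ?rnorm_ge0// (le_trans yd)// -addrA -opprD.
    by apply: dle; apply: VD => //; exact: VZ.
  lra.
pose c := rnorm w ^+ 2 + 1.
have c0 : 0 < c by rewrite ltr_wpDl// exprn_ge0// rnorm_ge0.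
have := key c^-1.
have -> : c^-1 ^+ 2 * rnorm b ^+ 2 * rnorm w ^+ 2 =
    c^-1 * rnorm b ^+ 2 - c^-1 ^+ 2 * rnorm b ^+ 2.
  have -> : rnorm w ^+ 2 = c - 1 by rewrite /c addrK.
  by field; rewrite gt_eqF.
have k1 : 0 <= c^-1 ^+ 2 * rnorm b ^+ 2.
  by rewrite mulr_ge0// exprn_ge0// ?rnorm_ge0// invr_ge0 ltW.
move=> k2; have k3 : c^-1 * rnorm b ^+ 2 <= 0 by lra.
have : rnorm b ^+ 2 <= 0 by rewrite -(ler_pM2l (_ : 0 < c^-1)) ?invr_gt0// mulr0.
rewrite le_eqVlt ltNge exprn_ge0 ?rnorm_ge0// orbF sqrf_eq0 => /eqP//.
Qed.

End HilbertProjection.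

(** * Pure states and primitive ideals *)

Section GNS.
Context {R : realType} {A : cstarAlgType R}.
Local Notation M := (multiplier A).
Implicit Types (a b m x y z : M).
Local Notation "t %:S" := (t%:C *: (1 : M)) (at level 2, format "t %:S").
Variable f : M -> R.
Hypotheses (f_lin : real_linear f) (f_pos : forall m, mpos m -> 0 <= f m)
  (f_star : forall m, f (cstar m) = f m).

Lemma complex_split (k : R[i]) : k = (complex.Re k)%:C + (complex.Im k)%:C * 'i%C.
Proof. by case: k => p q; apply/eqP; rewrite eq_complex/= !(mul0r, mulr0, mulr1, subr0, addr0, add0r) !eqxx. Qed.

Let fD x y : f (x + y) = f x + f y := proj1 f_lin x y.
Let fZ (t : R) x : f (t%:C *: x) = t * f x := proj2 f_lin t x.
Let fN x : f (- x) = - f x := real_linearN x f_lin.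

(** The complex-linear functional whose real part is [f]. *)
Definition gns_form m : R[i] := f m +i* (- f ('i%C *: m)).

Lemma gns_formD x y : gns_form (x + y) = gns_form x + gns_form y.
Proof. by rewrite /gns_form scalerDr !fD opprD. Qed.

Lemma gns_formZ (k : R[i]) m : gns_form (k *: m) = k * gns_form m.
Proof.
have ii : 'i%C * 'i%C = -1 :> R[i] by rewrite -expr2 sqr_i.
have E1 : f (k *: m) = complex.Re k * f m + complex.Im k * f ('i%C *: m).
  by rewrite {1}(complex_split k) scalerDl fD -scalerA !fZ.
have E2 : f ('i%C *: (k *: m)) = complex.Re k * f ('i%C *: m) - complex.Im k * f m.
  have -> : 'i%C *: (k *: m) =
      (complex.Re k)%:C *: ('i%C *: m) - (complex.Im k)%:C *: m.
    rewrite -scaleNr !scalerA -scalerDl; congr (_ *: _).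
    rewrite {1}(complex_split k) mulrDr mulrC; congr (_ + _).
    by rewrite mulrC -mulrA ii mulrN1.
  by rewrite fD fN !fZ.
rewrite /gns_form E1 E2; case: k {E1 E2} => p q /=.
by apply/eqP; rewrite eq_complex/=; apply/andP; split; apply/eqP; ring.
Qed.

Lemma gns_form_star m : gns_form (cstar m) = (gns_form m)^*%R.
Proof.
rewrite /gns_form f_star.
have -> : 'i%C *: cstar m = cstar (- ('i%C *: m)).
  rewrite -scaleNr cstarZ; congr (_ *: _).
  by apply/eqP; rewrite eq_complex/= oppr0 opprK !eqxx.
by rewrite f_star fN opprK; apply/eqP; rewrite eq_complex/= opprK !eqxx.
Qed.

Fact gns_sipDl x y z :
  gns_form (cstar z * (x + y)) = gns_form (cstar z * x) + gns_form (cstar z * y).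
Proof. by rewrite mulrDr gns_formD. Qed.
Fact gns_sipZl (k : R[i]) x y : gns_form (cstar y * (k *: x)) = k * gns_form (cstar y * x).
Proof. by rewrite -scalemAr gns_formZ. Qed.
Fact gns_sip_conj x y : gns_form (cstar x * y) = (gns_form (cstar y * x))^*%R.
Proof. by rewrite -gns_form_star mstar_mul cstarK. Qed.
Fact gns_sip_ge0 x : 0 <= complex.Re (gns_form (cstar x * x)).
Proof. by apply: f_pos; exact: mpos_star_mul. Qed.

Definition gns_sip : semi_inner M :=
  @SemiInner R M (fun x y => gns_form (cstar y * x))
    (fun x y z => gns_sipDl x y z) gns_sipZl (fun x y => gns_sip_conj x y) gns_sip_ge0.

Definition gns_space := completion gns_sip.
HB.instance Definition _ := Hilbert.on gns_space.
Implicit Types (F G v : gns_space).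

Lemma gns_sip_mulE m x y : gns_sip (m * x) y = gns_sip x (cstar m * y).
Proof. by rewrite /= mstar_mul cstarK mulrA. Qed.

Lemma gns_norm_sqr x : sip_norm gns_sip x ^+ 2 = f (cstar x * x).
Proof. by rewrite sip_norm_sqr. Qed.

(** The element |m|^2 - m^* m is positive, and conjugation by x preserves positivity. *)
Lemma gns_norm_mul_sqr m x :
  sip_norm gns_sip (m * x) ^+ 2 <= rnorm m ^+ 2 * sip_norm gns_sip x ^+ 2.
Proof.
rewrite !gns_norm_sqr mstar_mul -subr_ge0 -fZ -fN -fD; apply: f_pos.
have -> : (rnorm m ^+ 2)%:C *: (cstar x * x) - cstar x * cstar m * (m * x) =
    cstar x * ((rnorm m ^+ 2)%:S - cstar m * m) * x.
  by rewrite mulrBr mulrBl scal1_comm scal1M -scalemAl !mulrA.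
apply: mpos_conj; apply: mpos_bound; first by rewrite mstar_mul cstarK.
by rewrite rnorm_star_mul.
Qed.

Lemma gns_norm_mul m x : sip_norm gns_sip (m * x) <= rnorm m * sip_norm gns_sip x.
Proof.
rewrite -(@ler_pXn2r _ 2)// ?nnegrE ?mulr_ge0 ?sip_norm_ge0 ?rnorm_ge0//.
by rewrite exprMn gns_norm_mul_sqr.
Qed.

Lemma gns_represents m u (F : M -> R[i]) : represents gns_sip u F ->
  represents gns_sip (fun n => m * u n) (fun b => F (cstar m * b)).
Proof.
move=> [uc uF]; split=> [e e0|b]; last first.
  rewrite (_ : (fun n => _) = fun n => gns_sip (u n) (cstar m * b)); first exact: uF.
  by apply/funext => n; rewrite gns_sip_mulE.
have k0 : 0 < rnorm m + 1 by rewrite ltr_wpDl ?rnorm_ge0.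
have [N h] := uc _ (divr_gt0 e0 k0); exists N => n p Nn Np.
rewrite -mulrBr (le_lt_trans (gns_norm_mul _ _))//.
have := h _ _ Nn Np; rewrite ltr_pdivlMr//; apply: le_lt_trans.
by rewrite mulrC ler_wpM2l ?sip_norm_ge0// lerDl.
Qed.

Fact gns_act_rep m F : exists u, represents gns_sip u (fun b => F (cstar m * b)).
Proof.
by have [u uF] := completion_rep F; exists (fun n => m * u n); exact: gns_represents.
Qed.

(** Points of the completion are functionals, so the action is the transpose b -> F (m^* b). The
    module laws then hold by comparing functionals, without extending by continuity. *)
Definition gns_act m F : gns_space := Completion (gns_act_rep m F).

Definition gns_in x : gns_space := completion_in gns_sip x.

Lemma inner_gns_in F x : inner F (gns_in x) = F x.
Proof. exact: completion_inner_in. Qed.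

Lemma gns_act_in m x : gns_act m (gns_in x) = gns_in (m * x).
Proof. by apply: completion_ext => b /=; rewrite mstar_mul cstarK mulrA. Qed.

Lemma gns_act_linear m : linear (gns_act m).
Proof. by move=> k F G; apply: completion_ext. Qed.

Lemma gns_actM m n F : gns_act (m * n) F = gns_act m (gns_act n F).
Proof. by apply: completion_ext => b /=; rewrite mstar_mul mulrA. Qed.

Lemma gns_act_linear_l (k : R[i]) m n F :
  gns_act (k *: m + n) F = k *: gns_act m F + gns_act n F.
Proof.
apply: completion_ext => b /=.
by rewrite cstarD cstarZ mulrDl -scalemAl completion_funD completion_funZ conjCK.
Qed.

Lemma gns_act_adj m F G : inner (gns_act m F) G = inner F (gns_act (cstar m) G).
Proof.
have [u uF] := completion_rep F; have [v vG] := completion_rep G.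
apply: (@lim_eq _ (fun n => gns_sip (m * u n) (v n))).
  exact: (completion_innerE (f := gns_act m F) (g := G) (gns_represents m uF) vG).
rewrite (_ : (fun n => _) = fun n => gns_sip (u n) (cstar m * v n)).
  exact: (completion_innerE (f := F) (g := gns_act (cstar m) G) uF
    (gns_represents (cstar m) vG)).
by apply/funext => n; rewrite gns_sip_mulE.
Qed.

Lemma Re_scaleB (t : R) (z w : R[i]) :
  complex.Re (t%:C * z - w) = t * complex.Re z - complex.Re w.
Proof. by case: z w => [? ?] [? ?] /=; ring. Qed.

Lemma gns_act_norm m F : rnorm (gns_act m F) <= rnorm m * rnorm F.
Proof.
have key (p q r s t : R) : 0 <= p -> 0 <= q -> 0 <= r -> q ^+ 2 = s -> r ^+ 2 = t ->
    0 <= p ^+ 2 * s - t -> r <= p * q.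
  move=> p0 q0 r0 <- <-.
  by rewrite subr_ge0 -exprMn ler_pXn2r// nnegrE// mulr_ge0.
have E (G : gns_space) : rnorm G ^+ 2 = complex.Re (completion_inner G G).
  exact: (sip_norm_sqr (completion_sip gns_sip) G).
apply: (key _ _ _ _ _ (rnorm_ge0 m) (rnorm_ge0 F) (rnorm_ge0 (gns_act m F)) (E F)
  (E (gns_act m F))).
have [u uF] := completion_rep F; have mF := gns_represents m uF.
have h1 := completion_innerE (f := F) (g := F) uF uF.
have h2 := completion_innerE (f := gns_act m F) (g := gns_act m F) mF mF.
have h3 : (rnorm m ^+ 2)%:C * gns_sip (u n) (u n) - gns_sip (m * u n) (m * u n) @[n --> \oo]
    --> ((rnorm m ^+ 2)%:C * completion_inner F F -
         completion_inner (gns_act m F) (gns_act m F) : R[i]).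
  exact: (cvgB (cvgM (cvg_cst _) h1) h2).
have h4 n : 0 <= complex.Re
    ((rnorm m ^+ 2)%:C * gns_sip (u n) (u n) - gns_sip (m * u n) (m * u n)).
  rewrite Re_scaleB subr_ge0.
  by have := gns_norm_mul_sqr m (u n); rewrite !sip_norm_sqr.
by have := Re_lim_ge0 h3 h4; rewrite Re_scaleB.
Qed.

Lemma gns_act_continuous m : continuous (gns_act m).
Proof.
apply: (@linear_lip_continuous _ gns_space gns_space _ (rnorm m)%:C) => [x y|x].
  have := gns_act_linear m (-1) y x; rewrite !scaleN1r ![- _ + _]addrC; exact.
by rewrite !rnormE -rmorphM lecR gns_act_norm.
Qed.

Lemma gns_act1 F : gns_act 1 F = F.
Proof. by apply: completion_ext => b; rewrite /= mstar1 mul1r. Qed.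

Lemma inner_act_cyclic m : inner (gns_act m (gns_in 1)) (gns_in 1) = gns_form m.
Proof. by rewrite gns_act_in inner_gns_in /= mstar1 mul1r mulr1. Qed.

Lemma gns_sep F : (forall b, inner F (gns_in b) = 0) -> F = 0.
Proof. by move=> h; apply: completion_ext => b; rewrite -inner_gns_in h. Qed.

Lemma gns_fun_null F z : f (cstar z * z) = 0 -> F z = 0.
Proof.
move=> fz; rewrite -inner_gns_in; apply: rnorm_eq0; apply/eqP.
rewrite eq_le rnorm_ge0 andbT.
apply: (le_trans (cauchy_schwarz (completion_sip gns_sip) F (gns_in z))).
suff -> : sip_norm (completion_sip gns_sip) (gns_in z) = 0 by rewrite mulr0.
rewrite completion_in_norm; apply/eqP.
by rewrite -sqrf_eq0 gns_norm_sqr fz.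
Qed.

End GNS.

Section MultOf.
Context {R : realType} {A : cstarAlgType R}.
Implicit Types (a b : A) (m : multiplier A).

Lemma mult_of_linear (k : R[i]) a b :
  mult_of (k *: a + b) = k *: mult_of a + mult_of b.
Proof. by apply: multiplier_extL => c /=; rewrite cmulDl cmulZl. Qed.

Lemma mult_ofM a b : mult_of (a ** b) = mult_of a * mult_of b.
Proof. by apply: multiplier_extL => c /=; rewrite cmulA. Qed.

Lemma mult_of_star a : mult_of (cstar a) = cstar (mult_of a).
Proof. by apply: multiplier_extL => c /=; rewrite cstarM cstarK. Qed.

Lemma mul_mult_of m a : m * mult_of a = mult_of (m a).
Proof. by apply: multiplier_extL => c /=; rewrite mulL_cmul. Qed.

Lemma mult_of_mul m a : mult_of a * m = mult_of (mulR m a).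
Proof. by apply: multiplier_extL => c /=; rewrite mulLR. Qed.

Lemma rnorm_mult_of a : rnorm (mult_of a) = rnorm a.
Proof.
apply/eqP; rewrite eq_le; apply/andP; split.
  apply: multiplier_norm_le => [|b]; first exact: rnorm_ge0.
  exact: rnorm_cmul.
have [->|a0] := eqVneq (rnorm a) 0; first exact: rnorm_ge0.
have ap : 0 < rnorm a by rewrite lt_def a0 rnorm_ge0.
rewrite -(ler_pM2r ap) -expr2 -{1}rnorm_cstar -rnorm_cstarM cstarK.
by have := rnorm_mulL (mult_of a) (cstar a); rewrite rnorm_cstar.
Qed.

End MultOf.

(** * Irreducibility of the GNS representation of an extreme functional *)

Section PureState.
Context {R : realType} {A : cstarAlgType R}.
Local Notation M := (multiplier A).
Local Notation "t %:S" := (t%:C *: (1 : M)) (at level 2, format "t %:S").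
Context {H : hilbertType R} (pi : M -> H -> H).
Implicit Types (m n : M) (x y v w : H).
Hypotheses
  (pi_lin_l : forall (k : R[i]) m n x, pi (k *: m + n) x = k *: pi m x + pi n x)
  (pi_lin : forall m, linear (pi m))
  (piM : forall m n x, pi (m * n) x = pi m (pi n x))
  (pi1 : forall x, pi 1 x = x)
  (pi_adj : forall m x y, inner (pi m x) y = inner x (pi (cstar m) y)).

Let innerDr x y z : inner x (y + z) = inner x y + inner x z := sipDr hilbert_sip x y z.
Let innerZr (k : R[i]) x y : inner x (k *: y) = k^*%R * inner x y := sipZr hilbert_sip k x y.
Let innerBr x y z : inner x (y - z) = inner x y - inner x z := sipBr hilbert_sip x y z.
Let innerE x : inner x x = (rnorm x ^+ 2)%:C.
Proof. by rewrite inner_norm rnormE rmorphXn. Qed.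

Let inner_sym0 x y : inner x y = 0 -> inner y x = 0.
Proof. by move=> xy; rewrite inner_conj xy rmorph0. Qed.

Let piD m x y : pi m (x + y) = pi m x + pi m y.
Proof. by rewrite -[x]scale1r pi_lin !scale1r. Qed.

Let piDl m n x : pi (m + n) x = pi m x + pi n x.
Proof. by rewrite -[m]scale1r pi_lin_l !scale1r. Qed.

Let pi0 x : pi 0 x = 0.
Proof. by have := pi_lin_l (-1) 0 0 x; rewrite !scaleN1r oppr0 addr0 addNr. Qed.

Let piZl (k : R[i]) m x : pi (k *: m) x = k *: pi m x.
Proof. by have := pi_lin_l k m 0 x; rewrite pi0 !addr0. Qed.

Definition vector_state x m : R := complex.Re (inner (pi m x) x).

Lemma vector_state_linear x : real_linear (vector_state x).
Proof.
split=> [m n|t m]; rewrite /vector_state.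
  by rewrite piDl innerDl raddfD.
by rewrite piZl innerZl; case: (inner _ _) => p q /=; rewrite mul0r subr0.
Qed.

Lemma vector_state_star x m : vector_state x (cstar m) = vector_state x m.
Proof.
by rewrite /vector_state pi_adj cstarK [in LHS]inner_conj; case: (inner _ _).
Qed.

Lemma vector_state1 x : vector_state x 1 = rnorm x ^+ 2.
Proof. by rewrite /vector_state pi1 innerE. Qed.

Lemma vector_state_pos x m : mpos m -> 0 <= vector_state x m.
Proof.
move=> mp; have [sD sZ] := vector_state_linear x.
apply: rnorm_le_eps => e e0; pose d := e / (rnorm x ^+ 2 + 1).
have x0 : 0 < rnorm x ^+ 2 + 1 by rewrite ltr_wpDl// exprn_ge0// rnorm_ge0.
have d0 : 0 < d by rewrite divr_gt0.
have [l [ls ll _]] := mpos_root mp d0.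
have : 0 <= vector_state x (l * l).
  rewrite /vector_state piM pi_adj ls innerE/=.
  by rewrite exprn_ge0// rnorm_ge0.
rewrite ll sD sZ vector_state1 => h; apply: (le_trans h); rewrite lerD2l.
rewrite /d mulrAC ler_pdivrMr// ler_wpM2l ?(ltW e0)// lerDl//.
Qed.

(** For an A-invariant V, the largest M(A)-invariant subspace V1 inside V is 0 or everything. If it
    is 0, then A maps V into V1 because A is an ideal, so V lies in the common null space Z of A; Z
    is M(A)-invariant and differs from H since c acts nontrivially. *)
Lemma irreducible_rep_restrict c x0 :
  (forall m, continuous (pi m)) -> pi (mult_of c) x0 <> 0 ->
  (forall V : set H, closed_subspace V -> (forall m x, V x -> V (pi m x)) ->
     V = [set 0] \/ V = setT) ->
  irreducible_rep (fun a : A => pi (mult_of a)).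
Proof.
move=> pi_cont c0 irr; split; first by exists c, x0.
move=> V [Vc V0 Vl] Vinv.
have pi_0 m : pi m 0 = 0.
  by have := pi_lin m (-1) 0 0; rewrite !scaleN1r oppr0 addr0 addNr.
have closed_pre (D : set H) m : closed D -> closed (pi m @^-1` D).
  by move=> Dc; apply: closed_comp => // x _; exact: pi_cont.
pose V1 : set H := \bigcap_m (pi m @^-1` V).
have V1s : closed_subspace V1.
  split; first by apply: closed_bigI => m _; exact: closed_pre.
    by move=> m _; rewrite /preimage/= pi_0.
  by move=> k x y Vx Vy m _; rewrite /preimage/= pi_lin; apply: Vl; [exact: Vx|exact: Vy].
pose Z : set H := \bigcap_(a : A) (pi (mult_of a) @^-1` [set 0]).
have Zs : closed_subspace Z.
  split; first apply: closed_bigI => a _.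
  - apply: closed_pre; apply: accessible_closed_set1; apply: hausdorff_accessible.
    exact: norm_hausdorff.
  - by move=> a _; rewrite /preimage/= pi_0.
  - move=> k x y Zx Zy a _; rewrite /preimage/= pi_lin.
    by rewrite [pi _ x]Zx// [pi _ y]Zy// scaler0 addr0.
have [V10|V1T] := irr _ V1s (fun m x Vx n _ => ltac:(rewrite /preimage/= -piM; exact: Vx)).
  have [Z0|ZT] := irr _ Zs (fun m x Zx a _ => ltac:(rewrite /preimage/= -piM mult_of_mul; exact: Zx)).
    left; apply/seteqP; split=> [v Vv|_ ->//].
    have : Z v.
      move=> a _; suff : V1 (pi (mult_of a) v) by rewrite V10.
      by move=> m _; rewrite /preimage/= -piM mul_mult_of; exact: Vinv.
    by rewrite Z0.
  exfalso; apply: c0; have : Z x0 by rewrite ZT.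
  by move=> /(_ c I).
right; apply/seteqP; split=> // v _.
have : V1 v by rewrite V1T.
by move=> /(_ 1 I); rewrite /preimage/= pi1.
Qed.

Variables (f r : M -> R) (xi : H).
Hypotheses
  (r_ge0 : forall m, 0 <= r m)
  (r_dom : forall x m, vector_state x m <= rnorm x ^+ 2 * r m)
  (fE : forall m, f m = vector_state xi m) (xi1 : rnorm xi <= 1)
  (xi_cyclic : forall x, (forall m, inner x (pi m xi) = 0) -> x = 0)
  (f_extreme : forall g1 g2 s, real_linear g1 -> real_linear g2 ->
      (forall m, g1 m <= r m) -> (forall m, g2 m <= r m) -> 0 < s < 1 ->
      (forall m, f m = s * g1 m + (1 - s) * g2 m) -> g1 =1 f).

(** Decompose xi = y + z along V. Invariance splits f into the vector functionals of y and z, and if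
    both were nonzero, extremality would make each proportional to f. Cyclicity then gives y = k xi
    with k = |y|^2 / |xi|^2, which forces |y| = |xi| and z = 0. *)
Lemma pure_state_irreducible (V : set H) : closed_subspace V ->
  (forall m x, V x -> V (pi m x)) -> V = [set 0] \/ V = setT.
Proof.
move=> Vs Vpi; have [Vc V0 Vl] := Vs.
have [y [Vy yP]] := hilbert_projection xi Vs.
have [z zE] : exists z, z = xi - y by eexists.
rewrite -zE in yP; have xiE : xi = y + z by rewrite zE addrC subrK.
have zV m v : V v -> inner (pi m z) v = 0 by move=> Vv; rewrite pi_adj yP//; exact: Vpi.
have fyz m : f m = vector_state y m + vector_state z m.
  rewrite fE /vector_state xiE piD !innerDl !innerDr (zV m y Vy).
  by rewrite (inner_sym0 (yP _ (Vpi m _ Vy))) addr0 add0r raddfD.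
have xi_yz : rnorm xi ^+ 2 = rnorm y ^+ 2 + rnorm z ^+ 2.
  by rewrite -!vector_state1 -fyz fE.
have u1 : rnorm xi ^+ 2 <= 1 by rewrite expr_le1// rnorm_ge0.
have [y0|y0] := eqVneq y 0.
  left; apply/seteqP; split=> [v Vv|_ ->//]; apply: xi_cyclic => m.
  apply: inner_sym0; rewrite xiE y0 add0r; exact: zV.
have [z0|z0] := eqVneq z 0.
  right; apply/seteqP; split=> // x _.
  have [x' [Vx' xP]] := hilbert_projection x Vs.
  suff : x - x' = 0 by move/eqP; rewrite subr_eq0 => /eqP ->.
  apply: xi_cyclic => m; apply: xP; rewrite xiE z0 addr0; exact: Vpi.
exfalso.
set t := rnorm y ^+ 2 in xi_yz; set t' := rnorm z ^+ 2 in xi_yz.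
set u := rnorm xi ^+ 2 in xi_yz u1.
have sq_gt0 x : x != 0 -> 0 < rnorm x ^+ 2.
  move=> x0; rewrite exprn_gt0// lt_def rnorm_ge0 andbT.
  by apply: contra_neq x0; exact: rnorm_eq0.
have t0 : 0 < t := sq_gt0 _ y0; have t'0 : 0 < t' := sq_gt0 _ z0.
have u0 : 0 < u by rewrite xi_yz addr_gt0.
have lin (c : R) x : real_linear (fun m => c * vector_state x m).
  have [sD sZ] := vector_state_linear x.
  by split=> [m n|k m]; rewrite ?sD ?sZ ?mulrDr// mulrCA.
(* The two parts are rescaled to the mass u = |xi|^2, which is at most 1, so that both stay below r
   and f is their convex combination with weights t/u and t'/u. *)
have dom (c : R) x : 0 < c -> rnorm x ^+ 2 = c -> forall m, u / c * vector_state x m <= r m.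
  move=> c0 xc m; have := r_dom x m; rewrite xc => h.
  rewrite mulrAC ler_pdivrMr// mulrC [r m * c]mulrC.
  rewrite (@le_trans _ _ (c * r m * u))//; first by rewrite ler_wpM2r// ltW.
  by rewrite ler_piMr// mulr_ge0// ltW.
have gE : (fun m => u / t * vector_state y m) =1 f.
  apply: (f_extreme (lin _ _) (lin (u / t') z) (dom _ _ t0 erefl) (dom _ _ t'0 erefl)
    (s := t / u)).
    by rewrite divr_gt0// ltr_pdivrMr// mul1r xi_yz ltrDl.
  move=> m; rewrite fyz (_ : 1 - t / u = t' / u); last first.
    by rewrite xi_yz; field; rewrite -xi_yz gt_eqF.
  by field; rewrite (gt_eqF t0) (gt_eqF t'0) (gt_eqF u0).
pose k := t / u.
(* Extremality only controls real parts. Replacing m by i m recovers the imaginary part of [D m]. *)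
pose D m := inner (pi m xi) (y - k%:C *: xi).
have DE m : complex.Re (D m) = 0.
  rewrite /D innerBr innerZr (_ : k%:C^*%R = k%:C); last exact: conjc_real.
  have -> : inner (pi m xi) y = inner (pi m y) y.
    by rewrite {1}xiE piD innerDl (zV m y Vy) addr0.
  have := gE m; rewrite fE /vector_state => h.
  have -> : complex.Re (inner (pi m y) y - k%:C * inner (pi m xi) xi) =
     complex.Re (inner (pi m y) y) - k * complex.Re (inner (pi m xi) xi).
    by case: (inner (pi m y) y) (inner (pi m xi) xi) => [? ?] [? ?] /=; ring.
  by rewrite -h /k; field; rewrite !gt_eqF.
have D0 m : D m = 0.
  have := DE ('i%C *: m); rewrite /D piZl innerZl -/(D m).
  have := DE m; case: (D m) => p q /= -> ; rewrite mul0r mul1r add0r => /eqP.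
  by rewrite oppr_eq0 => /eqP ->.
have : y - k%:C *: xi = 0.
  by apply: xi_cyclic => m; apply: inner_sym0; exact: D0.
move/eqP; rewrite subr_eq0 => /eqP yk.
have tk : t = k ^+ 2 * u.
  by rewrite /t yk rnormZr exprMn ger0_norm// divr_ge0// ltW.
have : t * u = t * t by rewrite {1}tk /k; field; rewrite gt_eqF.
move/(mulfI (lt0r_neq0 t0)); rewrite xi_yz -{2}[t]addr0 => /addrI t'00.
by rewrite t'00 ltxx in t'0.
Qed.

End PureState.

(** * Extreme functionals localized along a family of central cut-offs *)

Section LocalizedState.
Context {R : realType} {A : cstarAlgType R}.
Local Notation M := (multiplier A).
Local Notation "t %:S" := (t%:C *: (1 : M)) (at level 2, format "t %:S").
Implicit Types (m n g : M) (s t : R).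
(** [G_abs] is the algebraic form of shrinking a neighbourhood: h lives where g equals 1. It will
    force every g to act as the identity. *)
Variable G : set M.
Hypotheses (G0 : G !=set0) (G_pos : forall g, G g -> mpos g)
  (G_le1 : forall g, G g -> mpos (1 - g))
  (G_central : forall g m, G g -> g * m = m * g)
  (GM : forall g h, G g -> G h -> G (g * h))
  (G_abs : forall g, G g -> exists2 h, G h & h * g = h).

Definition re_part m : M := (2^-1)%:C *: (m + cstar m).

Lemma re_part_sa m : cstar (re_part m) = re_part m.
Proof. by rewrite /re_part cstarZr cstarD cstarK addrC. Qed.

Lemma re_part_id m : cstar m = m -> re_part m = m.
Proof.
move=> ms; rewrite /re_part ms scalerDr -scalerDl -rmorphD/=.
by rewrite -[2^-1]mul1r -splitr scale1r.
Qed.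

Lemma re_partD m n : re_part (m + n) = re_part m + re_part n.
Proof. by rewrite /re_part cstarD addrACA scalerDr. Qed.

Lemma re_partZ t m : re_part (t%:C *: m) = t%:C *: re_part m.
Proof. by rewrite /re_part cstarZr -scalerDr !scalerA mulrC. Qed.

Lemma re_part0 : re_part 0 = 0.
Proof. by rewrite /re_part cstar0 addr0 scaler0. Qed.

Lemma re_part_star m : re_part (cstar m) = re_part m.
Proof. by rewrite /re_part cstarK addrC. Qed.

Lemma re_partN m : re_part (- m) = - re_part m.
Proof. by have := re_partZ (-1) m; rewrite rmorphN rmorph1 !scaleN1r. Qed.

Let G_sa g : G g -> cstar g = g. Proof. by move=> /G_pos/mpos_sa. Qed.

(* the positive part of the supremum of the real part of [m] in the germ of
   the algebra along [G] *)
Definition local_upper_set m :=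
  [set s : R | 0 <= s /\ exists2 g, G g & mpos (s%:S - g * re_part m)].
Definition local_upper m : R := inf (local_upper_set m).

Lemma local_upper_has_inf m : has_inf (local_upper_set m).
Proof.
split; last by exists 0 => s [].
have [g Gg] := G0; exists (rnorm (g * re_part m)); split; first exact: rnorm_ge0.
exists g => //; apply: mpos_bound => //.
by rewrite mstar_mul re_part_sa G_sa// -G_central.
Qed.

Lemma local_upper_le m s g : 0 <= s -> G g -> mpos (s%:S - g * re_part m) ->
  local_upper m <= s.
Proof.
move=> s0 Gg sp; apply: (ge_inf (proj2 (local_upper_has_inf m))).
by split=> //; exists g.
Qed.

Lemma local_upper_ge m c : (forall s g, 0 <= s -> G g ->
  mpos (s%:S - g * re_part m) -> c <= s) -> c <= local_upper m.
Proof.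
move=> h; apply: lb_le_inf; first exact: (proj1 (local_upper_has_inf m)).
by move=> s [s0 [g Gg sp]]; exact: h sp.
Qed.

Lemma local_upper_ge0 m : 0 <= local_upper m.
Proof. by apply: local_upper_ge. Qed.

(** The cut-off g h serves both arguments: s + t - g h (m + n) is the sum of h (s - g m) + s (1 - h)
    and g (t - h n) + t (1 - g), with real parts taken in m and n. *)
Lemma local_upper_add m n s t g h : G g -> G h ->
  0 <= s -> 0 <= t -> mpos (s%:S - g * re_part m) -> mpos (t%:S - h * re_part n) ->
  local_upper (m + n) <= s + t.
Proof.
move=> Gg Gh s0 t0 sp tp.
apply: (@local_upper_le _ _ (g * h)); [exact: addr_ge0|exact: GM|].
have -> : (s + t)%:S - g * h * re_part (m + n) =
    (h * (s%:S - g * re_part m) + s%:C *: (1 - h)) +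
    (g * (t%:S - h * re_part n) + t%:C *: (1 - g)).
  rewrite re_partD !mulrBr !mulrDr !scal1_comm !scal1M !scalerBr scal1D.
  by rewrite !mulrA (G_central h Gg); zmod.
have key g' x c : G g' -> 0 <= c -> mpos x -> mpos (g' * x + c%:C *: (1 - g')).
  move=> Gg' c0 xp; apply: mposD; last by apply: mposZ => //; exact: G_le1.
  by apply: mposM => //; [exact: G_pos|exact: G_central].
by apply: mposD; exact: key.
Qed.

Lemma local_upper_sublinear : sublinear local_upper.
Proof.
split=> [m n|t m t0].
  rewrite -lerBlDr; apply: local_upper_ge => s g s0 Gg sp.
  rewrite lerBlDl -lerBlDr; apply: local_upper_ge => t h t0 Gh tp.
  by rewrite lerBlDl; exact: local_upper_add sp tp.
have [->|tn0] := eqVneq t 0.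
  have [g Gg] := G0; rewrite mul0r scale0r; apply: (local_upper_le _ Gg) => //.
  by rewrite re_part0 mulr0 subr0; exact: mpos_scal1.
have tp : 0 < t by rewrite lt_def tn0.
rewrite mulrC -ler_pdivrMr//; apply: local_upper_ge => s g s0 Gg sp.
rewrite ler_pdivrMr// mulrC; apply: (local_upper_le _ Gg); first exact: mulr_ge0.
rewrite re_partZ -scalemAr rmorphM -scalerA -scalerBr; exact: mposZ.
Qed.

Lemma local_upper_norm m s g : cstar m = m -> G g -> rnorm (g * m) <= s ->
  local_upper m <= s.
Proof.
move=> ms Gg gm; apply: (local_upper_le _ Gg).
  by rewrite (le_trans _ gm)// rnorm_ge0.
rewrite re_part_id//; apply: mpos_bound => //.
by rewrite mstar_mul ms G_sa// -G_central.
Qed.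

(** Apply p to s - g m: positivity and invariance under G give p m <= s p(1). This supplies the
    domination hypothesis [r_dom] for vector functionals. *)
Lemma local_upper_dom (p : M -> R) : real_linear p -> (forall m, mpos m -> 0 <= p m) ->
  (forall m, p (cstar m) = p m) -> (forall g m, G g -> p (g * m) = p m) ->
  forall m, p m <= p 1 * local_upper m.
Proof.
move=> [pD pZ] p_pos p_star pG m.
have pN x : p (- x) = - p x by exact: (real_linearN x (conj pD pZ)).
have pre x : p (re_part x) = p x.
  by rewrite /re_part pZ pD p_star; lra.
have p1 : 0 <= p 1 by rewrite -[1]scale1r; apply: p_pos; exact: mpos_scal1.
have le s g : 0 <= s -> G g -> mpos (s%:S - g * re_part m) -> p m <= p 1 * s.
  move=> s0 Gg /p_pos; rewrite pD pN pZ pG// pre; lra.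
have [p10|p10] := eqVneq (p 1) 0.
  have [s [s0 [g Gg sp]]] := proj1 (local_upper_has_inf m).
  by have := le s g s0 Gg sp; rewrite p10 !mul0r.
have {}p1 : 0 < p 1 by rewrite lt_def p10.
rewrite -ler_pdivrMl//; apply: local_upper_ge => s g s0 Gg sp.
by rewrite ler_pdivrMl//; exact: le sp.
Qed.

Section Functional.
Variable f : M -> R.
Hypotheses (fl : real_linear f) (f_le : forall m, f m <= local_upper m).

Lemma local_functional0 m : local_upper m <= 0 -> local_upper (- m) <= 0 -> f m = 0.
Proof.
move=> h1 h2; have := f_le m; have := f_le (- m); rewrite real_linearN//; lra.
Qed.

Lemma local_functional_pos m : mpos m -> 0 <= f m.
Proof.
move=> mp; have [g Gg] := G0; rewrite -oppr_le0 -real_linearN//.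
apply: (le_trans (f_le _)); apply: (local_upper_le _ Gg) => //.
rewrite scale0r sub0r re_partN mulrN opprK re_part_id; last exact: mpos_sa.
by apply: mposM => //; [exact: G_pos|exact: G_central].
Qed.

Lemma local_functional_null m : re_part m = 0 -> f m = 0.
Proof.
move=> m0; have [g Gg] := G0.
by apply: local_functional0; apply: (local_upper_le _ Gg) => //;
  rewrite ?re_partN m0 ?oppr0 mulr0 subr0; exact: mpos_scal1.
Qed.

Lemma local_functional_star m : f (cstar m) = f m.
Proof.
apply/eqP; rewrite -subr_eq0 -(real_linearN m fl) -(proj1 fl).
by apply/eqP/local_functional_null; rewrite re_partD re_partN re_part_star subrr.
Qed.

Lemma local_functional1 : f 1 <= 1.
Proof.
have [g Gg] := G0; apply: (le_trans (f_le _)); apply: (local_upper_le _ Gg) => //.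
by rewrite re_part_id ?mstar1// mulr1 scale1r; exact: G_le1.
Qed.

Lemma local_functional_vanish m g : G g -> g * re_part m = 0 -> f m = 0.
Proof.
move=> Gg gm; apply: local_functional0; apply: (local_upper_le _ Gg) => //;
  rewrite ?re_partN ?mulrN gm !(oppr0, addr0); exact: mpos_scal1.
Qed.

End Functional.

(* For [G = {1}] this says that the primitive ideals separate the points of [A];
   for [G] the image of the functions equal to [1] near [x], that [A_x] vanishes
   unless [x] lies over a primitive ideal. *)
Lemma localized_primitive (c : A) (d : R) : 0 < d ->
  (forall g, G g -> d <= rnorm (g c)) ->
  exists P : set A, [/\ primitive_ideal P, ~ P c &
    forall a, (forall e : R, 0 < e -> exists2 g, G g & rnorm (g a) < e) -> P a].
Proof.
move=> d0 hd.
(* A functional attaining [local_upper] at this element, where it is at least d^2, keeps c from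
   annihilating the cyclic vector. *)
pose cc : M := cstar (mult_of c) * mult_of c.
have [f [fl f_le f_cc f_ext]] := extreme_functional cc local_upper_sublinear.
have f_pos := local_functional_pos fl f_le.
have f_star := local_functional_star fl f_le.
have ccp : 0 < f cc.
  rewrite f_cc (@lt_le_trans _ _ (d ^+ 2)) ?exprn_gt0//.
  apply: local_upper_ge => s g s0 Gg.
  have ccs : cstar cc = cc by rewrite /cc mstar_mul cstarK.
  rewrite re_part_id// => sp.
  apply: (@le_trans _ _ (rnorm (g * mult_of c) ^+ 2)).
    rewrite lerXn2r ?nnegrE ?rnorm_ge0 ?(ltW d0)//.
    by rewrite mul_mult_of rnorm_mult_of; exact: hd.
  rewrite -rnorm_star_mul; apply: mpos_le_norm => //; first exact: mpos_star_mul.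
  (* The bound s on g c^* c is turned into one on g^2 c^* c, whose norm is |g c|^2 >= d^2, by
     multiplying with g and using 1 - g >= 0. *)
  have -> : s%:S - cstar (g * mult_of c) * (g * mult_of c) =
      g * (s%:S - g * cc) + s%:C *: (1 - g).
    rewrite mulrBr scal1_comm scal1M scalerBr.
    suff -> : cstar (g * mult_of c) * (g * mult_of c) = g * (g * cc) by zmod.
    rewrite mstar_mul (G_sa Gg) -(G_central (cstar (mult_of c)) Gg) -mulrA.
    by congr (g * _); rewrite mulrA -(G_central (cstar (mult_of c)) Gg) -mulrA.
  apply: mposD; last by apply: mposZ => //; exact: G_le1.
  by apply: mposM => //; [exact: G_pos|exact: G_central].
pose H : hilbertType R := gns_space fl f_pos f_star.
pose pi m (F : H) : H := gns_act m F; pose xi : H := gns_in fl f_pos f_star 1.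
(* Some h in G satisfies h g = h, so it kills g b - b, and this vector has length zero in the GNS
   space. *)
have G_in g b (F : gns_space fl f_pos f_star) : G g -> F (g * b - b) = 0.
  move=> Gg; apply: gns_fun_null.
  have [h Gh hg] := G_abs Gg.
  apply: (local_functional_vanish fl f_le Gh).
  rewrite re_part_id; last by rewrite mstar_mul cstarK.
  by rewrite mulrA (G_central _ Gh) -mulrA mulrBr mulrA hg subrr mulr0.
have piG g (F : H) : G g -> pi g F = F.
  move=> Gg; apply: completion_ext => b /=; rewrite (G_sa Gg).
  have := G_in g b F Gg; rewrite completion_funD.
  have -> : completion_fun F (- b) = - completion_fun F b.
    by rewrite -scaleN1r completion_funZ rmorphN rmorph1 mulN1r.
  by move/eqP; rewrite subr_eq0 => /eqP.
have pi_lin_l : forall (k : R[i]) m n x, pi (k *: m + n) x = k *: pi m x + pi n x.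
  by move=> k m n x; exact: gns_act_linear_l.
have pi_lin : forall m, linear (pi m) by move=> m; exact: gns_act_linear.
have piM : forall m n x, pi (m * n) x = pi m (pi n x).
  by move=> m n x; exact: gns_actM.
have pi1 : forall x, pi 1 x = x by move=> x; exact: gns_act1.
have pi_adj : forall m x y, inner (pi m x) y = inner x (pi (cstar m) y).
  by move=> m x y; exact: gns_act_adj.
have pi_cont : forall m, continuous (pi m) by move=> m; exact: gns_act_continuous.
have piE m : inner (pi m xi) xi = gns_form f m by exact: inner_act_cyclic.
have cyc x : (forall m, inner x (pi m xi) = 0) -> x = 0.
  move=> h; apply: gns_sep => b; have := h b; rewrite /pi /xi gns_act_in mulr1.
  exact.
pose fn (F : H) (m : M) : R[i] := completion_fun F m.
have null m (F : H) : f (cstar m * m) = 0 -> fn F m = 0 by exact: gns_fun_null.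
have actE m (F : H) b : fn (pi m F) b = fn F (cstar m * b) by [].
have ext0 (F : H) : (forall b, fn F b = 0) -> F = 0.
  by move=> h; exact: completion_ext.
(* The GNS model becomes opaque; from here on only the recorded properties of the representation are
   available. *)
clear G_in; clearbody fn xi pi; clearbody H.
move: piG pi_lin_l pi_lin piM pi1 pi_adj pi_cont piE cyc null actE ext0.
move=> piG pi_lin_l pi_lin piM pi1 pi_adj pi_cont piE cyc null actE ext0.
have fE m : f m = vector_state pi xi m by rewrite /vector_state piE.
have xi1 : rnorm xi <= 1.
  rewrite -(@ler_pXn2r _ 2)// ?nnegrE ?rnorm_ge0// expr1n.
  rewrite -(vector_state1 pi1) -fE; exact: (local_functional1 f_le).
have dom x m : vector_state pi x m <= rnorm x ^+ 2 * local_upper m.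
  rewrite -(vector_state1 pi1); apply: local_upper_dom => //.
  - exact: vector_state_linear.
  - by move=> k kp; exact: vector_state_pos.
  - by move=> k; exact: vector_state_star.
  - by move=> g k Gg; rewrite /vector_state (G_central _ Gg) piM (piG _ _ Gg).
have irr := @pure_state_irreducible _ _ _ _ pi_lin_l pi_lin pi1 pi_adj _ _ _
  local_upper_ge0 dom fE xi1 cyc f_ext.
have c_xi : pi (mult_of c) xi <> 0.
  move=> c0; have : vector_state pi xi cc = 0.
    by rewrite /vector_state /cc piM pi_adj cstarK c0 -(scale0r (0 : H)) innerZl mul0r.
  by rewrite -fE => f0; rewrite f0 ltxx in ccp.
exists [set a | forall x, pi (mult_of a) x = 0]; split.
- exists H, (fun a => pi (mult_of a)); split=> //.
    split.
    + by move=> a; split; [exact: pi_lin|exact: pi_cont].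
    + by move=> k a b x; rewrite mult_of_linear pi_lin_l.
    + by move=> a b x; rewrite mult_ofM piM.
    + by move=> a x y; rewrite mult_of_star pi_adj.
  exact: (irreducible_rep_restrict pi_lin piM pi1 pi_cont c_xi irr).
- by move=> /= c0; exact: c_xi.
move=> a a_small x /=; apply: ext0 => b; rewrite actE; apply: null.
(* It suffices that n has length zero. Since n^* n = b^* a n contains a as a factor, its germ is as
   small as that of a. *)
set n := cstar (mult_of a) * b.
have nn : cstar n * n = cstar b * mult_of a * n by rewrite /n mstar_mul cstarK mulrA.
apply/eqP; rewrite eq_le f_pos ?andbT; last exact: mpos_star_mul.
apply: rnorm_le_eps => e e0; rewrite add0r; apply: (le_trans (f_le _)).
pose k := rnorm b * rnorm n + 1.
have k0 : 0 < k by rewrite /k ltr_wpDl// mulr_ge0 ?rnorm_ge0.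
have [g Gg ga] := a_small _ (divr_gt0 e0 k0).
apply: (local_upper_norm _ Gg); first by rewrite mstar_mul cstarK.
have -> : g * (cstar n * n) = cstar b * (g * mult_of a) * n.
  by rewrite nn !mulrA (G_central _ Gg).
rewrite mul_mult_of; apply: (le_trans (rnorm_mul _ _)).
apply: (@le_trans _ _ (rnorm b * (e / k) * rnorm n)).
  rewrite ler_wpM2r ?rnorm_ge0//; apply: (le_trans (rnorm_mul _ _)).
  by rewrite rnorm_cstar rnorm_mult_of ler_wpM2l ?rnorm_ge0// ltW.
rewrite mulrAC mulrC -[leRHS](divfK (lt0r_neq0 k0)) ler_wpM2l ?lerDl//.
by rewrite divr_ge0// ltW.
Qed.

End LocalizedState.

Definition prim_mem (R : realType) (A : cstarAlgType R) (P : prim A) (a : A) : Prop :=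
  prim_ideal P a.
Coercion prim_mem : prim >-> Funclass.

(** * Primitive ideals and the multiplier attached to a function on them *)

Section PrimitiveIdeals.
Context {R : realType} {A : cstarAlgType R}.
Implicit Types (a b : A).

(** For |c| < 1 write c^* c = k + k - k^2 with k in A, a square root of 1 - c^* c in disguise that
    avoids a unit. Then |y - k y|^2 = |y|^2 - |c y|^2. Scaling gives the general case. *)
Lemma representation_contractive (H : hilbertType R) (pi : A -> H -> H) a x :
  representation pi -> rnorm (pi a x) <= rnorm a * rnorm x.
Proof.
move=> [pi_lin pi_lin_l piM pi_adj].
have pi0 y : pi 0 y = 0.
  by have := pi_lin_l (-1) 0 0 y; rewrite scaler0 addr0 scaleN1r addNr.
have piZ (k : R[i]) c y : pi (k *: c) y = k *: pi c y.
  by have := pi_lin_l k c 0 y; rewrite pi0 !addr0.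
have piD c d y : pi (c + d) y = pi c y + pi d y.
  by have := pi_lin_l 1 c d y; rewrite !scale1r.
have innerE (y : H) : inner y y = (rnorm y ^+ 2)%:C.
  by rewrite inner_norm rnormE rmorphXn.
have small c y : rnorm c < 1 -> rnorm (pi c y) <= rnorm y.
  move=> c1; pose h := cstar c ** c.
  have h1 : rnorm h < 1 by rewrite /h rnorm_cstarM expr_lt1// rnorm_ge0.
  have hs : cstar h = h by rewrite /h cstarM cstarK.
  have [k [_ ks kE _]] := cstar_sqrt h1 hs.
  have key : inner (y - pi k y) (y - pi k y) = inner y y - inner (pi h y) y.
    have iBl (u v w : H) : inner (u - v) w = inner u w - inner v w.
      exact: (sipBl hilbert_sip).
    have iBr (u v w : H) : inner u (v - w) = inner u v - inner u w.
      exact: (sipBr hilbert_sip).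
    rewrite iBl !iBr.
    have -> : inner y (pi k y) = inner (pi k y) y by rewrite pi_adj ks.
    have -> : inner (pi k y) (pi k y) = inner (pi (k ** k) y) y.
      by rewrite piM [RHS]pi_adj ks.
    have : inner (pi (k + k) y) y = inner (pi h y) y + inner (pi (k ** k) y) y.
      by rewrite -innerDl -piD -kE subrK.
    by rewrite piD innerDl => e; rewrite -[inner (pi h y) y](addrK (inner (pi (k ** k) y) y)) -e; ring.
  have hE : inner (pi h y) y = (rnorm (pi c y) ^+ 2)%:C.
    by rewrite /h piM pi_adj cstarK innerE.
  have : rnorm (pi c y) ^+ 2 <= rnorm y ^+ 2.
    have : (rnorm (y - pi k y) ^+ 2)%:C = (rnorm y ^+ 2 - rnorm (pi c y) ^+ 2)%:C.
      by rewrite -innerE key innerE hE rmorphB.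
    by move=> /complexI e; rewrite -subr_ge0 -e exprn_ge0// rnorm_ge0.
  by rewrite ler_pXn2r// nnegrE rnorm_ge0.
apply: rnorm_le_eps => e e0.
pose d := e / (rnorm x + 1); have x1 : 0 < rnorm x + 1 by rewrite ltr_wpDl ?rnorm_ge0.
have d0 : 0 < d by rewrite divr_gt0.
have ad : 0 < rnorm a + d by rewrite ltr_wpDl ?rnorm_ge0.
have : rnorm (pi ((rnorm a + d)^-1%:C *: a) x) <= rnorm x.
  apply: small; rewrite rnormZr gtr0_norm ?invr_gt0// mulrC ltr_pdivrMr// mul1r.
  by rewrite ltrDl.
rewrite piZ rnormZr gtr0_norm ?invr_gt0// ler_pdivrMl// mulrDl => h.
apply: (le_trans h); rewrite lerD2l /d mulrAC ler_pdivrMr// mulrDr mulr1 lerDl.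
exact: ltW.
Qed.

Lemma prim_lin (P : prim A) (k : R[i]) a b : P a -> P b -> P (k *: a + b).
Proof.
rewrite /prim_mem; case: P => P /= [H [pi [[_ pil _ _] _ ->]]] /= Pa Pb x.
by rewrite pil Pa Pb scaler0 addr0.
Qed.

Lemma prim0 (P : prim A) : P 0.
Proof.
rewrite /prim_mem; case: P => P /= [H [pi [[_ pil _ _] _ ->]]] /= x.
by have := pil (-1) 0 0 x; rewrite scaler0 addr0 scaleN1r addNr.
Qed.

Lemma primD (P : prim A) a b : P a -> P b -> P (a + b).
Proof. by move=> Pa Pb; rewrite -[a]scale1r; exact: prim_lin. Qed.

Lemma primZ (P : prim A) (k : R[i]) a : P a -> P (k *: a).
Proof. by move=> Pa; rewrite -[k *: a]addr0; apply: prim_lin => //; exact: prim0. Qed.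

Lemma primN (P : prim A) a : P a -> P (- a).
Proof. by move=> Pa; rewrite -scaleN1r; exact: primZ. Qed.

Lemma primB (P : prim A) a b : P a -> P b -> P (a - b).
Proof. by move=> Pa Pb; apply: primD => //; exact: primN. Qed.

Lemma primMr (P : prim A) a b : P a -> P (a ** b).
Proof. by rewrite /prim_mem; case: P => P /= [H [pi [[_ _ piM _] _ ->]]] /= Pa x; rewrite piM Pa. Qed.

Lemma prim_closed (P : prim A) a :
  (forall e : R, 0 < e -> exists2 j, P j & rnorm (a - j) < e) -> P a.
Proof.
rewrite /prim_mem; case: P => P /= [H [pi [rp _ ->]]] /= h x; have [_ pil _ _] := rp.
apply: rnorm_eq0; apply/eqP; rewrite eq_le rnorm_ge0 andbT.
apply: rnorm_le_eps => e e0; rewrite add0r.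
have x1 : 0 < rnorm x + 1 by rewrite ltr_wpDl ?rnorm_ge0.
have [j Pj aj] := h _ (divr_gt0 e0 x1).
have -> : pi a x = pi (a - j) x.
  by have := pil (-1) j a x; rewrite Pj scaler0 add0r scaleN1r [- j + a]addrC => ->.
apply: (le_trans (representation_contractive _ _ rp)).
apply: (@le_trans _ _ (e / (rnorm x + 1) * rnorm x)).
  by rewrite ler_wpM2r ?rnorm_ge0// ltW.
by rewrite mulrAC ler_pdivrMr// mulrDr mulr1 lerDl ltW.
Qed.

Lemma prim_proper (P : prim A) : exists a, ~ P a.
Proof.
rewrite /prim_mem; case: P => P /= [H [pi [_ [[a [x ax]] _] ->]]]; exists a => h; exact: ax.
Qed.

Lemma bigcap_prim0 a : (forall P : prim A, P a) -> a = 0.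
Proof.
move=> h; apply/eqP; apply: contraPT isT => a0 _.
have [||||||||P [Pp Pa _]] := @localized_primitive R A [set 1] _ _ _ _ _ _ a (rnorm a).
- by exists 1.
- by move=> _ ->; rewrite -[1]scale1r; exact: mpos_scal1.
- by move=> _ ->; rewrite subrr -(scale0r (1 : multiplier A)); exact: mpos_scal1.
- by move=> _ m ->; rewrite mul1r mulr1.
- by move=> _ _ -> ->; rewrite mulr1.
- by move=> _ ->; exists 1; rewrite ?mulr1.
- rewrite lt_def rnorm_ge0 andbT; apply: contra a0 => /eqP/rnorm_eq0 ->//.
- by move=> _ ->.
by apply: Pa; exact: (h (Prim Pp)).
Qed.

Lemma add_cosetE (P : prim A) a b :
  add_coset (prim_ideal P) a = add_coset (prim_ideal P) b <-> P (a - b).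
Proof.
split=> [e|Pab].
  have : add_coset (prim_ideal P) a a by exists 0; [exact: prim0|rewrite addr0].
  by rewrite e => -[j Pj <-]; rewrite addrAC subrr add0r.
have sub (c d : A) : P (c - d) -> add_coset (prim_ideal P) c `<=` add_coset (prim_ideal P) d.
  move=> Pcd _ [j Pj <-]; exists (c - d + j); first exact: primD.
  by rewrite addrA addrCA subrr addr0.
apply/seteqP; split; apply: sub => //.
by rewrite -opprB; exact: primN.
Qed.

Definition dauns_hofmann_spec (g : prim A -> R[i]) (m : multiplier A) :=
  ZM m /\ forall (P : prim A) a, P (m a - g P *: a).

(** The choice returns a multiplier with the property or the default 0; arguments below treat both
    outcomes, excluding the default whenever the value is known to be nonzero. *)
Lemma dauns_hofmannP (g : prim A -> R[i]) :
  dauns_hofmann g = 0 \/ dauns_hofmann_spec g (dauns_hofmann g).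
Proof.
rewrite /dauns_hofmann; case: xgetP => [m -> [Zm mg]|_]; last by left.
by right; split=> // P a; apply/add_cosetE.
Qed.

Lemma dauns_hofmann_unique (g : prim A -> R[i]) m :
  dauns_hofmann_spec g m -> dauns_hofmann g = m.
Proof.
move=> [Zm mg].
have : [set m | ZM m /\ forall (P : prim A) a, add_coset P (m a) = add_coset P (g P *: a)] m.
  by split=> // P a; apply/add_cosetE.
rewrite /dauns_hofmann; case: xgetP => [m' _ [_ m'g] _|/(_ m)//].
apply: multiplier_extL => a; apply/eqP; rewrite -subr_eq0; apply/eqP/bigcap_prim0 => P.
have -> : m' a - m a = (m' a - g P *: a) - (m a - g P *: a) by zmod.
by apply: primB => //; apply/add_cosetE.
Qed.

End PrimitiveIdeals.

(** * Cut-off functions and fibres *)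

Section C0Functions.
Context {R : realType} {X : topologicalType}.

Lemma rnorm_continuous (V : normedModType R[i]) (f : X -> V) :
  continuous f -> continuous (fun x => rnorm (f x)).
Proof.
move=> fc x; apply/cvgrPdist_lt => e e0.
have /cvg_rnormP/(_ _ e0) := fc x; apply: filterS => y fxy.
rewrite (le_lt_trans _ fxy)// ler_norml.
have h1 := rnormD (f y - f x) (f x); have h2 := rnormD (f x - f y) (f y).
rewrite !subrK in h1 h2; rewrite [rnorm (f x - _)]rnormC in h2.
by apply/andP; split; lra.
Qed.

Lemma C0P (f : X -> R[i]) : C0 f <->
  continuous f /\ forall e : R, 0 < e -> compact [set x | e <= rnorm (f x)].
Proof.
have set_eq (e : R) : [set x | e%:C <= `|f x|] = [set x | e <= rnorm (f x)].
  by apply/seteqP; split=> x /=; rewrite rnormE lecR.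
split=> -[fc fe]; split=> // e e0; first by rewrite -set_eq; apply: fe; rewrite ltcR.
have eE : e = (complex.Re e)%:C by rewrite RRe_real// gtr0_real.
by rewrite eE set_eq; apply: fe; rewrite -ltcR -eE.
Qed.

Lemma C0_sub (f : X -> R[i]) : continuous f ->
  (forall e : R, 0 < e -> exists2 K, compact K & [set x | e <= rnorm (f x)] `<=` K) ->
  C0 f.
Proof.
move=> fc h; apply/C0P; split=> // e e0; have [K Kc sub] := h e e0.
apply: (subclosed_compact _ Kc sub).
apply: (@closed_comp _ _ (fun x => rnorm (f x)) [set y | e <= y]).
  by move=> x _; exact: rnorm_continuous.
exact: closed_ge.
Qed.

Lemma C0_le (f g : X -> R[i]) (c : R) : continuous f -> C0 g -> 0 < c ->
  (forall x, rnorm (f x) <= c * rnorm (g x)) -> C0 f.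
Proof.
move=> fc /C0P[_ gK] c0 fg; apply: C0_sub => // e e0.
exists [set x | e / c <= rnorm (g x)]; first by apply: gK; exact: divr_gt0.
by move=> x /= ex; rewrite ler_pdivrMr// mulrC (le_trans ex).
Qed.

Lemma C0D (f g : X -> R[i]) : C0 f -> C0 g -> C0 (f \+ g).
Proof.
move=> /C0P[fc fK] /C0P[gc gK]; apply: C0_sub => [x|e e0].
  by apply: cvgD; [exact: fc|exact: gc].
have e2 : 0 < e / 2 by rewrite divr_gt0.
exists ([set x | e / 2 <= rnorm (f x)] `|` [set x | e / 2 <= rnorm (g x)]).
  by apply: compactU; [exact: fK|exact: gK].
move=> x /= ex; have [fx|fx] := leP (e / 2) (rnorm (f x)); [by left|right].
by have := rnormD (f x) (g x); lra.
Qed.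

End C0Functions.

Section BaseMap.
Context {R : realType} {X : topologicalType} {A : cstarAlgType R}.
Variable mu : c0_algebra X A.

(* If no base map exists, the default value in its definition is the same
   point for every primitive ideal, by proof irrelevance. *)
Lemma base_map_cases :
  (forall f, C0 f -> mu f = dauns_hofmann (f \o base_map mu)) \/
  (forall P Q, base_map mu P = base_map mu Q).
Proof.
rewrite /base_map; case: xgetP => [phi _ [_ h]|_]; first by left.
by right=> P Q; congr (sval (cid _)); exact: Prop_irrelevance.
Qed.

Hypothesis muE : forall f, C0 f -> mu f = dauns_hofmann (f \o base_map mu).

Lemma mu_eq f g : C0 f -> C0 g -> (forall P, f (base_map mu P) = g (base_map mu P)) ->
  mu f = mu g.
Proof.
move=> fC gC fg; rewrite !muE//; congr dauns_hofmann.
by apply/funext => P; exact: fg.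
Qed.

(** If [mu f] is nonzero, the choice behind it succeeded. If it is 0, it cannot be told from the
    default; nondegeneracy then provides g with [mu g] nonzero, and the property for f + g and for g
    is subtracted. *)
Lemma c0_mapP f (P : prim A) a : C0 f -> P (mu f a - f (base_map mu P) *: a).
Proof.
move=> fC; have [c Pc] := prim_proper P.
have [g gC [c' _ gc]] : [set mu f a | f in @C0 R X & a in [set: A]] c.
  by rewrite c0_map_nondeg.
have spec h : C0 h -> mu h <> 0 -> forall b, P (mu h b - h (base_map mu P) *: b).
  move=> hC h0 b; have := h0; rewrite muE// => h0'.
  by have [//|[_]] := dauns_hofmannP (h \o base_map mu); apply.
have [f0|f0] := pselect (mu f = 0); last exact: spec.
have g0 : mu g <> 0 by move=> g0; apply: Pc; rewrite -gc g0; exact: prim0.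
have fgC : C0 (f \+ g) by exact: C0D.
have fg : mu (f \+ g) = mu g by rewrite c0_mapD// f0 add0r.
have h1 := spec g gC g0 a; have h2 : P (mu (f \+ g) a - (f \+ g) (base_map mu P) *: a).
  by apply: spec; rewrite // fg.
rewrite f0 /= sub0r.
have -> : - (f (base_map mu P) *: a) = (mu (f \+ g) a - (f \+ g) (base_map mu P) *: a) -
    (mu g a - g (base_map mu P) *: a).
  by rewrite fg /= scalerDl; zmod.
exact: primB.
Qed.

End BaseMap.

Section RealFunctions.
Context {R : realType} {X : topologicalType}.
Implicit Types (h k : X -> R).

Definition cplx h : X -> R[i] := fun x => (h x)%:C.

Lemma rnorm_cplx h x : rnorm (cplx h x) = `|h x|.
Proof. exact: rnorm_real. Qed.

Lemma cplx_continuous h : continuous h -> continuous (cplx h).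
Proof.
move=> hc x; apply/cvg_rnormP => e e0.
have /cvgrPdist_lt/(_ _ e0) := hc x; apply: filterS => y.
by rewrite /cplx -rmorphB rnorm_real distrC.
Qed.

Lemma cplxM h k : cplx (fun x => h x * k x) = cplx h \* cplx k.
Proof. by apply/funext => x; rewrite /cplx rmorphM. Qed.

Lemma cplxD h k : cplx (fun x => h x + k x) = cplx h \+ cplx k.
Proof. by apply/funext => x; rewrite /cplx rmorphD. Qed.

Definition C0r h := continuous h /\ C0 (cplx h).

Lemma C0r_le h k (c : R) : continuous h -> C0r k -> 0 < c ->
  (forall x, `|h x| <= c * `|k x|) -> C0r h.
Proof.
move=> hc [_ kC] c0 hk; split=> //; apply: (C0_le _ kC c0).
  exact: cplx_continuous.
by move=> x; rewrite !rnorm_cplx.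
Qed.

Lemma continuousM h k : continuous h -> continuous k -> continuous (fun x => h x * k x).
Proof. by move=> hc kc x; apply: cvgM; [exact: hc|exact: kc]. Qed.

Lemma C0rM h k : C0r h -> (forall x, 0 <= k x <= 1) -> continuous k ->
  C0r (fun x => h x * k x).
Proof.
move=> hC k01 kc; apply: (C0r_le (c := 1) _ hC) => //.
  by apply: continuousM => //; case: hC.
move=> x; rewrite mul1r normrM ler_piMr//.
by have /andP[k0 k1] := k01 x; rewrite ger0_norm.
Qed.

Lemma C0rD h k : C0r h -> C0r k -> C0r (fun x => h x + k x).
Proof.
move=> [hc hC] [kc kC]; split; last by rewrite cplxD; exact: C0D.
by move=> x; apply: cvgD; [exact: hc|exact: kc].
Qed.

Lemma C0r0 : C0r (fun=> 0).
Proof.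
split; first by move=> x; exact: cvg_cst.
apply: C0_sub => [x|e e0]; first exact: cvg_cst.
exists set0; first exact: compact0.
by move=> x /=; rewrite rnorm_cplx normr0 leNgt e0.
Qed.

Lemma continuous_sqrt h : continuous h -> continuous (fun x => Num.sqrt (h x)).
Proof. by move=> hc x; apply: continuous_comp; [exact: hc|exact: sqrt_continuous]. Qed.

Lemma C0r_sqrt h : C0r h -> (forall x, 0 <= h x) -> C0r (fun x => Num.sqrt (h x)).
Proof.
move=> [hc hC] h0; have sc := continuous_sqrt hc; split=> //.
move/C0P: hC => [_ hK]; apply: C0_sub; first exact: cplx_continuous.
move=> e e0; exists [set x | e ^+ 2 <= rnorm (cplx h x)]; first by apply: hK; exact: exprn_gt0.
move=> x /=; rewrite !rnorm_cplx !ger0_norm ?sqrtr_ge0// => es.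
by rewrite -[h x]sqr_sqrtr// lerXn2r// ?nnegrE ?sqrtr_ge0 ?(ltW e0).
Qed.

Definition bump_at (x : X) h :=
  [/\ C0r h, forall y, 0 <= h y <= 1 & \forall y \near x, h y = 1].

Lemma bump1 x h : bump_at x h -> h x = 1.
Proof. by case=> _ _ /nbhs_singleton. Qed.

Lemma bumpM x h k : bump_at x h -> bump_at x k -> bump_at x (fun y => h y * k y).
Proof.
move=> [hC h01 h1] [[kc _] k01 k1]; split.
- exact: C0rM.
- move=> y; have /andP[? ?] := h01 y; have /andP[? ?] := k01 y.
  by rewrite mulr_ge0// mulr_ile1.
- by apply: filterS2 h1 k1 => y -> ->; rewrite mulr1.
Qed.

Lemma bump_exists x U : locally_compact [set: X] -> hausdorff_space X ->
  nbhs x U -> exists2 h, bump_at x h & forall y, ~ U y -> h y = 0.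
Proof.
move=> lcX hX xU.
have [W /= xW [Wc Wcl]] : exists2 W, nbhs x W & compact W /\ closed W.
  have [W xW WP] := lcX x I; exists W => //.
  by move: xW; rewrite withinET.
pose V := (U `&` W)^°.
have xV : V x by apply: filterI.
have Vcl : closed (~` V) by apply: open_closedC; exact: open_interior.
have sep := @locally_compact_completely_regular X R lcX hX x (~` V) Vcl (fun nV : (~` V) x => nV xV).
have [f [fc f01 fx fV]] := (@uniform_separatorP X R _ _).1 sep.
have f01' y : 0 <= f y <= 1.
  by have := f01 (f y) (imageT f y); rewrite /= in_itv/=.
have fx0 : f x = 0 by apply: fx; exists x.
have fV1 y : ~ V y -> f y = 1 by move=> Vy; apply: fV; exists y.
(* Doubling and truncating makes h equal to 1 on the neighbourhood where f < 1/2, not merely at x.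
   The support condition through the compact W puts h in C0. *)
pose h y := Num.min 1 (2 * (1 - f y)).
have hV y : ~ V y -> h y = 0.
  by move=> /fV1 fy; rewrite /h fy subrr mulr0 min_r.
have h01 y : 0 <= h y <= 1.
  have /andP[f0 f1] := f01' y.
  by rewrite /h le_min ler01/= ge_min lexx mulr_ge0// subr_ge0.
have hc : continuous h.
  move=> y; apply: (@continuous_min R X (fun=> 1) (fun y => 2 * (1 - f y)) y).
    exact: cvg_cst.
  apply: cvgM; first exact: cvg_cst.
  by apply: cvgB; [exact: cvg_cst|exact: fc].
exists h; last first.
  by move=> y Uy; apply: hV => /interior_subset[].
split=> //.
  split=> //; apply: C0_sub; first exact: cplx_continuous.
  move=> e e0; exists W => // y /= ey; have [/interior_subset[]//|/hV hy] := pselect (V y).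
  by move: ey; rewrite rnorm_cplx hy normr0 leNgt e0.
have f12 : (1 / 2 : R) > 0 by rewrite divr_gt0.
have /cvgrPdist_lt/(_ _ f12) := fc x; rewrite fx0; apply: filterS => y.
rewrite sub0r normrN; have /andP[f0 f1] := f01' y; rewrite ger0_norm// => fy.
by rewrite /h min_l//; lra.
Qed.

End RealFunctions.

Section C0Action.
Context {R : realType} {X : topologicalType} {A : cstarAlgType R}.
Variable mu : c0_algebra X A.
Hypothesis muE : forall f, C0 f -> mu f = dauns_hofmann (f \o base_map mu).
Local Notation M := (multiplier A).
Local Notation "t %:S" := (t%:C *: (1 : M)) (at level 2, format "t %:S").
Implicit Types (h k : X -> R) (P : prim A).

Definition mur h : M := mu (cplx h).

Lemma mur_eq h k : C0r h -> C0r k -> (forall P, h (base_map mu P) = k (base_map mu P)) ->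
  mur h = mur k.
Proof. by move=> [_ hC] [_ kC] hk; apply: mu_eq => // P; rewrite /cplx hk. Qed.

Lemma mur_sa h : C0r h -> cstar (mur h) = mur h.
Proof.
move=> [_ hC]; rewrite -[LHS](c0_map_star mu hC); congr (mu _).
by apply/funext => x; exact: conjc_real.
Qed.

Lemma mur_central h m : C0r h -> mur h * m = m * mur h.
Proof. by move=> [_ hC]; exact: c0_map_central. Qed.

Lemma murM h k : C0r h -> C0r k -> mur (fun x => h x * k x) = mur h * mur k.
Proof. by move=> [_ hC] [_ kC]; rewrite /mur cplxM c0_mapM. Qed.

Lemma murD h k : C0r h -> C0r k -> mur (fun x => h x + k x) = mur h + mur k.
Proof. by move=> [_ hC] [_ kC]; rewrite /mur cplxD c0_mapD. Qed.

Lemma murZ h (c : R) : C0r h -> mur (fun x => c * h x) = c%:C *: mur h.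
Proof.
move=> [_ hC]; rewrite /mur -c0_mapZ//; congr (mu _).
by apply/funext => x; rewrite /cplx rmorphM.
Qed.

Lemma mur0 : mur (fun=> 0) = 0.
Proof.
have := murZ 0 (@C0r0 R X); rewrite scale0r => <-; congr mur.
by apply/funext => x; rewrite mul0r.
Qed.

Lemma murP h P a : C0r h -> P (mur h a - (h (base_map mu P))%:C *: a).
Proof. by move=> [_ hC]; exact: c0_mapP. Qed.

Lemma mur_pos h : C0r h -> (forall x, 0 <= h x) -> mpos (mur h).
Proof.
move=> hC h0; have sC := C0r_sqrt hC h0.
have -> : mur h = mur (fun x => Num.sqrt (h x)) * mur (fun x => Num.sqrt (h x)).
  rewrite -murM//; congr mur; apply/funext => x.
  by rewrite -expr2 sqr_sqrtr.
by apply: mpos_sqr; exact: mur_sa.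
Qed.

(** Truncating h at 1 does not change [mur h], as only values on the image of the base map count.
    Then 1 - h' = (1 - k)^2 with k = 1 - sqrt (1 - h'), which satisfies 0 <= k <= h' and so lies in
    C0 although the constant 1 need not. *)
Lemma mur_le1 h : C0r h -> (forall x, 0 <= h x) -> (forall P, h (base_map mu P) <= 1) ->
  mpos (1 - mur h).
Proof.
move=> hC h0 h1; have [hc _] := hC.
pose h' x := Num.min 1 (h x).
have h'01 x : 0 <= h' x <= 1 by rewrite le_min ler01 h0 ge_min lexx.
have h'c : continuous h'.
  move=> x; apply: (@continuous_min R X (fun=> 1) h x); last exact: hc.
  exact: cvg_cst.
have h'C : C0r h'.
  apply: (C0r_le (c := 1) h'c hC) => // x; have /andP[? _] := h'01 x.
  by rewrite mul1r !ger0_norm// ge_min lexx orbT.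
have -> : mur h = mur h' by apply: mur_eq => // P; rewrite /h' min_r.
pose k x := 1 - Num.sqrt (1 - h' x).
have s01 x : 0 <= Num.sqrt (1 - h' x) <= 1.
  have /andP[? ?] := h'01 x.
  by rewrite sqrtr_ge0/= -[leRHS]sqrtr1 ler_wsqrtr// lerBlDr lerDl.
have s2 x : Num.sqrt (1 - h' x) ^+ 2 = 1 - h' x.
  by rewrite sqr_sqrtr// subr_ge0; have /andP[] := h'01 x.
have kc : continuous k.
  move=> x; apply: cvgB; first exact: cvg_cst.
  apply: (@continuous_sqrt R X (fun x => 1 - h' x)) => y.
  by apply: cvgB; [exact: cvg_cst|exact: h'c].
have kC : C0r k.
  apply: (C0r_le (c := 1) kc h'C) => // x; have /andP[? ?] := h'01 x.
  have /andP[s0 s1] := s01 x; rewrite mul1r !ger0_norm ?subr_ge0//.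
  have ss : Num.sqrt (1 - h' x) ^+ 2 <= Num.sqrt (1 - h' x).
    by rewrite expr2 ler_piMl.
  by rewrite s2 in ss; rewrite /k; lra.
have k01 x : 0 <= k x <= 1.
  by have /andP[? ?] := s01 x; rewrite /k subr_ge0 gerBl; apply/andP.
have E : mur k + mur k - mur k * mur k = mur h'.
  have kkC := C0rM kC k01 kc.
  apply/eqP; rewrite subr_eq -murM// -!murD//; apply/eqP; congr mur.
  by apply/funext => x; have := s2 x; rewrite /k; lra.
have -> : 1 - mur h' = (1 - mur k) * (1 - mur k).
  by rewrite -E mulrBl mul1r mulrBr mulr1; zmod.
apply: mpos_sqr; rewrite cstarB mstar1 mur_sa//.
Qed.

Lemma mur_le_norm h (c : R) : C0r h -> (forall x, 0 <= h x) -> 0 < c ->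
  (forall P, h (base_map mu P) <= c) -> rnorm (mur h) <= c.
Proof.
move=> hC h0 c0 hc; pose k x := c^-1 * h x.
have [hcont _] := hC.
have kC : C0r k.
  apply: (C0r_le (c := c^-1) _ hC); rewrite ?invr_gt0//.
    by move=> x; apply: cvgM; [exact: cvg_cst|exact: hcont].
  by move=> x; rewrite normrM gtr0_norm ?invr_gt0.
have k0 x : 0 <= k x by rewrite mulr_ge0// invr_ge0 ltW.
have k1 P : k (base_map mu P) <= 1 by rewrite /k ler_pdivrMl// mulr1.
have k_le1 : rnorm (mur k) <= 1.
  apply: mpos_le_norm => //; first exact: mur_pos.
  by rewrite scale1r; exact: mur_le1.
have -> : mur h = c%:C *: mur k.
  rewrite /k murZ// scalerA -rmorphM divff ?gt_eqF// scale1r//.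
by rewrite rnormZr gtr0_norm// ler_piMr// ltW.
Qed.

Lemma mur_norm1 h : C0r h -> (forall x, 0 <= h x <= 1) -> rnorm (mur h) <= 1.
Proof.
move=> hC h01; apply: mur_le_norm => // [x|P].
  by have /andP[] := h01 x.
by have /andP[_] := h01 (base_map mu P).
Qed.

Lemma c0_map_norm f (c : R) : C0 f -> 0 < c -> (forall x, rnorm (f x) <= c) ->
  rnorm (mu f) <= c.
Proof.
move=> fC c0 fc; pose h x := rnorm (f x) ^+ 2.
have [fcont _] := fC.
have hcont : continuous h.
  by move=> x; apply: continuousM => y; exact: rnorm_continuous.
have hE x : cplx h x = (f x)^*%R * f x.
  by rewrite /cplx /h mulrC -sqr_normc rnormE rmorphXn.
have hC : C0r h.
  split; first exact: hcont.
  apply: (C0_le _ fC c0); first exact: cplx_continuous.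
  move=> x; rewrite rnorm_cplx /h ger0_norm ?exprn_ge0 ?rnorm_ge0// expr2.
  by rewrite ler_wpM2r ?rnorm_ge0.
have fbC : C0 (fun x => (f x)^*%R).
  apply: (C0_le _ fC ltr01) => x; last by rewrite rnorm_conj mul1r.
  by apply: cvg_conj; exact: fcont.
have E : cstar (mu f) * mu f = mur h.
  rewrite -[cstar _](c0_map_star mu fC) -c0_mapM//; congr (mu _).
  by apply/funext => x; rewrite hE.
rewrite -(@ler_pXn2r _ 2)// ?nnegrE ?rnorm_ge0 ?(ltW c0)//.
rewrite -rnorm_star_mul E; apply: mur_le_norm => //.
- by move=> x; rewrite exprn_ge0// rnorm_ge0.
- exact: exprn_gt0.
- by move=> P; rewrite /h lerXn2r ?nnegrE ?rnorm_ge0 ?(ltW c0).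
Qed.

Hypotheses (lcX : locally_compact [set: X]) (hX : hausdorff_space X).

(** Otherwise localization along the bumps at x yields a primitive ideal P avoiding a, over some z
    different from x. For a bump h at x vanishing at z, h a lies in P; and a - h a lies in P too,
    because a bump supported where h = 1 annihilates it. So a would be in P. *)
Lemma not_XA_small x a (e : R) : ~ XA mu x -> 0 < e ->
  exists2 h, bump_at x h & rnorm (mur h a) < e.
Proof.
move=> xXA e0; apply: contrapT => /forall2NP hN.
pose G := [set mur h | h in bump_at x].
have big g : G g -> e <= rnorm (g a).
  by move=> [h hb <-]; case: (hN h) => // /negP; rewrite -leNgt.
have [||||||P [Pp Pa PG]] := @localized_primitive R A G _ _ _ _ _ _ a e e0 big.
- have [h hb _] := bump_exists (R := R) lcX hX (@filterT _ (nbhs x) _).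
  by exists (mur h), h.
- move=> _ [h [hC h01 _] <-]; apply: mur_pos => // y.
  by have /andP[] := h01 y.
- move=> _ [h [hC h01 _] <-]; apply: mur_le1 => // [y|P].
    by have /andP[] := h01 y.
  by have /andP[] := h01 (base_map mu P).
- by move=> _ m [h [hC _ _] <-]; exact: mur_central.
- move=> _ _ [h hb <-] [k kb <-]; exists (fun y => h y * k y); first exact: bumpM.
  by case: hb kb => [hC _ _] [kC _ _]; rewrite murM.
- move=> _ [h [hC h01 h1] <-].
  have [k kb kU] := bump_exists (R := R) lcX hX h1.
  exists (mur k); first by exists k.
  have [kC _ _] := kb; rewrite -murM//; congr mur; apply/funext => y.
  by have [->|/kU ->] := pselect (h y = 1); rewrite ?mulr1 ?mul0r.
pose Q : prim A := Prim Pp; pose z := base_map mu Q.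
have zx : z <> x by move=> zx; apply: xXA; exists Q.
have [U [xU zU]] : exists U, nbhs x U /\ ~ U z.
  apply: contrapT => nU; apply: zx; apply: hX => U V zU xV; apply: contrapT => UV.
  apply: nU; exists V; split=> // zV; apply: UV; exists z; split=> //.
  exact: nbhs_singleton.
have [h hb hU] := bump_exists (R := R) lcX hX xU.
have [hC h01 h1] := hb.
have [k kb kU] := bump_exists (R := R) lcX hX h1.
have [kC _ _] := kb.
have Q1 : Q (mur h a) by have := murP Q a hC; rewrite -/z hU// scale0r subr0.
apply: Pa; rewrite -[a](subrK (mur h a)); apply: (primD (P := Q)) => //.
apply: PG => d d0; exists (mur k); first by exists k.
have -> : mur k (a - mur h a) = 0; last by rewrite rnorm0.
have -> : mur k (a - mur h a) = mur k a - (mur k * mur h) a by rewrite mulLB.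
rewrite -murM// (_ : (fun y => k y * h y) = k) ?subrr//; apply/funext => y.
by have [->|/kU ->] := pselect (h y = 1); rewrite ?mulr1 ?mul0r.
Qed.

End C0Action.

(** * Approaching a point of the remainder *)

Section NestedNeighborhoods.
Context {K : topologicalType}.
Hypotheses (Kc : compact [set: K]) (KH : hausdorff_space K).

Lemma compact_regular_nbhs (y : K) (U : set K) : nbhs y U ->
  exists V, [/\ open V, V y & closure V `<=` U].
Proof.
move=> yU.
have h := @compact_regular K y setT KH Kc (@filterT K (nbhs y) (nbhs_filter y)).
have [V yV VU] := h U yU; exists V^°; split.
- exact: open_interior.
- exact: yV.
- by apply: subset_trans VU; apply: closureS; exact: interior_subset.
Qed.

(** Choose open neighbourhoods N_n of y and points x_n of S in N_n such that the closure of N_(n+1)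
    lies in N_n and misses both D_n and x_n. A point of S lies in some D_j, hence off the closure of
    N_(j+1), which contains all W_n with n > j. *)
Lemma nested_nbhs (S : set K) (D : nat -> set K) (y : K) (U : set K) :
  dense S -> (forall n, closed (D n)) -> (forall n, ~ D n y) ->
  S `<=` \bigcup_n D n -> ~ S y -> nbhs y U ->
  exists (x : nat -> K) (W : nat -> set K), [/\
    forall n, S (x n) /\ W n (x n), forall n, open (W n),
    forall n m, n <> m -> W n `&` W m = set0,
    forall n j, (j < n)%N -> ~ D j (x n) &
    (forall z, S z -> exists V m, nbhs z V /\
       forall n, (m <= n)%N -> V `&` W n = set0) /\
    closure (\bigcup_n W n) `<=` U].
Proof.
move=> Sdense Dcl Dy SD Sy yU.
have openB (V F : set K) : open V -> closed F -> open (V `\` F).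
  by move=> Vo Fc; rewrite setDE; apply: openI => //; exact: closed_openC.
have [N0 [N0o N0y N0U]] := compact_regular_nbhs yU.
(* Stated as an implication so that [choice] yields a total function; the pair [(y, V)] is a dummy
   when V is not an open neighbourhood of y. *)
have step (nV : nat * set K) : exists p : K * set K, open nV.2 -> nV.2 y ->
    [/\ S p.1, nV.2 p.1, open p.2, p.2 y & closure p.2 `<=` nV.2 `\` (D nV.1 `|` [set p.1])].
  case: nV => n V; have [[Vo Vy]|nV] := pselect (open V /\ V y); last first.
    by exists (y, V) => /= Vo Vy; case: nV.
  have [x [Vx Sx]] := Sdense V (ex_intro _ y Vy) Vo.
  have o : open (V `\` (D n `|` [set x])).
    apply: openB => //; apply: closedU => //.
    by apply: accessible_closed_set1; exact: hausdorff_accessible.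
  have [|V' [V'o V'y V'cl]] := @compact_regular_nbhs y (V `\` (D n `|` [set x])).
    apply: open_nbhs_nbhs; split=> //; split=> // -[|/= yx]; first exact: Dy.
    by apply: Sy; rewrite yx.
  by exists (x, V').
have [F FP] := choice step.
pose NN := fix nn n := if n is m.+1 then (F (m, nn m)).2 else N0.
have NP n : open (NN n) /\ NN n y.
  by elim: n => [//|n [no ny]]; have [] := FP (n, NN n) no ny.
pose x n := (F (n, NN n)).1.
have xP n : [/\ S (x n), NN n (x n) & closure (NN n.+1) `<=` NN n `\` (D n `|` [set x n])].
  by have [no ny] := NP n; have [] := FP (n, NN n) no ny.
have NS n : NN n.+1 `<=` NN n.
  move=> z /subset_closure zc; have [_ _ /(_ z zc)] := xP n; by case.
have Nle n m : (n <= m)%N -> NN m `<=` NN n.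
  move=> nm; rewrite -(subnKC nm); elim: (m - n)%N => [|k ih]; first by rewrite addn0.
  by rewrite addnS; apply: subset_trans ih; exact: NS.
(* The layers between consecutive neighbourhoods are disjoint, and x_n stays in its layer because
   the next closure avoids it. *)
pose W n := NN n `\` closure (NN n.+1).
have WN n m : (n < m)%N -> forall z, W m z -> closure (NN n.+1) z.
  by move=> nm z [zm _]; apply: subset_closure; exact: Nle nm z zm.
exists x, W; split.
- move=> n; have [Sx Nx cl] := xP n; split=> //; split=> // /cl[_]; apply; right.
  by [].
- move=> n; apply: openB; [by have [] := NP n|exact: closed_closure].
- move=> n m nm; rewrite -subset0 => z [Wn Wm].
  have [lt|lt|e] := ltngtP n m; last exact: nm.
    by case: Wn => _; apply; exact: WN lt _ Wm.
  by case: Wm => _; apply; exact: WN lt _ Wn.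
- move=> n j jn Dj; have [_ Nx _] := xP n; have [_ _ cl] := xP j.
  have := Nle _ _ jn _ Nx => /subset_closure /cl[_]; apply; by left.
split.
- move=> z /SD[j _ Dj]; exists (~` closure (NN j.+1)), j.+1; split.
    apply: open_nbhs_nbhs; split; first by apply: closed_openC; exact: closed_closure.
    by move=> zc; have [_ _ /(_ z zc)[_]] := xP j; apply; left.
  move=> n jn; rewrite -subset0 => w [nw Ww]; apply: nw; exact: WN jn w Ww.
- apply: subset_trans N0U; apply: closureS => z [n _ [zn _]].
  by have := Nle 0%N n (leq0n n) z zn.
Qed.

End NestedNeighborhoods.

Lemma compact_set_type (X : topologicalType) (S D : set X) :
  compact D -> D `<=` S -> compact (set_val @^-1` D : set S).
Proof.
move=> Dc DS F FF FD.
have [x [Dx xcl]] := Dc (set_val @ F) _ FD.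
pose x' : S := exist _ x (mem_set (DS _ Dx)).
exists x'; split=> // A B FA xB.
case: xB => _ [[B' B'o <-] /= B'x sub].
have [z [Az B'z]] : set_val @` A `&` B' !=set0.
  apply: xcl; last by apply: open_nbhs_nbhs; split.
  apply: (@filterS S F _ A) FA => w Aw; by exists w.
by case: Az => w Aw wz; exists w; split=> //; apply: sub; rewrite /= wz.
Qed.

(** * Level sets of fibre norms *)

Section LevelSets.
Context {R : realType} {X : topologicalType} {A : cstarAlgType R}.
Variable mu : c0_algebra X A.
Hypothesis muE : forall f, C0 f -> mu f = dauns_hofmann (f \o base_map mu).
Hypotheses (lcX : locally_compact [set: X]) (hX : hausdorff_space X).

(* the fibre norm of [a] at [x] is less than [e] *)
Definition fibre_lt (a : A) (e : R) (x : X) :=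
  exists2 h, bump_at x h & rnorm (mur mu h a) < e.

Lemma fibre_lt_le a e e' x : e <= e' -> fibre_lt a e x -> fibre_lt a e' x.
Proof. by move=> ee' [h hb he]; exists h => //; exact: lt_le_trans ee'. Qed.

Lemma open_fibre_lt a e : open (fibre_lt a e).
Proof.
rewrite openE => x [h [hC h01 h1] he].
have : \forall y \near x, \forall z \near y, h z = 1 by apply: nbhs_interior.
by apply: filterS => y hy; exists h.
Qed.

(** By nondegeneracy a = mu(f) a' for some f in C0. Where |f| is below e / (|a'| + 1), a bump
    supported nearby makes the norm of a smaller than e, so the level set is a closed part of a
    compact level set of f. *)
Lemma compact_fibre_ge a (e : R) : 0 < e -> compact (~` fibre_lt a e).
Proof.
move=> e0.
have [f fC [a' _ <-]] : [set mu f a | f in @C0 R X & a in [set: A]] a.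
  by rewrite c0_map_nondeg.
have a1 : 0 < rnorm a' + 1 by rewrite ltr_wpDl ?rnorm_ge0.
pose d := e / (rnorm a' + 1); have d0 : 0 < d by rewrite divr_gt0.
have /C0P[fc fK] := fC.
apply: (subclosed_compact _ (fK d d0)).
  by apply: open_closedC; exact: open_fibre_lt.
move=> x; apply: contra_notP => /= /negP; rewrite -ltNge => fx.
have [|h hb hU] := @bump_exists R X x [set z | rnorm (f z) < d] lcX hX.
  have := rnorm_continuous fc (x := x); move=> /cvgrPdist_lt.
  have dx : 0 < d - rnorm (f x) by rewrite subr_gt0.
  move=> /(_ _ dx); apply: filterS => y /=; rewrite ltr_norml => /andP[+ _].
  by lra.
exists h => //; have [hC h01 _] := hb.
have hfC : C0 (cplx h \* f).
  apply: (C0_le _ fC ltr01).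
    by move=> y; apply: cvgM; [exact: cplx_continuous (proj1 hC) y|exact: fc].
  move=> y; rewrite rnormM rnorm_cplx ler_wpM2r ?rnorm_ge0//.
  by have /andP[h0 h1] := h01 y; rewrite ger0_norm.
have -> : mur mu h (mu f a') = mu (cplx h \* f) a'.
  exact: (congr1 (fun m : multiplier A => m a') (esym (c0_mapM mu (proj2 hC) fC))).
apply: (le_lt_trans (rnorm_mulL _ _)).
apply: (@le_lt_trans _ _ (d * rnorm a')).
  rewrite ler_wpM2r ?rnorm_ge0//; apply: c0_map_norm => // y.
  rewrite rnormM rnorm_cplx; have /andP[h0 h1] := h01 y; rewrite ger0_norm//.
  have [fy|fy] := pselect (rnorm (f y) < d); last by rewrite hU// mul0r ltW.
  by rewrite (le_trans _ (ltW fy))// ler_piMl// rnorm_ge0.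
by rewrite /d mulrAC ltr_pdivrMr// mulrDr mulr1 ltrDl.
Qed.

Lemma fibre_ge_XA a (e : R) : 0 < e -> ~` fibre_lt a e `<=` XA mu.
Proof.
move=> e0 x nx; apply: contrapT => xXA; apply: nx.
exact: not_XA_small xXA e0.
Qed.

(** Take P over x and a bump k at x. Then a - k a lies in P, and |k a| <= |a - u_n a| + |k u_n| |a|.
    If all fibre norms of the u_n vanished at x, P would be everything. *)
Lemma XA_fibre_ge (u : nat -> A) x :
  (forall a, u n ** a @[n --> \oo] --> a) -> XA mu x ->
  exists n, exists2 e : R, 0 < e & ~ fibre_lt (u n) e x.
Proof.
move=> ua [P _ Px]; apply: contrapT => nh.
have h n (e : R) : 0 < e -> fibre_lt (u n) e x.
  by move=> e0; apply: contrapT => nl; apply: nh; exists n, e.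
have [a Pa] := prim_proper P; apply: Pa; apply: prim_closed => e e0.
have e20 : 0 < e / 2 by rewrite divr_gt0.
have /cvg_rnormP/(_ _ e20)[n _ /(_ n (leqnn n)) /= un] := ua a.
have a1 : 0 < rnorm a + 1 by rewrite ltr_wpDl ?rnorm_ge0.
have [k kb kn] := h n _ (divr_gt0 e20 a1); have [kC k01 _] := kb.
exists (a - mur mu k a).
  have := murP muE P a kC; rewrite Px (bump1 kb) scale1r => /primN.
  by rewrite opprB.
rewrite opprB addrC subrK.
have -> : mur mu k a = (mur mu k (a - u n ** a)) + mur mu k (u n) ** a.
  by rewrite mulLB mulL_cmul subrK.
apply: (le_lt_trans (rnormD _ _)).
have h1 : rnorm (mur mu k (a - u n ** a)) <= rnorm (a - u n ** a).
  apply: (le_trans (rnorm_mulL _ _)); rewrite ler_piMl ?rnorm_ge0//.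
  exact: mur_norm1.
have h2 : rnorm (mur mu k (u n) ** a) <= e / 2.
  apply: (le_trans (rnorm_cmul _ _)).
  apply: (@le_trans _ _ (e / 2 / (rnorm a + 1) * rnorm a)).
    by rewrite ler_wpM2r ?rnorm_ge0// ltW.
  by rewrite mulrAC ler_pdivrMr// mulrDr mulr1 lerDl ltW.
rewrite rnormC in un; lra.
Qed.

(** Bumps act as contractions, so multiplying by further ones preserves each smallness condition. *)
Lemma common_bump (u : nat -> A) x (e : R) m :
  (forall k, (k < m)%N -> fibre_lt (u k) e x) ->
  exists2 h, bump_at x h & forall k, (k < m)%N -> rnorm (mur mu h (u k)) < e.
Proof.
elim: m => [_|m ih hm].
  by have [h hb _] := @bump_exists R X x setT lcX hX (@filterT _ (nbhs x) _); exists h.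
have [h hb hu] := ih (fun k km => hm k (ltnW km)).
have [k kb ku] := hm m (ltnSn m).
exists (fun y => h y * k y); first exact: bumpM.
have [hC h01 _] := hb; have [kC k01 _] := kb.
have le1 (g : X -> R) (c : A) : C0r g -> (forall y, 0 <= g y <= 1) ->
    rnorm (mur mu g c) <= rnorm c.
  move=> gC g01; apply: (le_trans (rnorm_mulL _ _)).
  by rewrite ler_piMl ?rnorm_ge0// mur_norm1.
move=> i; rewrite ltnS leq_eqVlt => /orP[/eqP ->|im].
  by rewrite murM//; exact: le_lt_trans (le1 _ _ hC h01) ku.
rewrite murM// mur_central//; exact: le_lt_trans (le1 _ _ kC k01) (hu i im).
Qed.

End LevelSets.

(** * Strictly convergent orthogonal sums *)

Section CentralMultipliers.
Context {R : realType} {A : cstarAlgType R}.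
Implicit Types (a b : A) (z : multiplier A).

Lemma mult_ofD a b : mult_of (a + b) = mult_of a + mult_of b.
Proof. by have := mult_of_linear 1 a b; rewrite !scale1r. Qed.

Lemma mult_of0 : mult_of 0 = 0 :> multiplier A.
Proof. by apply: multiplier_extL => a /=; rewrite cmul0l. Qed.

Lemma mulR_central z a : ZM z -> mulR z a = z a.
Proof.
move=> zc; apply/eqP; rewrite -subr_eq0; apply/eqP/cmul_faithful => b.
rewrite cmulBl; have := zc (mult_of a); rewrite mul_mult_of mult_of_mul.
by move=> /(congr1 (fun m : multiplier A => m b)) /= ->; rewrite subrr.
Qed.

Lemma cmul_central z a b : ZM z -> a ** z b = z (a ** b).
Proof. by move=> zc; rewrite mulLR mulR_central// mulL_cmul. Qed.

End CentralMultipliers.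

Section OrthogonalSum.
Context {R : realType} {X : topologicalType} {A : cstarAlgType R}.
Variable mu : c0_algebra X A.
Hypothesis muE : forall f, C0 f -> mu f = dauns_hofmann (f \o base_map mu).
Local Notation M := (multiplier A).
Variables (u : nat -> A) (h : nat -> X -> R) (d : nat -> A).
Hypotheses (u_unit : forall a, u n ** a @[n --> \oo] --> a)
  (unit_u : forall a, a ** u n @[n --> \oo] --> a)
  (hC : forall n, C0r (h n)) (h01 : forall n x, 0 <= h n x <= 1)
  (h_orth : forall n m (P : prim A), n <> m ->
     h n (base_map mu P) * h m (base_map mu P) = 0)
  (d_le1 : forall n, rnorm (d n) <= 1)
  (h_decay : forall k n, (k.+1 < n)%N -> rnorm (mur mu (h n) (u k)) <= 2^-1 ^+ n).

Definition orth_sum N : A := \sum_(n < N) mur mu (h n) (d n).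

Lemma orth_sumS N : orth_sum N.+1 = orth_sum N + mur mu (h N) (d N).
Proof. by rewrite /orth_sum big_ord_recr. Qed.

Let zc n : ZM (mur mu (h n)).
Proof. by move=> m; exact: mur_central. Qed.

Let hh n x := h n x * h n x.

Let hhC n : C0r (hh n).
Proof. by apply: C0rM => //; have [] := hC n. Qed.

Let sq_sum N x : R := \sum_(n < N) hh n x.

Let sq_sumS N : sq_sum N.+1 = fun x => sq_sum N x + hh N x.
Proof. by apply/funext => x; rewrite /sq_sum big_ord_recr. Qed.

Let sq_sum0 : sq_sum 0 = fun=> 0.
Proof. by apply/funext => x; rewrite /sq_sum big_ord0. Qed.

Let sq_sumC N : C0r (sq_sum N).
Proof.
elim: N => [|N ih]; first by rewrite sq_sum0; exact: C0r0.
by rewrite sq_sumS; exact: C0rD.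
Qed.

Let sq_sum_ge0 N x : 0 <= sq_sum N x.
Proof.
apply: sumr_ge0 => n _; have /andP[? _] := h01 n x; exact: mulr_ge0.
Qed.

Let sq_sum_le1 N (P : prim A) : sq_sum N (base_map mu P) <= 1.
Proof.
elim: N => [|N ih]; first by rewrite sq_sum0.
rewrite sq_sumS; set x := base_map mu P in ih *.
have /andP[h0 h1] := h01 N x.
have [hN|hN] := eqVneq (h N x) 0; first by rewrite /hh hN mul0r addr0.
rewrite [sq_sum N x]big1 ?add0r ?mulr_ile1// => n _.
have nN : (n : nat) <> N by move=> nN; have := ltn_ord n; rewrite nN ltnn.
have /eqP := h_orth P nN; rewrite -/x mulf_eq0 (negPf hN) orbF => /eqP hn.
by rewrite /hh hn mul0r.
Qed.

(* the summands have orthogonal supports, so the square norm of the sum is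
   dominated by that of the cut-off functions *)
Lemma rnorm_orth_sum N : rnorm (orth_sum N) <= 1.
Proof.
pose S n : M := mult_of (orth_sum n).
pose T n : M := mur mu (h n) * mult_of (d n).
have SS n : S n.+1 = S n + T n by rewrite /S orth_sumS mult_ofD -mul_mult_of.
have S0 : S 0%N = 0 by rewrite /S /orth_sum big_ord0 mult_of0.
have murh n m : n <> m -> mur mu (h n) * mur mu (h m) = 0.
  move=> nm; rewrite -murM// -(mur0 mu); apply: mur_eq => //.
  - by apply: C0rM => //; have [] := hC m.
  - exact: C0r0.
  - by move=> P; exact: h_orth.
have TT n m : n <> m -> cstar (T n) * T m = 0.
  move=> nm; rewrite /T mstar_mul mur_sa// -mulrA [mur mu (h n) * _]mulrA murh//.
  by rewrite mul0r mulr0.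
have ST n m : (n <= m)%N -> cstar (S n) * T m = 0.
  elim: n => [|n ih] nm; first by rewrite S0 cstar0 mul0r.
  rewrite SS cstarD mulrDl ih ?(ltnW nm)// add0r TT// => e.
  by rewrite e ltnn in nm.
have TS n m : (n <= m)%N -> cstar (T m) * S n = 0.
  by move=> nm; have := congr1 cstar (ST n m nm); rewrite mstar_mul cstarK cstar0.
have Tsq n : mpos (mur mu (hh n) - cstar (T n) * T n).
  have -> : mur mu (hh n) - cstar (T n) * T n =
      mur mu (hh n) * (1 - cstar (mult_of (d n)) * mult_of (d n)).
    rewrite mulrBr mulr1 /T mstar_mul mur_sa// murM//; congr (_ - _).
    rewrite -(mur_central mu (cstar (mult_of (d n))) (hC n)) -!mulrA.
    congr (_ * _); rewrite !mulrA; congr (_ * _).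
    by rewrite (mur_central mu (cstar (mult_of (d n))) (hC n)).
  apply: mposM; last exact: mur_central.
    by apply: mur_pos => // x; have /andP[? _] := h01 n x; exact: mulr_ge0.
  rewrite -[1]scale1r; apply: mpos_bound; first by rewrite mstar_mul cstarK.
  by rewrite rnorm_star_mul rnorm_mult_of expr_le1// rnorm_ge0.
have Ssq n : mpos (mur mu (sq_sum n) - cstar (S n) * S n).
  elim: n => [|n ih].
    rewrite S0 mulr0 subr0; apply: mur_pos => // x; exact: sq_sum_ge0.
  rewrite sq_sumS murD// SS cstarD mulrDl !mulrDr ST// TS// addr0 add0r.
  by rewrite opprD addrACA; exact: mposD.
rewrite -rnorm_mult_of -/(S N) -(@ler_pXn2r _ 2)// ?nnegrE ?rnorm_ge0// expr1n.
rewrite -rnorm_star_mul; apply: mpos_le_norm => //; first exact: mpos_star_mul.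
rewrite scale1r -[1](subrK (mur mu (sq_sum N))) -addrA.
by apply: mposD => //; exact: mur_le1.
Qed.

(** The right-hand side is the geometric sum of 2^-(n+i) over i < j. Since cut-offs are central,
    each factor h_i can be moved from d_i to u_k, where [h_decay] applies. *)
Let tail k n j : (k.+1 < n)%N ->
  rnorm ((orth_sum (n + j) - orth_sum n) ** u k) <= 2 * 2^-1 ^+ n * (1 - 2^-1 ^+ j) /\
  rnorm (u k ** (orth_sum (n + j) - orth_sum n)) <= 2 * 2^-1 ^+ n * (1 - 2^-1 ^+ j).
Proof.
move=> kn; elim: j => [|j [ih1 ih2]].
  by rewrite addn0 subrr cmul0l cmul0r rnorm0 expr0 subrr mulr0.
have kn' : (k.+1 < n + j)%N by exact: leq_trans kn (leq_addr _ _).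
have -> : orth_sum (n + j.+1) - orth_sum n =
    (orth_sum (n + j) - orth_sum n) + mur mu (h (n + j)) (d (n + j)).
  by rewrite addnS orth_sumS; zmod.
have E : 2 * 2^-1 ^+ n * (1 - 2^-1 ^+ j.+1) =
    2 * 2^-1 ^+ n * (1 - 2^-1 ^+ j) + 2^-1 ^+ (n + j) :> R.
  by rewrite exprS exprD; field.
have dk := h_decay kn'; have d1 := d_le1 (n + j).
rewrite E cmulDl cmulDr; split.
  apply: (le_trans (rnormD _ _)); apply: lerD => //.
  rewrite -mulL_cmul -cmul_central; last exact: zc.
  apply: (le_trans (rnorm_cmul _ _)).
  by rewrite -[leRHS]mul1r ler_pM ?rnorm_ge0.
apply: (le_trans (rnormD _ _)); apply: lerD => //.
rewrite cmul_central; last exact: zc.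
rewrite mulL_cmul; apply: (le_trans (rnorm_cmul _ _)).
by rewrite -[leRHS]mulr1 ler_pM ?rnorm_ge0.
Qed.

(** The tails are controlled only against the u_k. A general a is replaced by u_k a or a u_k, and
    the uniform norm bound of the partial sums absorbs the error. *)
Lemma orth_sum_strict : exists m : M,
  (forall a, orth_sum N ** a @[N --> \oo] --> m a) /\
  (forall a, a ** orth_sum N @[N --> \oo] --> mulR m a).
Proof.
have diff2 N n : rnorm (orth_sum N - orth_sum n) <= 2.
  have := rnormB (orth_sum N) (orth_sum n).
  by have := rnorm_orth_sum N; have := rnorm_orth_sum n; lra.
have cauchy a (e : R) : 0 < e -> exists n, forall N, (n <= N)%N ->
    rnorm ((orth_sum N - orth_sum n) ** a) < e /\
    rnorm (a ** (orth_sum N - orth_sum n)) < e.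
  move=> e0; have e40 : 0 < e / 4 by rewrite divr_gt0.
  have e20 : 0 < e / 2 by rewrite divr_gt0.
  have /cvg_rnormP/(_ _ e40) h1 := @u_unit a.
  have /cvg_rnormP/(_ _ e40) h2 := @unit_u a.
  have [k [k1 k2]] := filter_ex (filterI h1 h2).
  have a1 : 0 < 2 * (rnorm a + 1) by rewrite mulr_gt0// ltr_wpDl ?rnorm_ge0.
  have [n1 hn1] := expr_half_small (divr_gt0 e20 a1).
  pose n := maxn n1 k.+2.
  exists n => N nN; rewrite -(subnKC nN).
  have kn : (k.+1 < n)%N by rewrite leq_max leqnn orbT.
  have [t1 t2] := tail (N - n) kn.
  have t3 : 2 * 2^-1 ^+ n * (1 - 2^-1 ^+ (N - n)) * rnorm a <= e / 2.
    have := hn1 n (leq_maxl _ _); rewrite ltr_pdivlMr// => hn.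
    have p0 : 0 <= 2^-1 ^+ n :> R by rewrite exprn_ge0// invr_ge0.
    have q0 : 0 <= 2^-1 ^+ (N - n) :> R by rewrite exprn_ge0// invr_ge0.
    apply: (@le_trans _ _ (2 * 2^-1 ^+ n * 1 * rnorm a)).
      by rewrite ler_wpM2r ?rnorm_ge0// ler_wpM2l ?mulr_ge0// gerBl.
    by move: (2^-1 ^+ n) hn p0 => p; lra.
  set w := orth_sum _ - orth_sum n in t1 t2 *.
  have w2 : rnorm w <= 2 by exact: diff2.
  have r0 := rnorm_ge0 a.
  split.
    have -> : w ** a = w ** u k ** a - w ** (u k ** a - a).
      by rewrite cmulBr cmulA; zmod.
    apply: (le_lt_trans (rnormB _ _)).
    have s1 : rnorm (w ** u k ** a) <= e / 2.
      apply: (le_trans (rnorm_cmul _ _)); apply: le_trans t3.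
      by rewrite ler_wpM2r.
    have s2 : rnorm (w ** (u k ** a - a)) <= 2 * rnorm (u k ** a - a).
      by apply: (le_trans (rnorm_cmul _ _)); rewrite ler_wpM2r ?rnorm_ge0.
    move: k1 => /= k1; lra.
  have -> : a ** w = a ** (u k ** w) - (a ** u k - a) ** w.
    by rewrite cmulBl cmulA; zmod.
  apply: (le_lt_trans (rnormB _ _)).
  have s1 : rnorm (a ** (u k ** w)) <= e / 2.
    apply: (le_trans (rnorm_cmul _ _)); apply: le_trans t3.
    by rewrite mulrC ler_wpM2r.
  have s2 : rnorm ((a ** u k - a) ** w) <= 2 * rnorm (a ** u k - a).
    by apply: (le_trans (rnorm_cmul _ _)); rewrite mulrC ler_wpM2r ?rnorm_ge0.
  move: k2 => /= k2; lra.
have [|a|a|m [mL mR _]] := @strict_limit R A nat \oo _ (fun N => mult_of (orth_sum N)) 1.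
- by apply: nearW => N; rewrite rnorm_mult_of; exact: rnorm_orth_sum.
- apply: rnorm_cauchy_filter => e e0; have [n hn] := cauchy a e e0.
  exists (orth_sum n ** a); exists n => // N nN /=.
  by rewrite -cmulBl; have [] := hn N nN.
- apply: rnorm_cauchy_filter => e e0; have [n hn] := cauchy a e e0.
  exists (a ** orth_sum n); exists n => // N nN /=.
  by rewrite -cmulBr; have [] := hn N nN.
by exists m.
Qed.

End OrthogonalSum.

(** * Distance to a primitive ideal, and ideals attached to Stone-Cech points *)

Section PrimitiveDistance.
Context {R : realType} {A : cstarAlgType R}.
Implicit Types (P : prim A) (a c : A).

(** As in Riesz's lemma, normalize a - j0 with |a - j0| less than twice the distance of a to P. The
    resulting unit vector c has distance at least 1/2, and some u_k c is within 1/4 of it. *)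
Lemma prim_distant (u : nat -> A) P : (forall a, u n ** a @[n --> \oo] --> a) ->
  exists c k, rnorm c <= 1 /\ forall j, P j -> 4^-1 <= rnorm (u k ** c - j).
Proof.
move=> u_unit; have [a Pa] := prim_proper P.
pose D := [set rnorm (a - j) | j in (P : A -> Prop)].
have Dinf : has_inf D.
  split; first by exists (rnorm (a - 0)), 0 => //; exact: prim0.
  by exists 0 => _ [j _ <-]; exact: rnorm_ge0.
have Dle j : P j -> inf D <= rnorm (a - j).
  by move=> Pj; apply: (ge_inf (proj2 Dinf)); exists j.
have D0 : 0 < inf D.
  rewrite ltNge; apply/negP => D0; apply: Pa; apply: prim_closed => e e0.
  have [_ [j Pj <-] je] := inf_adherent e0 Dinf; exists j => //.
  by apply: (lt_le_trans je); lra.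
have [_ [j0 Pj0 <-] j0D] := inf_adherent D0 Dinf.
set r := rnorm (a - j0) in j0D.
have r0 : 0 < r by rewrite (lt_le_trans D0)// Dle.
pose c : A := r^-1%:C *: (a - j0).
have c1 : rnorm c = 1 by rewrite /c rnormZr gtr0_norm ?invr_gt0// mulVf// gt_eqF.
have cD j : P j -> 2^-1 <= rnorm (c - j).
  move=> Pj; have -> : c - j = r^-1%:C *: (a - (j0 + r%:C *: j)).
    rewrite /c opprD addrA [in RHS]scalerDr scalerN scalerA -rmorphM mulVf ?gt_eqF//.
    by rewrite scale1r.
  rewrite rnormZr gtr0_norm ?invr_gt0// mulrC ler_pdivlMr//.
  apply: (@le_trans _ _ (inf D)); first by lra.
  by apply: Dle; apply: primD => //; exact: primZ.
have e0 : 0 < 4^-1 :> R by rewrite invr_gt0.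
have /cvg_rnormP/(_ _ e0)[k _ /(_ k (leqnn k)) /= kc] := @u_unit c.
exists c, k; rewrite c1; split=> // j Pj.
have := cD j Pj; have := rnormD (u k ** c - j) (c - u k ** c).
rewrite (_ : u k ** c - j + (c - u k ** c) = c - j); last by zmod.
by rewrite rnormC in kc; lra.
Qed.

End PrimitiveDistance.

Section StoneCechAction.
Context {R : realType} {X : topologicalType} {A : cstarAlgType R}.
Variable mu : c0_algebra X A.
Hypothesis muE : forall f, C0 f -> mu f = dauns_hofmann (f \o base_map mu).

(** The extension is the coordinate of index f in the product that defines [stone_cech]. *)
Lemma Cb_extension (f : X -> R[i]) : Cb f ->
  exists2 F : stone_cech X -> R[i], continuous F & F \o @to_stone_cech R X = f.
Proof.
move=> fb; pose i : @Cb R X := exist _ f (mem_set fb).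
pose Y := prod_topology (fun _ : @Cb R X => R[i] : topologicalType).
have c1 : continuous (set_val : stone_cech X -> Y) by exact: initial_continuous.
have c2 : continuous (fun v : Y => v i : R[i]) by exact: proj_continuous.
exists (fun w => (set_val w : Y) i); last by [].
by move=> w; exact: (continuous_comp (c1 w) (c2 _)).
Qed.

(** From g m = 0 follows m = (1 - g) m, and 1 - g extends continuously to the Stone-Cech
    compactification with value 0 at x. Uniqueness identifies the multiplier of this extension with
    1 - [mur mu g]. *)
Lemma H_mem (x : X) (g : X -> R) (m : multiplier A) : C0r g ->
  (forall y, 0 <= g y <= 1) -> g x = 1 -> mur mu g * m = 0 ->
  H_ mu (to_stone_cech x) m.
Proof.
move=> gC g01 gx gm.
have [gc _] := gC.
have fb : Cb (cplx (fun y => 1 - g y)).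
  split.
    apply: cplx_continuous => y; apply: cvgB; [exact: cvg_cst|exact: gc].
  exists 1 => y; rewrite rnormE rnorm_cplx lecR.
  by have /andP[? ?] := g01 y; rewrite ger0_norm ?subr_ge0// gerBl.
have [F Fc FE] := Cb_extension fb.
exists F; first split=> //.
  by have := congr1 (fun f => f x) FE; rewrite /= => ->; rewrite /cplx gx subrr.
exists m => //.
rewrite /mu_MA FE (_ : dauns_hofmann _ = 1 - mur mu g).
  by rewrite mulrBl mul1r gm subr0.
apply: dauns_hofmann_unique; split.
  by move=> n; rewrite mulrBl mulrBr mul1r mulr1 mur_central.
move=> P a; rewrite /= /cplx rmorphB scalerBl scaleN1r scale1r.
have -> : a - mur mu g a - (a - (g (base_map mu P))%:C *: a) =
    - (mur mu g a - (g (base_map mu P))%:C *: a) by zmod.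
by apply: primN; exact: murP.
Qed.

Lemma Abeta0 : Abeta mu 0.
Proof.
move=> x _; exists 0; first by exists 0 => //; exact: mult_of0.
exists 0; last by rewrite addr0.
exists (fun=> 0); first by split=> // w; exact: cst_continuous.
by exists 0 => //; rewrite mulr0.
Qed.

Lemma Abeta_fibre_neq0 (K : topologicalType) (iota : XA mu -> K) (y : K) b :
  Abeta mu b -> ~ Abeta_ideal iota y b ->
  Abeta_fibre iota y <> zero_add_quotient (Abeta_ideal iota y).
Proof.
move=> bA bI fE; apply: bI.
have I0 : Abeta_ideal iota y 0.
  exists (fun=> 0); first by split=> // w; exact: cst_continuous.
  by exists 0; [exact: Abeta0|rewrite /mu_Abeta mulr0].
have : Abeta_fibre iota y (add_coset (Abeta_ideal iota y) b) by exists b.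
rewrite fE => bE.
have : add_coset (Abeta_ideal iota y) b b by exists 0; rewrite ?addr0.
by rewrite bE => -[j Ij <-]; rewrite add0r.
Qed.

End StoneCechAction.

Section ConstantBaseMap.
Context {R : realType} {X : topologicalType} {A : cstarAlgType R}.
Variables (mu : c0_algebra X A) (K : topologicalType) (iota : XA mu -> K).

(** A constant base map leaves at most one point in [XA]; its image is closed and dense, hence all
    of K. *)
Lemma compactification_point : compactification iota ->
  (forall P Q, base_map mu P = base_map mu Q) -> range iota = setT.
Proof.
move=> [_ KH _ _ dns] bE; apply/seteqP; split=> // y _.
have [_ [_ [p _ _]]] := dns setT (ex_intro _ y I) openT.
have pE q : q = p.
  apply: val_inj; have [P _ <-] := set_mem (valP p).
  by have [Q _ <-] := set_mem (valP q).
have cl : closed [set iota p].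
  by apply: accessible_closed_set1; exact: hausdorff_accessible.
apply: contrapT => ny.
have [|z [/= zp [q _ qz]]] := dns (~` [set iota p]) _ (closed_openC cl).
  by exists y => /= yp; apply: ny; exists p.
by apply: zp; rewrite -qz (pE q).
Qed.

End ConstantBaseMap.

(** * Density of the nonzero fibres in the remainder *)

Theorem theorem5p8 (R : realType) (X : topologicalType) (A : cstarAlgType R)
  (mu : c0_algebra X A) (K : topologicalType) (iota : XA mu -> K)
  (lcX : locally_compact [set: X]) (hX : hausdorff_space X)
  (sA : sigma_unital A) (cK : compactification iota) :
  ~` range iota `<=`
  closure [set y | (~` range iota) y /\
    Abeta_fibre iota y <> zero_add_quotient (Abeta_ideal iota y)].
Proof.
(* With the default base map, K is the image of [XA] and the remainder is empty. *)
have [muE|bE] := base_map_cases mu; last first.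
  by rewrite (compactification_point cK bE) setCT => y [].
have [Kc KH iota_inj iota_emb iota_dense] := cK.
have [u [u1 _ u_unit2]] := sA.
have u_le1 n : rnorm (u n) <= 1 by have [_] := u1 n; rewrite rnormE lecR.
have u_unit a : u n ** a @[n --> \oo] --> a by have [] := u_unit2 a.
have unit_u a : a ** u n @[n --> \oo] --> a by have [] := u_unit2 a.
have iota_cont : continuous iota.
  apply/continuousP => B Bo; apply/iota_emb; by exists B.
move=> y0 y0S U yU.
(* Tests and accuracy grow together: a point where u_k has fibre norm at least e belongs to E_n as
   soon as n > k and 2^-(n+1) <= e, while a point off E_n makes u_0, ..., u_(n-1) small
   simultaneously. *)
pose E n := [set x | exists2 k, (k < n)%N & ~ fibre_lt mu (u k) (2^-1 ^+ n.+1) x].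
have half0 n : 0 < 2^-1 ^+ n :> R by rewrite exprn_gt0// invr_gt0.
have EXA n : E n `<=` XA mu.
  by move=> x [k _ kx]; exact: (fibre_ge_XA muE lcX hX (half0 n.+1)) kx.
have Ec n : compact (E n).
  have -> : E n = \big[setU/set0]_(k < n) (~` fibre_lt mu (u k) (2^-1 ^+ n.+1)).
    rewrite -(bigcup_mkord n (fun k => ~` fibre_lt mu (u k) (2^-1 ^+ n.+1))).
    by apply/seteqP; split=> x [k kn kx]; exists k.
  by apply: bigsetU_compact => k _; exact: compact_fibre_ge.
pose D n := iota @` (set_val @^-1` E n).
have Dcl n : closed (D n).
  apply: compact_closed => //; apply: continuous_compact.
    by apply: continuous_subspaceT; exact: iota_cont.
  by apply: compact_set_type; [exact: Ec|exact: EXA].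
have Dy n : ~ D n y0 by move=> [p _ py]; apply: y0S; exists p.
have SD : range iota `<=` \bigcup_n D n.
  move=> _ [p _ <-]; have pX : XA mu (set_val p) by case: p => x xX; exact: set_mem.
  have [k [e e0 ke]] := XA_fibre_ge muE u_unit pX.
  have [N hN] := expr_half_small e0.
  exists (maxn N k.+1) => //; exists p => //; exists k; first by rewrite leq_max leqnn orbT.
  move=> kl; apply: ke; apply: fibre_lt_le kl; rewrite ltW// hN//.
  by rewrite (leq_trans (leq_maxl N k.+1))//.
have [x [W [SW Wo Wdisj xD [Wloc WU]]]] := nested_nbhs Kc KH iota_dense Dcl Dy SD y0S yU.
have {}SW n : exists pP : XA mu * prim A,
    [/\ iota pP.1 = x n, W n (x n) & base_map mu pP.2 = set_val pP.1].
  have [[p _ px] Wx] := SW n.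
  have [P _ Pp] : XA mu (set_val p) by case: p {px} => z zX; exact: set_mem.
  by exists (p, P).
have [pP pPx] := choice SW.
pose p n := (pP n).1; pose P n := (pP n).2.
have px n : iota (p n) = x n by have [] := pPx n.
have Wx n : W n (x n) by have [] := pPx n.
have Pp n : base_map mu (P n) = set_val (p n) by have [] := pPx n.
(* The W_n live in K and the bumps on X; the common topology of [XA] translates between them, which
   suffices because bumps matter only at base points. *)
have openX (V : set K) : open V -> exists2 G : set X, open G &
    forall q : XA mu, G (set_val q) <-> V (iota q).
  move=> Vo; have : open (iota @^-1` V) by apply/iota_emb; exists V.
  move=> [G Go GE]; exists G => // q.
  by rewrite -[V (iota q)]/((iota @^-1` V) q) -GE.
have hex n : exists h, [/\ bump_at (set_val (p n)) h,
    forall Q : prim A, h (base_map mu Q) <> 0 -> W n (iota (base_mapXA mu Q)) &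
    forall k, (k.+1 < n)%N -> rnorm (mur mu h (u k)) <= 2^-1 ^+ n].
  have [G Go OW] := openX _ (Wo n).
  have pO : nbhs (set_val (p n)) G.
    by apply: open_nbhs_nbhs; split=> //; apply/OW; rewrite px.
  have [h1 h1b h1O] := bump_exists (R := R) lcX hX pO.
  (* The point x_n avoids D_j for j < n only, so E_(n-1) is used: it tests u_k for k < n - 1 at
     level 2^-n. This is the origin of the condition k + 1 < n. *)
  have [|h2 h2b h2u] := @common_bump _ _ _ mu muE lcX hX u (set_val (p n)) (2^-1 ^+ n) n.-1.
    move=> k kn; apply: contrapT => nk.
    have n0 : (0 < n)%N by case: (n) kn.
    have nn : (n.-1 < n)%N by rewrite ltn_predL.
    apply: (xD n n.-1 nn); exists (p n) => //; exists k => //.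
    by rewrite prednK.
  exists (fun z => h1 z * h2 z); split; first exact: bumpM.
    move=> Q hQ; apply/OW; apply: contrapT => nO; apply: hQ.
    by rewrite h1O ?mul0r.
  have [h1C h101 _] := h1b; have [h2C _ _] := h2b.
  move=> k kn; have kn' : (k < n.-1)%N by case: (n) kn.
  rewrite murM//; apply: (le_trans (rnorm_mulL (mur mu h1) (mur mu h2 (u k)))).
  apply: (@le_trans _ _ (1 * rnorm (mur mu h2 (u k)))); last by rewrite mul1r ltW// h2u.
  by rewrite ler_wpM2r ?rnorm_ge0//; exact: mur_norm1.
have [h hP] := choice hex.
have hC n : C0r (h n) by have [[]] := hP n.
have h01 n z : 0 <= h n z <= 1 by have [[]] := hP n.
have hp n : h n (set_val (p n)) = 1 by have [hb _ _] := hP n; exact: bump1 hb.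
have h_orth n m (Q : prim A) : n <> m -> h n (base_map mu Q) * h m (base_map mu Q) = 0.
  move=> nm; apply/eqP; apply: contraT; rewrite mulf_eq0 => /norP[/eqP hn /eqP hm].
  have [_ /(_ _ hn) Wn _] := hP n; have [_ /(_ _ hm) Wm _] := hP m.
  by have := Wdisj _ _ nm; rewrite -subset0 => /(_ _ (conj Wn Wm)).
have ckex n : exists ck : A * nat, rnorm ck.1 <= 1 /\
    forall j, P n j -> 4^-1 <= rnorm (u ck.2 ** ck.1 - j).
  by have [c [k ckn]] := prim_distant (P n) u_unit; exists (c, k).
have [ck ckP] := choice ckex.
pose c n := (ck n).1; pose d n := u (ck n).2.
have c1 n : rnorm (c n) <= 1 by have [] := ckP n.
have dc n j : P n j -> 4^-1 <= rnorm (d n ** c n - j) by have [_] := ckP n; apply.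
have d1 n : rnorm (d n) <= 1 by exact: u_le1.
have h_decay k n : (k.+1 < n)%N -> rnorm (mur mu (h n) (u k)) <= 2^-1 ^+ n.
  by have [_ _] := hP n; apply.
have [b [bL bR]] := orth_sum_strict muE u_unit unit_u hC h01 h_orth d1 h_decay.
(* At x_n the cut-off h_n equals 1 and the others vanish, so modulo P_n every partial sum of index
   above n acts as d_n. Closedness of P_n passes this to b. *)
have bP n : P n (b (c n) - d n ** c n).
  apply: prim_closed => e e0; have /cvg_rnormP/(_ _ e0)[N _ hN] := bL (c n).
  pose m := maxn N n.+1.
  exists (orth_sum mu h d m ** c n - d n ** c n); last first.
    rewrite (_ : _ - _ = b (c n) - orth_sum mu h d m ** c n); last by zmod.
    by rewrite rnormC; apply: (hN m); rewrite /= leq_maxl.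
  have nm : (n < m)%N by rewrite leq_max leqnn orbT.
  rewrite -cmulBl; apply: primMr.
  rewrite /orth_sum (bigD1 (Ordinal nm))//= addrAC.
  apply: primD.
    by have := murP muE (P n) (d n) (hC n); rewrite Pp hp scale1r.
  apply: (big_ind (fun a : A => P n a)); [exact: prim0|by move=> ? ?; exact: primD|].
  move=> i ni; have := murP muE (P n) (d i) (hC i).
  have -> : h i (base_map mu (P n)) = 0; last by rewrite scale0r subr0.
  have ni' : (i : nat) <> n by move=> en; move/negP: ni; apply; apply/eqP/val_inj.
  by have := h_orth i n (P n) ni'; rewrite !Pp hp mulr1.
have localize (x0 : XA mu) : exists g m, [/\ C0r g, forall z, 0 <= g z <= 1,
    g (set_val x0) = 1 & forall n (Q : prim A), (m <= n)%N ->
      g (base_map mu Q) * h n (base_map mu Q) = 0].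
  have [V [m [Vn VW]]] := Wloc (iota x0) (imageT iota x0).
  have [G Go OV] := openX _ (open_interior V).
  have xO : nbhs (set_val x0) G.
    by apply: open_nbhs_nbhs; split=> //; apply/OV; exact: Vn.
  have [g [gC g01 g1] gO] := bump_exists (R := R) lcX hX xO.
  exists g, m; split=> //; first exact: (nbhs_singleton g1).
  move=> n Q mn; have [//|gQ] := eqVneq (g (base_map mu Q)) 0.
    by move=> ->; rewrite mul0r.
  have OQ : G (base_map mu Q).
    by apply: contrapT => nO; move/eqP: gQ; apply; exact: gO.
  have VQ : V (iota (base_mapXA mu Q)) by apply: interior_subset; apply/OV.
  have [hQ|/eqP hQ] := eqVneq (h n (base_map mu Q)) 0; first by rewrite hQ mulr0.
  have [_ /(_ _ hQ) WQ _] := hP n.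
  by have := VW n mn; rewrite -subset0 => /(_ _ (conj VQ WQ)).
have bA : Abeta mu b.
  move=> z zX; pose x0 : XA mu := exist _ z (mem_set zX).
  have [g [m [gC g01 gx gh]]] := localize x0.
  (* The function g kills all summands of index at least m, so b differs from the m-th partial sum,
     an element of A, by something annihilated by g. *)
  exists (mult_of (orth_sum mu h d m)); first by exists (orth_sum mu h d m).
  exists (b - mult_of (orth_sum mu h d m)); last by rewrite addrC subrK.
  apply: (H_mem muE gC g01 gx).
  apply: multiplier_extL => a.
  have gS N : (m <= N)%N -> mur mu g ((orth_sum mu h d N - orth_sum mu h d m) ** a) = 0.
    elim: N => [|N IH]; first by rewrite leqn0 => /eqP ->; rewrite subrr cmul0l mulL0.
    rewrite leq_eqVlt => /predU1P[->|mN]; first by rewrite subrr cmul0l mulL0.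
    rewrite orth_sumS addrAC cmulDl mulLD (IH mN) add0r mulL_cmul.
    rewrite -[mur mu g _]/((mur mu g * mur mu (h N)) (d N)) -murM//.
    rewrite (mur_eq muE (C0rM gC (h01 N) (proj1 (hC N))) (@C0r0 R X) _) ?mur0 ?cmul0l// => Q.
    exact: gh.
  rewrite -[LHS]/(mur mu g (b a + -1 *: (orth_sum mu h d m ** a))) scaleN1r.
  have gb : mur mu g ((orth_sum mu h d N - orth_sum mu h d m) ** a) @[N --> \oo] -->
      mur mu g (b a - orth_sum mu h d m ** a).
    have Sb : (orth_sum mu h d N - orth_sum mu h d m) ** a @[N --> \oo] -->
        b a - orth_sum mu h d m ** a.
      under eq_fun do rewrite cmulBl.
      by apply: cvgB; [exact: bL|exact: cvg_cst].
    exact: (cvg_comp _ _ Sb (@mulL_continuous _ _ (mur mu g) _)).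
  apply: rnorm_eq0; apply/eqP; rewrite eq_le rnorm_ge0 andbT.
  apply: (cvg_rnorm_le _ gb).
  by exists m => // N mN; rewrite gS// rnorm0.
have [y1 [_ y1cl]] := Kc (x @ \oo) _ filterT.
(* A point of [XA] has a neighbourhood that meets only finitely many W_n, so it is not a cluster
   point of the x_n. *)
have y1S : ~ range iota y1.
  move=> /Wloc[V [m [Vn VW]]].
  have xm : (x @ \oo) [set x n | n in [set n | (m <= n)%N]].
    by exists m => // n mn; exists n.
  have [_ [[n mn <-] Vx]] := y1cl _ _ xm Vn.
  by have := VW n mn; rewrite -subset0 => /(_ _ (conj Vx (Wx n))).
exists y1; split; last first.
  apply: WU => B By1.
  have xW : (x @ \oo) (\bigcup_n W n) by exists 0 => // n _; exists n.
  by have := y1cl _ _ xW By1.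
split=> //; apply: (Abeta_fibre_neq0 bA).
move=> [f [fc fy1] [b' _ bE]].
(* Modulo P_n, b c_n is congruent to d_n c_n as well as to f(x_n) b' c_n, while d_n c_n stays at
   distance 1/4 from P_n and |c_n| <= 1. *)
have key n : 4^-1 <= rnorm (f (x n)) * rnorm b'.
  pose k := (f \o iota \o base_mapXA mu) (P n).
  have kx : k = f (x n).
    rewrite /k /= -(px n); congr (f (iota _)); apply: val_inj; exact: Pp.
  (* If the choice fell back to 0, then b = 0 and d_n c_n itself would lie in P_n, against its
     distance from P_n. *)
  have [DE|[_ DE]] := dauns_hofmannP (f \o iota \o base_mapXA mu).
    have b0 : b = 0 by rewrite -bE /mu_Abeta DE mul0r.
    have := bP n; rewrite b0 => /primN; rewrite opprB subr0 => /(dc n).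
    rewrite subrr rnorm0 => /le_trans; apply; exact: mulr_ge0 (rnorm_ge0 _) (rnorm_ge0 _).
  have kb : P n (b (c n) - k *: b' (c n)).
    by rewrite -bE; exact: DE.
  rewrite -kx; have kd : P n (d n ** c n - k *: b' (c n)).
    rewrite (_ : _ - _ = (b (c n) - k *: b' (c n)) - (b (c n) - d n ** c n)); last by zmod.
    exact: primB.
  have := dc n _ kd; rewrite subKr rnormZ => /le_trans; apply.
  rewrite ler_wpM2l ?rnorm_ge0//; apply: (le_trans (rnorm_mulL _ _)).
  by rewrite ler_piMr ?rnorm_ge0.
have b'0 := rnorm_ge0 b'.
(* The extra 1 keeps the denominator positive and makes |f(x_n)| |b'| strictly smaller than 1/4 at
   an n with x_n close to the cluster point. *)
have e0 : 0 < 4^-1 / (rnorm b' + 1) by rewrite divr_gt0// ?invr_gt0// ltr_wpDl.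
have /cvg_rnormP/(_ _ e0) := fc y1; rewrite fy1 => fn.
have xT : (x @ \oo) (range x) by exists 0 => // n _; exists n.
have [_ [[n _ <-] /=]] := y1cl _ _ xT fn; rewrite subr0 ltr_pdivlMr; last by rewrite ltr_wpDl.
have := key n; have := rnorm_ge0 (f (x n)); lra.
Qed.
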